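(* Let $N\ge 2$ and let masses $m_1,\dots,m_N>0$ be given, such that the number of equivalence classes of central configurations for these masses is finite. Suppose that every central configuration for these masses has degree of degeneracy less than or equal to two, and that every central configuration $\mathbf r_0$ (normalized so that $\|\mathbf r_0\|=1$) with degree of degeneracy exactly two satisfies $$a_{555}^2a_{666}^2-6a_{555}a_{556}a_{566}a_{666}+4a_{555}a_{566}^3+4a_{556}^3a_{666}-3a_{556}^2a_{566}^2\neq0 ,$$ where $a_{ijk}=d^3\widetilde{\mathcal U}|_{\mathbf r_0}(\widehat{\mathcal E}_i,\widehat{\mathcal E}_j,\widehat{\mathcal E}_k)$ for $i,j,k\in\{5,6\}$ and $\widehat{\mathcal E}_5,\widehat{\mathcal E}_6$ is an orthonormal basis of $\ker D^2\widetilde{\mathcal U}(\mathbf r_0)\cap\mathcal P_{\mathbf r_0}^{\perp}$. Then for every total collision orbit $\mathbf r(t)$ of the planar $N$-body problem with these masses, the normalized configuration $\widehat{\mathbf r}(t)=\mathbf r(t)/\|\mathbf r(t)\|$ converges to a certain (single) central configuration as $t$ approaches the collision instant.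
   Context: The planar $N$-body problem: $m_k\ddot{\mathbf r}_k=\sum_{j\ne k}\frac{m_km_j(\mathbf r_j-\mathbf r_k)}{|\mathbf r_j-\mathbf r_k|^3}$, $k=1,\dots,N$, $\mathbf r_k\in\mathbb R^2$, with center of mass at the origin. Put $\langle\mathbf r,\mathbf s\rangle=\sum_k m_k(\mathbf r_k,\mathbf s_k)$ (mass scalar product), $\|\mathbf r\|=\sqrt{\langle\mathbf r,\mathbf r\rangle}$, $\mathcal X=\{\mathbf r\in(\mathbb R^2)^N:\sum_k m_k\mathbf r_k=0\}$, $\Delta=\{\mathbf r:\mathbf r_j=\mathbf r_k\text{ for some }j\neq k\}$. Orthogonality and orthonormality refer to $\langle\cdot,\cdot\rangle$. $\mathcal U(\mathbf r)=\sum_{j<k}\frac{m_jm_k}{|\mathbf r_j-\mathbf r_k|}$, $I(\mathbf r)=\|\mathbf r\|^2$ on $\mathcal X$, $\widetilde{\mathcal U}=I^{1/2}\mathcal U$. A central configuration is $\mathbf r\in\mathcal X\setminus\Delta$ such that for some $\lambda\in\mathbb R$, $\sum_{j\ne k}\frac{m_jm_k}{|\mathbf r_j-\mathbf r_k|^3}(\mathbf r_j-\mathbf r_k)=-\lambda m_k\mathbf r_k$ for all $k$; equivalently, a critical point of $\widetilde{\mathcal U}$ on $\mathcal X\setminus\Delta$. Two central configurations are equivalent if one is obtained from the other by $\mathbf r\mapsto\rho A\mathbf r=(\rho A\mathbf r_1,\dots,\rho A\mathbf r_N)$ with $\rho>0$, $A\in SO(2)$. For a central configuration $\mathbf r$,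 $\mathcal P_{\mathbf r}=\{\rho A\mathbf r:\rho>0,A\in SO(2)\}\cup\{0\}$, a 2-dimensional subspace, and $\mathcal P_{\mathbf r}^\perp$ is its orthogonal complement in $\mathcal X$. The Hessian $D^2\widetilde{\mathcal U}(\mathbf r)$ is the symmetric operator on $\mathcal X$ with $d^2\widetilde{\mathcal U}(\mathbf r)(\mathbf u,\mathbf v)=\langle D^2\widetilde{\mathcal U}(\mathbf r)\mathbf u,\mathbf v\rangle$; its kernel always contains $\mathcal P_{\mathbf r}$. The degree of degeneracy of $\mathbf r$ is $n_0=\dim\ker D^2\widetilde{\mathcal U}(\mathbf r)-2$. $d^3\widetilde{\mathcal U}|_{\mathbf r_0}$ is the third-order differential at $\mathbf r_0$ (a symmetric trilinear form). A total collision orbit is a solution $\mathbf r(t)\in\mathcal X\setminus\Delta$ with $\|\mathbf r(t)\|\to0$ as $t$ tends (from one side) to some finite instant, the collision instant. *)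

(* Defs.v *)
From HB Require Import structures.
From mathcomp Require Import all_boot all_order all_algebra.
From mathcomp Require Import all_classical all_reals all_analysis.

Set Implicit Arguments.
Unset Strict Implicit.
Unset Printing Implicit Defensive.

Import Order.TTheory GRing.Theory Num.Theory.
Import numFieldNormedType.Exports.

Local Open Scope classical_set_scope.
Local Open Scope ring_scope.

Section NBody.
Context {R : realType} {N : nat}.

(* A configuration is a matrix whose k-th row is the position of body k. *)
Definition config := 'M[R]_(N, 2).

(* The library norm `|_| on matrices is the sup norm, so the Euclidean norm of
   the plane is defined here; the topologies agree. *)
Definition dot (u v : 'rV[R]_2) : R := \sum_(i < 2) u 0 i * v 0 i.
Definition enorm (u : 'rV[R]_2) : R := Num.sqrt (dot u u).

Implicit Types (m : 'I_N -> R) (r s u v w : config).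

Definition mass_dot m r s : R := \sum_k m k * dot (row k r) (row k s).
Definition mass_norm m r : R := Num.sqrt (mass_dot m r r).

(* The space of configurations with center of mass at the origin. *)
Definition centered m : {vspace config} :=
  lker (linfun (mulmx (\row_k m k) : config -> 'rV[R]_2)).

Lemma mem_centered m r :
  (r \in centered m) = (\sum_k m k *: row k r == 0).
Proof.
rewrite memv_ker lfunE /= mulmx_sum_row.
by congr (_ == 0); apply: eq_bigr => k _; rewrite mxE.
Qed.

Definition collision r : Prop := exists j k, j != k /\ row j r = row k r.

Definition potential m r : R :=
  \sum_(j < N) \sum_(k < N | (j < k)%N)
    m j * m k / enorm (row j r - row k r).

Definition inertia m r : R := mass_norm m r ^+ 2.

(* This formula makes sense on all configurations; only its restriction to
   [centered m] matters, and below it is differentiated only at points of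
   [centered m] in directions of [centered m]. *)
Definition scaled_potential m r : R :=
  Num.sqrt (inertia m r) * potential m r.

Definition central_config m r : Prop :=
  [/\ r \in centered m, ~ collision r &
      exists lambda : R, forall k,
        \sum_(j | j != k)
          (m j * m k / enorm (row j r - row k r) ^+ 3) *: (row j r - row k r) =
        - (lambda * m k) *: row k r].

Definition SO2 : set 'M[R]_2 := [set A | A *m A^T = 1%:M /\ \det A = 1].

(* [act A r] applies A to each body; positions are row vectors. *)
Definition act (A : 'M[R]_2) r : config := r *m A^T.

Definition equiv_config r s : Prop :=
  exists rho (A : 'M[R]_2), [/\ 0 < rho, SO2 A & s = rho *: act A r].

Definition equiv_class r : set config := [set s | equiv_config r s].

Definition central_classes m : set (set config) :=
  [set equiv_class r | r in [set r | central_config m r]].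

Definition homothetic_plane r : set config := equiv_class r `|` [set 0].

Definition diff2 (f : config -> R) r u v : R :=
  'd (fun s => 'd f s v) r u.
Definition diff3 (f : config -> R) r u v w : R :=
  'd (fun s => diff2 f s v w) r u.

(* For positive masses and r without collision, exactly one operator represents
   the second differential; the default value 0 is then never used. *)
Definition hessian m r : 'End(subvs_of (centered m)) :=
  xget 0 [set H : 'End(subvs_of (centered m)) |
    forall x y : subvs_of (centered m),
      diff2 (scaled_potential m) r (vsval x) (vsval y) =
      mass_dot m (vsval (H x)) (vsval y)].

(* The kernel contains the homothetic plane of a central configuration r, so the
   truncated subtraction is exact there. *)
Definition degeneracy_degree m r : nat := (\dim (lker (hessian m r)) - 2)%N.

Definition reduced_kernel m r : set config :=
  [set vsval x | x in [set x : subvs_of (centered m) | x \in lker (hessian m r) /\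
     forall p, homothetic_plane r p -> mass_dot m (vsval x) p = 0]].

Definition orthonormal_basis2 m (S : set config) u v : Prop :=
  [/\ S u /\ S v,
      [/\ mass_dot m u u = 1, mass_dot m v v = 1 & mass_dot m u v = 0] &
      forall w, S w -> exists a b : R, w = a *: u + b *: v].

Definition cubic_nondegenerate m r (e5 e6 : config) : Prop :=
  let a := diff3 (scaled_potential m) r in
  let a555 := a e5 e5 e5 in let a556 := a e5 e5 e6 in
  let a566 := a e5 e6 e6 in let a666 := a e6 e6 e6 in
  a555 ^+ 2 * a666 ^+ 2 - 6 * a555 * a556 * a566 * a666
    + 4 * a555 * a566 ^+ 3 + 4 * a556 ^+ 3 * a666
    - 3 * a556 ^+ 2 * a566 ^+ 2 != 0.

Definition newton_at m (r : R -> config) (t : R) : Prop :=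
  [/\ derivable r t 1, derivable r^`()%classic t 1 &
      forall k, m k *: row k (r^`(2)%classic t) =
        \sum_(j | j != k)
          (m k * m j / enorm (row j (r t) - row k (r t)) ^+ 3) *:
            (row j (r t) - row k (r t))].

Definition solution_on m (D : set R) (r : R -> config) : Prop :=
  forall t, D t -> [/\ r t \in centered m, ~ collision (r t) & newton_at m r t].

Definition total_collision_forward m (r : R -> config) (a T : R) : Prop :=
  [/\ a < T, solution_on m [set t | a < t < T] r &
      mass_norm m (r t) @[t --> T^'-] --> (0 : R)].

Definition total_collision_backward m (r : R -> config) (T b : R) : Prop :=
  [/\ T < b, solution_on m [set t | T < t < b] r &
      mass_norm m (r t) @[t --> T^'+] --> (0 : R)].

Definition normalized m r : config := (mass_norm m r)^-1 *: r.

End NBody.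

Arguments config : clear implicits.

(* Main.v *)
From HB Require Import structures.
From mathcomp Require Import all_boot all_order all_algebra.
From mathcomp Require Import all_classical all_reals all_analysis.
From mathcomp Require Import ring lra.
Require Import Defs.

(**
The scaled potential [f] is constant along similarities, so it is a function of the shape
of a configuration, and central configurations are its critical points. Near a total
collision the shape follows, in a rescaled time, a damped gradient-like flow of [f]. The
difficulty is to exclude that it wanders along a continuum of critical points or spirals
towards one; it is met by a Lojasiewicz inequality
[|f (x) - f (p)| ^ n <= C |grad f (x)| ^ (n + 1)] near each critical shape [p].

Dynamics. In McGehee variables ([mcgehee]) the radial velocity is eventually negative
([inward_speed]), the velocity of the shape stays bounded ([shape_velocity_bounded]), and
an orbit has a Lyapunov function whose rate of growth dominates the squares of the
velocity of the shape and of the gradient of [f] ([lyapunov]). Consequently the shape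
accumulates at some critical point [p] ([collision_gradient_like]). If the gradient
inequality holds at [p], the remaining length of the path of the shape is bounded by a
power of the gap of the Lyapunov function, and the shape converges to [p]
([gradient_like_cvg]).

Gradient inequality. By invariance under similarities it suffices to treat displacements
in the slice orthogonal to [p] and to its image by a quarter turn ([slice_to_lojasiewicz]).
A Lyapunov-Schmidt reduction ([lyapunov_schmidt]) reduces the inequality to a lower bound of
the gradient over a family of points parametrized by the kernel of the Hessian in the slice,
whose dimension is the degree of degeneracy and hence at most two.
- Dimension zero: there is nothing to reduce ([slice_lojasiewicz0]), and [n = 1].
- Dimension two: the hypothesis on the third derivatives says that the discriminant of the
  cubic form on the kernel does not vanish, so that the gradient of this form is of the order
  of the square of the distance ([quadratics_lower], [slice_lojasiewicz2]), and [n = 2].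
- Dimension one: the configurations at which the gradient of [f] points in the kernel
  direction form a curve, the solution of a quadratic system with injective linearization
  ([eqn_inj]), hence given by a convergent power series ([quadratic_curve]). The size of the
  gradient along this curve is an analytic function of one variable, either identically
  zero or comparable to a power ([central_curve]). The first possibility would give
  infinitely many classes of central configurations, against the finiteness hypothesis;
  the second one gives the inequality ([slice_lojasiewicz1]).
*)

Set Implicit Arguments.
Unset Strict Implicit.
Unset Printing Implicit Defensive.

Import Order.TTheory GRing.Theory Num.Theory.
Import numFieldNormedType.Exports.

Local Open Scope classical_set_scope.
Local Open Scope ring_scope.

Local Opaque diff.

(** * Smooth functions *)

(** Wraps ['d f x v]. Freezing the direction makes a second differential an ordinary
  differential of a function, and the lock keeps conversion from unfolding
  differentials. *)
HB.lock Definition pd {R : realType} {V : normedModType R} (v : V) (f : V -> R)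
  (x : V) : R := 'd f x v.

Section SmoothFunctions.
Context {R : realType} {V : normedModType R}.
Implicit Types (f g : V -> R) (x u v : V).

Lemma near_eq_is_diff f g x (df : V -> R) :
  (\near x, f x = g x) -> is_diff x f df -> is_diff x g df.
Proof.
move=> fg [dfx <-]; have [cdf dfE] := (diff_locallyP x f).1 dfx.
have gE : g \o shift x = cst (g x) + 'd f x +o_ 0 id.
  apply/eqaddoP => e e0.
  have H := (eqaddoP _ _ _ _).1 dfE e e0.
  have fg0' : \forall y \near 0, f (y + x) = g (y + x).
    move: (fg); rewrite (near_shift 0) subr0 /=.
    by apply: filterS => y.
  near=> y.
  have : `|(f \o shift x - (cst (f x) + 'd f x)) y| <= e * `|id y|.
    by near: y; exact: H.
  rewrite !fctE /=.
  have -> : f (y + x) = g (y + x) by near: y; exact: fg0'.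
  by rewrite (nbhs_singleton fg).
have dgE : 'd g x = 'd f x :> (V -> R) by apply: diff_unique.
apply: DiffDef; last exact: dgE.
by apply/diff_locallyP; rewrite dgE.
Unshelve. all: by end_near. Qed.

Lemma pdE v f x : pd v f x = 'd f x v.
Proof. by rewrite unlock. Qed.

Lemma pdZ (a : R) v f x : pd (a *: v) f x = a * pd v f x.
Proof. by rewrite !pdE linearZ. Qed.

Lemma pdD u v f x : pd (u + v) f x = pd u f x + pd v f x.
Proof. by rewrite !pdE linearD. Qed.

Lemma is_diff_pd f x (df : V -> R) : is_diff x f df -> forall u, pd u f x = df u.
Proof. by case=> _ E u; rewrite pdE; exact: (congr1 (fun h : V -> R => h u) E). Qed.

Lemma differentiable_pd f x : differentiable f x -> is_diff x f (fun v => pd v f x).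
Proof.
by move=> df; apply: DiffDef => //; apply/funext => v; rewrite pdE.
Qed.

(** A syntactic class, rather than infinite differentiability: it contains the
  potential, and differentiability, stability under directional derivatives and Schwarz
  symmetry all follow by induction on the construction. *)
Inductive smooth (O : set V) : (V -> R) -> Prop :=
| smooth_cst c : smooth O (fun=> c)
| smooth_lin (f : {linear V -> R}) : continuous f -> smooth O f
| smooth_add f g : smooth O f -> smooth O g -> smooth O (fun x => f x + g x)
| smooth_mul f g : smooth O f -> smooth O g -> smooth O (fun x => f x * g x)
| smooth_rsqrt g : smooth O g -> (forall x, O x -> 0 < g x) ->
    smooth O (fun x => (Num.sqrt (g x))^-1)
| smooth_ext f g : smooth O f -> (forall x, O x -> f x = g x) -> smooth O g.

Context {O : set V}.
Hypothesis oO : open O.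

Lemma is_diff_ext f g x (df : V -> R) : O x -> (forall x, O x -> f x = g x) ->
  is_diff x f df -> is_diff x g df.
Proof.
move=> Ox fg; apply: near_eq_is_diff.
have : \near x, O x by exact: open_nbhs_nbhs.
by apply: filterS => y /fg.
Qed.

Lemma is_diff_rsqrt g x (dg : V -> R) : 0 < g x -> is_diff x g dg ->
  is_diff x (fun y => (Num.sqrt (g y))^-1)
    (fun u => - 2^-1 * (Num.sqrt (g x))^-1 ^+ 3 * dg u).
Proof.
move=> gx0 gd.
have s0 : 0 < Num.sqrt (g x) by rewrite sqrtr_gt0.
have ds : is_derive (g x) 1 (fun s : R => (Num.sqrt s)^-1)
    (- 2^-1 * (Num.sqrt (g x))^-1 ^+ 3).
  have h := is_derive1_sqrt gx0.
  apply: DeriveDef; first by apply: derivableV; [rewrite gt_eqF|].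
  rewrite deriveV ?gt_eqF // derive_val /= /GRing.scale /=.
  by field; rewrite gt_eqF.
have dd : is_diff (g x) (fun s : R => (Num.sqrt s)^-1)
    (fun h => - 2^-1 * (Num.sqrt (g x))^-1 ^+ 3 * h).
  apply: DiffDef; first by apply/derivable1_diffP.
  apply/funext => h; rewrite deriv1E // derive1E derive_val.
  by rewrite /GRing.scale /= mulrC.
apply: is_diff_eq (is_diff_comp gd dd) _ => //.
Qed.

Lemma is_diff_fcst (c : R) x : is_diff x (fun=> c) (fun _ : V => 0 : R).
Proof. exact: (is_diff_cst c x). Qed.

Lemma is_diff_fadd f g x (df dg : V -> R) : is_diff x f df -> is_diff x g dg ->
  is_diff x (fun y => f y + g y) (fun u => df u + dg u).
Proof. by move=> fd gd; exact: (is_diffD fd gd). Qed.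

Lemma is_diff_fmul f g x (df dg : V -> R) : is_diff x f df -> is_diff x g dg ->
  is_diff x (fun y => f y * g y) (fun u => f x * dg u + g x * df u).
Proof. by move=> fd gd; exact: (is_diffM fd gd). Qed.

Lemma is_diff_pd_ext f g (df : V -> R) x u : O x -> (forall x, O x -> f x = g x) ->
  is_diff x f df -> pd u g x = df u.
Proof. by move=> Ox fg fd; apply: is_diff_pd; exact: is_diff_ext Ox fg fd. Qed.

(** The differential of an inverse root [r = g ^ (-1/2)] is [- r ^ 3 / 2] times that of
  [g], hence belongs to the class again. *)
Lemma smooth_is_diff f : smooth O f ->
  (forall x, O x -> is_diff x f (fun v => pd v f x)) /\
  (forall v, smooth O (pd v f)).
Proof.
elim=> {f} [c|f fc|f g _ [df sf] _ [dg sg]|f g s1 [df sf] s2 [dg sg]|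
  g s1 [dg sg] g0|f g _ [df sf] fg].
- split=> [x _|v]; first exact/differentiable_pd/differentiable_cst.
  apply: (smooth_ext (smooth_cst _ 0)) => x _.
  by apply/esym; apply: (is_diff_pd (is_diff_cst c x)).
- split=> [x _|v]; first exact/differentiable_pd/linear_differentiable.
  by apply: (smooth_ext (smooth_cst _ (f v))) => x _; rewrite pdE diff_lin.
- have H x : O x -> is_diff x (fun y => f y + g y) (fun u => pd u f x + pd u g x).
    by move=> Ox; apply: is_diff_fadd; [exact: df|exact: dg].
  split=> [x Ox|v]; first by apply: differentiable_pd; have [] := H x Ox.
  apply: (smooth_ext (smooth_add (sf v) (sg v))) => x Ox.
  by rewrite (is_diff_pd (H x Ox)).
- have H x : O x -> is_diff x (fun y => f y * g y)
      (fun u => f x * pd u g x + g x * pd u f x).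
    by move=> Ox; apply: is_diff_fmul; [exact: df|exact: dg].
  split=> [x Ox|v]; first by apply: differentiable_pd; have [] := H x Ox.
  apply: (smooth_ext (smooth_add (smooth_mul s1 (sg v)) (smooth_mul s2 (sf v)))).
  by move=> x Ox; rewrite (is_diff_pd (H x Ox)).
- have H x : O x -> is_diff x (fun y => (Num.sqrt (g y))^-1)
    (fun u => - 2^-1 * (Num.sqrt (g x))^-1 ^+ 3 * pd u g x).
    by move=> Ox; apply: is_diff_rsqrt; [exact: g0|exact: dg].
  split=> [x Ox|v]; first by apply: differentiable_pd; have [] := H x Ox.
  pose r := smooth_rsqrt s1 g0.
  apply: (smooth_ext (smooth_mul (smooth_mul (smooth_cst _ (- 2^-1))
    (smooth_mul r (smooth_mul r r))) (sg v))) => x Ox.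
  by rewrite (is_diff_pd (H x Ox)) !exprS expr0 mulr1.
- have H x : O x -> is_diff x g (fun v => pd v f x).
    by move=> Ox; exact: is_diff_ext Ox fg (df _ Ox).
  split=> [x Ox|v]; first by apply: differentiable_pd; have [] := H x Ox.
  apply: (smooth_ext (sf v)) => x Ox.
  by rewrite (is_diff_pd (H x Ox)).
Qed.

Lemma smooth_diff f x : smooth O f -> O x -> is_diff x f (fun v => pd v f x).
Proof. by move=> /smooth_is_diff[+ _]; exact. Qed.

Lemma smooth_pd f v : smooth O f -> smooth O (pd v f).
Proof. by move=> /smooth_is_diff[_]; exact. Qed.

Lemma smooth_continuous f x : smooth O f -> O x -> {for x, continuous f}.
Proof.
by move=> sf Ox; apply: differentiable_continuous; have [] := smooth_diff sf Ox.
Qed.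

Lemma pd_ext f g x u : O x -> smooth O f -> (forall x, O x -> f x = g x) ->
  pd u f x = pd u g x.
Proof. by move=> Ox sf fg; rewrite (is_diff_pd_ext u Ox fg (smooth_diff sf Ox)). Qed.

Lemma pd_cst w (c : R) x : pd w (fun=> c) x = 0.
Proof. by rewrite pdE diff_cst. Qed.

(** A linear map has zero second differential, and the formulas for the second
  differential of a sum, a product and an inverse root are symmetric when those of the
  arguments are. *)
Lemma smooth_pdC f x u v : smooth O f -> O x ->
  pd u (pd v f) x = pd v (pd u f) x.
Proof.
move=> sf; elim: sf x u v => {f} [c|f fc|f g sf Hf sg Hg|f g sf Hf sg Hg|
  g sg Hg g0|f g sf Hf fg] x u v Ox.
- have E (w : V) : pd w (fun=> c) = cst 0.
    by apply/funext => y; rewrite pd_cst.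
  by rewrite !E !pd_cst.
- have E w : pd w f = cst (f w).
    by apply/funext => y; rewrite pdE diff_lin.
  by rewrite !E !pd_cst.
- have E w y : O y -> pd w f y + pd w g y = pd w (fun y => f y + g y) y.
    by move=> Oy; rewrite (is_diff_pd (is_diff_fadd (smooth_diff sf Oy) (smooth_diff sg Oy))).
  have H a b : pd a (pd b (fun y => f y + g y)) x = pd a (pd b f) x + pd a (pd b g) x.
    by rewrite (is_diff_pd_ext a Ox (E b) (is_diff_fadd
      (smooth_diff (smooth_pd b sf) Ox) (smooth_diff (smooth_pd b sg) Ox))).
  by rewrite !H Hf // Hg.
- have E w y : O y -> f y * pd w g y + g y * pd w f y = pd w (fun y => f y * g y) y.
    by move=> Oy; rewrite (is_diff_pd (is_diff_fmul (smooth_diff sf Oy) (smooth_diff sg Oy))).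
  have H a b : pd a (pd b (fun y => f y * g y)) x =
      (f x * pd a (pd b g) x + pd b g x * pd a f x) +
      (g x * pd a (pd b f) x + pd b f x * pd a g x).
    by rewrite (is_diff_pd_ext a Ox (E b) (is_diff_fadd
      (is_diff_fmul (smooth_diff sf Ox) (smooth_diff (smooth_pd b sg) Ox))
      (is_diff_fmul (smooth_diff sg Ox) (smooth_diff (smooth_pd b sf) Ox)))).
  by rewrite !H Hf // Hg //; ring.
- pose r y : R := (Num.sqrt (g y))^-1.
  have dr y : O y -> is_diff y r (fun w => - 2^-1 * (r y) ^+ 3 * pd w g y).
    by move=> Oy; apply: is_diff_rsqrt; [exact: g0|exact: (smooth_diff sg Oy)].
  pose r3 y : R := r y * (r y * r y).
  have E w y : O y -> - 2^-1 * (r3 y * pd w g y) = pd w r y.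
    by move=> Oy; rewrite (is_diff_pd (dr y Oy)) /r3; ring.
  have H a b : pd a (pd b r) x = - 2^-1 * (r3 x * pd a (pd b g) x) +
      3 / 4 * r x ^+ 5 * (pd a g x * pd b g x).
    have d3 := is_diff_fmul (dr x Ox) (is_diff_fmul (dr x Ox) (dr x Ox)).
    rewrite (is_diff_pd_ext a Ox (E b) (is_diff_fmul (is_diff_fcst (- 2^-1) x)
      (is_diff_fmul d3 (smooth_diff (smooth_pd b sg) Ox)))) /r3.
    by field.
  by rewrite !H Hg //; ring.
- have E w y : O y -> pd w f y = pd w g y by move=> Oy; exact: pd_ext.
  rewrite -(pd_ext _ Ox (smooth_pd v sf) (E v)) -(pd_ext _ Ox (smooth_pd u sf) (E u)).
  exact: Hf.
Qed.

Definition diter (vs : seq V) f : V -> R := foldr (fun v g => pd v g) f vs.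

Lemma smooth_diter vs f : smooth O f -> smooth O (diter vs f).
Proof. by move=> sf; elim: vs => //= v vs IH; exact: smooth_pd. Qed.

Lemma diter_rcons vs v f : diter (rcons vs v) f = diter vs (pd v f).
Proof. by rewrite /diter foldr_rcons. Qed.

(** Schwarz symmetry carries the outermost direction to the innermost place, where it
  can be expanded in coordinates without disturbing the other ones. *)
Lemma diter_cons_rcons v vs f x : smooth O f -> O x ->
  diter (v :: vs) f x = diter (rcons vs v) f x.
Proof.
move=> sf; elim: vs x => [//|w vs IH] x Ox /=.
rewrite smooth_pdC //; last exact: smooth_diter.
rewrite (pd_ext _ Ox _ IH) //.
exact: (smooth_diter (v :: vs)).
Qed.

End SmoothFunctions.

(** * Directional derivatives along segments *)

Section Segment.
Context {R : realType} {V : normedModType R}.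
Implicit Types (f g : V -> R) (x u v : V).

Lemma is_derive_comp f (r : R -> V) (t : R) (dr : V) (df : V -> R) :
  is_derive t (1 : R) r dr -> is_diff (r t) f df ->
  is_derive t (1 : R) (fun s => f (r s)) (df dr).
Proof.
move=> [/derivable1_diffP dfr rE] fd.
have H := is_diff_comp (differentiableP dfr) fd.
have [ex E] := H.
apply: DeriveDef; first by apply/derivable1_diffP.
by rewrite deriveE // E /= -rE deriveE.
Qed.

Lemma is_derive_line x z (s : R) :
  is_derive s (1 : R) (fun s : R => x + s *: z) z.
Proof.
have H := is_diffD (is_diff_cst x s) (is_diff_scalel s z).
have [ex E] := H.
apply: DeriveDef; first by apply/derivable1_diffP.
by rewrite deriveE // E /= add0r scale1r.
Qed.

Context {O : set V}.
Hypothesis oO : open O.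

Lemma smooth_is_derive_line f x z (s : R) : smooth O f -> O (x + s *: z) ->
  is_derive s (1 : R) (fun s : R => f (x + s *: z)) (pd z f (x + s *: z)).
Proof.
move=> sf Ox.
exact: is_derive_comp (is_derive_line x z s) (smooth_diff oO sf Ox).
Qed.

Lemma is_derive_continuous (g : R -> R) (s dg : R) :
  is_derive s (1 : R) g dg -> {for s, continuous g}.
Proof. by move=> [/derivable1_diffP + _]; exact: differentiable_continuous. Qed.

Lemma smooth_MVT f x z : smooth O f -> (forall s : R, 0 <= s <= 1 -> O (x + s *: z)) ->
  exists2 s : R, 0 <= s <= 1 & f (x + z) - f x = pd z f (x + s *: z).
Proof.
move=> sf Oz.
have D (s : R) : 0 <= s <= 1 ->
    is_derive s (1 : R) (fun s : R => f (x + s *: z)) (pd z f (x + s *: z)).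
  by move=> s01; apply: smooth_is_derive_line => //; exact: Oz.
have [||s + E] := @MVT R (fun s => f (x + s *: z)) (fun s => pd z f (x + s *: z)) 0 1 ltr01.
- by move=> s; rewrite in_itv /= => /andP[s0 s1]; apply: D; rewrite !ltW.
- apply: continuous_in_subspaceT => s; rewrite inE /= in_itv /= => s01.
  exact: is_derive_continuous (D s s01).
rewrite in_itv /= => /andP[s0 s1]; exists s; first by rewrite !ltW.
by move: E; rewrite scale1r scale0r addr0 subr0 mulr1.
Qed.

End Segment.

Section MatrixBounds.
Context {R : realType} {a b : nat} {O : set 'M[R]_(a, b)}.
Hypothesis oO : open O.
Implicit Types (f g : 'M[R]_(a, b) -> R) (x u v : 'M[R]_(a, b)).

Lemma mx_norm_le (v : 'M[R]_(a, b)) i j : `|v i j| <= `|v|.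
Proof.
rewrite {2}/Num.Def.normr /= mx_normrE.
exact: (le_bigmax _ (fun i : 'I_a * 'I_b => `|v i.1 i.2|) (i, j)).
Qed.

Lemma pd_sum f x (I : Type) (r : seq I) (P : pred I) (k : I -> R) (v : I -> 'M[R]_(a, b)) :
  pd (\sum_(i <- r | P i) k i *: v i) f x = \sum_(i <- r | P i) k i * pd (v i) f x.
Proof.
by rewrite pdE linear_sum; apply: eq_bigr => i _; rewrite linearZ -pdE.
Qed.

Lemma pd_coord f x v :
  pd v f x = \sum_i \sum_j v i j * pd (delta_mx i j) f x.
Proof.
rewrite {1}(matrix_sum_delta v) pair_big /= pd_sum pair_big /=.
by [].
Qed.

(** Expanding the outermost direction in coordinates and moving it innermost leaves the
  finitely many functions [pd (delta_mx i j) f], to which the bound of the previous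
  order applies. *)
Lemma diter_locally_bounded n f p : smooth O f -> O p ->
  exists2 C : R, 0 <= C & \forall x \near p, forall vs : seq ('M[R]_(a, b)),
    size vs = n -> `|diter vs f x| <= C * \prod_(v <- vs) `|v|.
Proof.
move=> + Op; elim: n f => [|n IH] f sf.
  have cf : {for p, continuous f} by exact: (smooth_continuous oO).
  exists (`|f p| + 1); first by rewrite addr_ge0.
  move: cf => /cvgrPdist_lt/(_ 1 ltr01).
  apply: filterS => x fx [|//] _ /=; rewrite big_nil mulr1.
  rewrite -[f x](subrK (f p)) addrC (le_trans (ler_normD _ _)) // lerD2l.
  by rewrite distrC ltW.
have H (ij : 'I_a * 'I_b) := cid2 (IH (pd (delta_mx ij.1 ij.2) f) (smooth_pd oO _ sf)).
exists (\sum_ij s2val (H ij)).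
  by apply: sumr_ge0 => ij _; exact: (s2valP (H ij)).
have N : \forall x \near p, forall ij, forall vs : seq ('M[R]_(a, b)),
    size vs = n -> `|diter vs (pd (delta_mx ij.1 ij.2) f) x| <=
      s2val (H ij) * \prod_(v <- vs) `|v|.
  have H2 ij := s2valP' (H ij).
  exact: filter_forall H2.
have NO : \forall x \near p, O x by exact: open_nbhs_nbhs.
apply: filterS2 N NO => x Nx Ox [//|v vs] /= [svs].
rewrite pd_coord pair_big /= (le_trans (ler_norm_sum _ _ _)) //.
rewrite big_cons mulr_suml; apply: ler_sum => ij _.
have -> : pd (delta_mx ij.1 ij.2) (diter vs f) x =
    diter vs (pd (delta_mx ij.1 ij.2) f) x.
  by rewrite -diter_rcons -(diter_cons_rcons oO).
rewrite normrM mulrCA; apply: ler_pM => //; first exact: mx_norm_le.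
exact: Nx.
Qed.

End MatrixBounds.

(** * The mass scalar product and rotations *)

Section MassGeometry.
Context {R : realType} {N : nat} {m : 'I_N -> R}.
Hypothesis hm : forall k, 0 < m k.
Implicit Types (r s u v w p x : config R N) (a b : R).
Local Notation dotm := (mass_dot m).
Local Notation nrm := (mass_norm m).

Lemma mass_dotE r s : dotm r s = \sum_k \sum_i m k * (r k i * s k i).
Proof.
rewrite /mass_dot /dot; apply: eq_bigr => k _; rewrite mulr_sumr.
by apply: eq_bigr => i _; rewrite !mxE.
Qed.

Lemma mass_dotC r s : dotm r s = dotm s r.
Proof.
rewrite !mass_dotE; apply: eq_bigr => k _; apply: eq_bigr => i _.
by rewrite [r k i * _]mulrC.
Qed.

Lemma mass_dotDl r s v : dotm (r + s) v = dotm r v + dotm s v.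
Proof.
rewrite !mass_dotE -big_split; apply: eq_bigr => k _.
by rewrite -big_split; apply: eq_bigr => i _; rewrite mxE /=; ring.
Qed.

Lemma mass_dotZl a r s : dotm (a *: r) s = a * dotm r s.
Proof.
rewrite !mass_dotE mulr_sumr; apply: eq_bigr => k _.
by rewrite mulr_sumr; apply: eq_bigr => i _; rewrite mxE /=; ring.
Qed.

Lemma mass_dotNl r s : dotm (- r) s = - dotm r s.
Proof. by rewrite -scaleN1r mass_dotZl mulN1r. Qed.

Lemma mass_dotBl r s v : dotm (r - s) v = dotm r v - dotm s v.
Proof. by rewrite mass_dotDl mass_dotNl. Qed.

Lemma mass_dot0l s : dotm 0 s = 0.
Proof. by rewrite -(scale0r s) mass_dotZl mul0r. Qed.

Lemma mass_dotDr r s v : dotm v (r + s) = dotm v r + dotm v s.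
Proof. by rewrite !(mass_dotC v) mass_dotDl. Qed.

Lemma mass_dotZr a r s : dotm s (a *: r) = a * dotm s r.
Proof. by rewrite !(mass_dotC s) mass_dotZl. Qed.

Lemma mass_dotNr r s : dotm s (- r) = - dotm s r.
Proof. by rewrite !(mass_dotC s) mass_dotNl. Qed.

Lemma mass_dotBr r s v : dotm v (r - s) = dotm v r - dotm v s.
Proof. by rewrite !(mass_dotC v) mass_dotBl. Qed.

Lemma mass_dot0r s : dotm s 0 = 0.
Proof. by rewrite mass_dotC mass_dot0l. Qed.

Definition mdE := (mass_dotDl, mass_dotDr, mass_dotBl, mass_dotBr, mass_dotZl,
  mass_dotZr, mass_dotNl, mass_dotNr, mass_dot0l, mass_dot0r).

Lemma mass_dot_ge0 r : 0 <= dotm r r.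
Proof.
rewrite mass_dotE; do 2 (apply: sumr_ge0 => ? _).
by rewrite mulr_ge0 ?(ltW (hm _)) // -expr2 sqr_ge0.
Qed.

Lemma mass_dot_eq0 r : (dotm r r == 0) = (r == 0).
Proof.
apply/eqP/eqP => [|->]; last exact: mass_dot0l.
have F k i : 0 <= m k * (r k i * r k i).
  by rewrite mulr_ge0 ?(ltW (hm _)) // -expr2 sqr_ge0.
rewrite mass_dotE => /eqP; rewrite psumr_eq0 => [|k _]; last exact: sumr_ge0.
move=> /allP H; apply/matrixP => k i; rewrite mxE.
have := H k (mem_index_enum _); rewrite /= psumr_eq0 // => /allP/(_ i (mem_index_enum _)) /=.
by rewrite mulf_eq0 gt_eqF ?hm //= mulf_eq0 orbb => /eqP.
Qed.

Lemma mass_norm_ge0 r : 0 <= nrm r.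
Proof. exact: sqrtr_ge0. Qed.

Lemma mass_norm2 r : nrm r ^+ 2 = dotm r r.
Proof. by rewrite sqr_sqrtr // mass_dot_ge0. Qed.

Lemma mass_norm_eq0 r : (nrm r == 0) = (r == 0).
Proof. by rewrite -sqrf_eq0 mass_norm2 mass_dot_eq0. Qed.

Lemma mass_norm_gt0 r : (0 < nrm r) = (r != 0).
Proof. by rewrite lt_neqAle mass_norm_ge0 andbT eq_sym mass_norm_eq0. Qed.

Lemma mass_norm0 : nrm 0 = 0 :> R.
Proof. by apply/eqP; rewrite mass_norm_eq0. Qed.

Lemma mass_normZ a r : nrm (a *: r) = `|a| * nrm r.
Proof.
by rewrite /mass_norm !mdE mulrA -expr2 sqrtrM ?sqr_ge0 // sqrtr_sqr.
Qed.

Lemma mass_normN r : nrm (- r) = nrm r.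
Proof. by rewrite -scaleN1r mass_normZ normrN1 mul1r. Qed.

Lemma mass_normB r s : nrm (r - s) = nrm (s - r).
Proof. by rewrite -mass_normN opprB. Qed.

Lemma mass_CS r s : `|dotm r s| <= nrm r * nrm s.
Proof.
have [->|s0] := eqVneq s 0; first by rewrite mass_dot0r normr0 mass_norm0 mulr0.
rewrite -ler_sqr ?nnegrE ?mulr_ge0 ?mass_norm_ge0 // exprMn !mass_norm2.
rewrite -normrX ger0_norm ?sqr_ge0 //.
have ss : 0 < dotm s s by rewrite lt_neqAle mass_dot_ge0 andbT eq_sym mass_dot_eq0.
have := mass_dot_ge0 (dotm s s *: r - dotm r s *: s).
rewrite !mdE (mass_dotC s r) => H.
have {}H : 0 <= dotm s s * (dotm r r * dotm s s - dotm r s ^+ 2).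
  by apply: le_trans H _; rewrite le_eqVlt; apply/orP; left; apply/eqP; ring.
by move: H; rewrite pmulr_rge0 // subr_ge0.
Qed.

Lemma mass_dot_le r s : dotm r s <= nrm r * nrm s.
Proof. exact: le_trans (ler_norm _) (mass_CS r s). Qed.

Lemma mass_normD r s : nrm (r + s) <= nrm r + nrm s.
Proof.
rewrite -ler_sqr ?nnegrE ?addr_ge0 ?mass_norm_ge0 //.
rewrite mass_norm2 !mdE (mass_dotC s r) sqrrD !mass_norm2.
have := mass_dot_le r s; nra.
Qed.

Lemma mass_norm_sum (I : Type) (l : seq I) (P : pred I) (F : I -> config R N) :
  nrm (\sum_(i <- l | P i) F i) <= \sum_(i <- l | P i) nrm (F i).
Proof.
elim/big_rec2: _ => [|i y x _ H]; first by rewrite mass_norm0.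
by apply: le_trans (mass_normD _ _) _; rewrite lerD2l.
Qed.

(** Equivalence of norms in finite dimension; it translates estimates in the mass norm
  into statements about the topology of matrices. *)
Lemma mass_norm_equiv :
  exists2 C : R, 0 < C & forall r, nrm r <= C * `|r| /\ `|r| <= C * nrm r.
Proof.
pose C1 := \sum_(ki : 'I_N * 'I_2) nrm (delta_mx ki.1 ki.2).
pose C2 := \sum_k (Num.sqrt (m k))^-1.
have C1_ge0 : 0 <= C1 by apply: sumr_ge0 => *; exact: mass_norm_ge0.
have C2_ge0 : 0 <= C2 by apply: sumr_ge0 => *; rewrite invr_ge0 sqrtr_ge0.
exists (C1 + C2 + 1) => [|r]; first by rewrite ltr_wpDl // addr_ge0.
split.
  apply: (@le_trans _ _ (C1 * `|r|)); last by rewrite ler_wpM2r // -addrA lerDl addr_ge0.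
  rewrite {1}(matrix_sum_delta r) pair_big /=.
  rewrite (le_trans (mass_norm_sum _ _ _)) // mulr_suml; apply: ler_sum => ki _.
  by rewrite mass_normZ mulrC ler_wpM2l ?mass_norm_ge0 // mx_norm_le.
apply: (@le_trans _ _ (C2 * nrm r)); last first.
  by rewrite ler_wpM2r ?mass_norm_ge0 // addrAC lerDr addr_ge0.
rewrite /Num.Def.normr /= mx_normrE bigmax_le ?mulr_ge0 ?mass_norm_ge0 // => -[k i] _ /=.
have sk : 0 < Num.sqrt (m k) by rewrite sqrtr_gt0.
apply: (@le_trans _ _ ((Num.sqrt (m k))^-1 * nrm r)); last first.
  rewrite ler_wpM2r ?mass_norm_ge0 // /C2 (bigD1 k) //= lerDl.
  by apply: sumr_ge0 => *; rewrite invr_ge0 sqrtr_ge0.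
rewrite mulrC ler_pdivlMr // -ler_sqr ?nnegrE ?mass_norm_ge0 ?mulr_ge0 ?(ltW sk) //.
rewrite mass_norm2 exprMn sqr_sqrtr ?(ltW (hm _)) // real_normK ?num_real //.
rewrite mass_dotE (bigD1 k) //= (bigD1 i) //=.
rewrite -addrA mulrC expr2 lerDl addr_ge0 //.
  by apply: sumr_ge0 => *; rewrite mulr_ge0 ?(ltW (hm _)) // -expr2 sqr_ge0.
by do 2 (apply: sumr_ge0 => ? _);
  rewrite mulr_ge0 ?(ltW (hm _)) // -expr2 sqr_ge0.
Qed.

Lemma near_mass_norm (P : set (config R N)) p :
  (\near p, P p) <-> exists2 e : R, 0 < e & forall x, nrm (x - p) < e -> P x.
Proof.
have [C C0 H] := mass_norm_equiv.
split=> [/nbhs_ballP[e /= e0 He]|[e e0 He]].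
  exists (e / C); first exact: divr_gt0.
  move=> x xp; apply: He; rewrite -ball_normE /= distrC.
  by apply: le_lt_trans (H _).2 _; rewrite mulrC -ltr_pdivlMr.
apply/nbhs_ballP; exists (e / C) => /=; first exact: divr_gt0.
move=> x; rewrite -ball_normE /= distrC => xp; apply: He.
by apply: le_lt_trans (H _).1 _; rewrite mulrC -ltr_pdivlMr.
Qed.

(** Multiplication by the imaginary unit in every copy of the plane. *)
Definition rot r : config R N :=
  \matrix_(k, i) (if i == 0 then - r k 1 else r k 0).

Lemma rotD r s : rot (r + s) = rot r + rot s.
Proof. by apply/matrixP => k i; rewrite !mxE; case: ifP => _; rewrite ?opprD. Qed.

Lemma rotZ a r : rot (a *: r) = a *: rot r.
Proof. by apply/matrixP => k i; rewrite !mxE; case: ifP => _; rewrite ?mulrN. Qed.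

Lemma rotK r : rot (rot r) = - r.
Proof.
apply/matrixP => k i; rewrite !mxE.
by case: (i =P 0) => [->|/eqP i0] /=; [|congr (- r _ _); apply/val_inj; case: i i0 => -[|[|]]].
Qed.

Lemma rot_dotl r s : dotm (rot r) s = - dotm r (rot s).
Proof.
rewrite !mass_dotE -sumrN; apply: eq_bigr => k _.
by rewrite !big_ord_recl !big_ord0 !mxE /=; rewrite (_ : lift ord0 ord0 = 1); [ring|exact/val_inj].
Qed.

Lemma rot_dot r s : dotm (rot r) (rot s) = dotm r s.
Proof. by rewrite rot_dotl rotK mass_dotNr opprK. Qed.

Lemma dot_rot_self r : dotm r (rot r) = 0.
Proof. by have := rot_dotl r r; rewrite mass_dotC; lra. Qed.

End MassGeometry.

(** * Derivatives of sums, roots and coordinates *)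

Section SmoothSums.
Context {R : realType} {V : normedModType R}.
Implicit Types (x u v : V).

Lemma smooth_sum (O : set V) (I : Type) (l : seq I) (P : pred I) (F : I -> V -> R) :
  (forall i, P i -> smooth O (F i)) -> smooth O (fun x => \sum_(i <- l | P i) F i x).
Proof.
move=> sF; elim: l => [|i l IH].
  by apply: (smooth_ext (smooth_cst O 0)) => x _; rewrite big_nil.
case Pi: (P i); last by apply: (smooth_ext IH) => x _; rewrite big_cons Pi.
by apply: (smooth_ext (smooth_add (sF i Pi) IH)) => x _; rewrite big_cons Pi.
Qed.

Lemma is_diff_eqfun (f g df dg : V -> R) x : f =1 g -> df =1 dg ->
  is_diff x f df -> is_diff x g dg.
Proof. by move=> /funext <- /funext <-. Qed.

Lemma is_diff_fsum (I : Type) (l : seq I) (P : pred I) (F dF : I -> V -> R) x :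
  (forall i, P i -> is_diff x (F i) (dF i)) ->
  is_diff x (fun x => \sum_(i <- l | P i) F i x) (fun v => \sum_(i <- l | P i) dF i v).
Proof.
move=> H; elim: l => [|i l IH].
  by apply: is_diff_eqfun (is_diff_fcst 0 x) => v; rewrite big_nil.
case Pi: (P i); last by apply: is_diff_eqfun IH => v; rewrite big_cons Pi.
by apply: is_diff_eqfun (is_diff_fadd (H i Pi) IH) => v; rewrite big_cons Pi.
Qed.

Lemma is_diff_fsqrt (g : V -> R) x (dg : V -> R) : 0 < g x -> is_diff x g dg ->
  is_diff x (fun y => Num.sqrt (g y)) (fun u => dg u / (2 * Num.sqrt (g x))).
Proof.
move=> gx0 gd; have ds := is_derive1_sqrt gx0.
have dd : is_diff (g x) Num.sqrt (fun h : R => h / (2 * Num.sqrt (g x))).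
  apply: DiffDef; first by apply/derivable1_diffP; have [] := ds.
  apply/funext => h; rewrite deriv1E; last by have [] := ds.
  by rewrite derive1E derive_val.
exact: is_diff_eq (is_diff_comp gd dd) _.
Qed.

End SmoothSums.

Section MxCoord.
Context {R : realType} {a b : nat}.

Lemma is_diff_mxcoord (x : 'M[R]_(a, b)) i j : is_diff x (fun r => r i j : R) (fun v => v i j).
Proof.
have @f : {linear 'M[R]_(a, b) -> R}.
  by exists (fun N : 'M[R]_(_, _) => N i j); do 2![eexists]; do ?[constructor];
     rewrite ?mxE// => ? *; rewrite ?mxE//; move=> ?; rewrite !mxE.
have cf : continuous f by exact: coord_continuous.
apply: DiffDef; first exact: (@linear_differentiable _ _ _ f x cf).
exact: (@diff_lin _ _ _ f x cf).
Qed.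

Lemma smooth_mxcoord (O : set 'M[R]_(a, b)) i j : smooth O (fun r => r i j).
Proof.
have @f : {linear 'M[R]_(a, b) -> R}.
  by exists (fun N : 'M[R]_(_, _) => N i j); do 2![eexists]; do ?[constructor];
     rewrite ?mxE// => ? *; rewrite ?mxE//; move=> ?; rewrite !mxE.
have cf : continuous f by exact: coord_continuous.
exact: smooth_lin cf.
Qed.
End MxCoord.

Section Dot.
Context {R : realType}.
Implicit Types (u v w : 'rV[R]_2).

Lemma dotE u v : dot u v = u 0 0 * v 0 0 + u 0 1 * v 0 1.
Proof.
by rewrite /dot !big_ord_recl big_ord0 addr0 (_ : lift ord0 ord0 = 1) //; exact/val_inj.
Qed.
Lemma dotC u v : dot u v = dot v u.
Proof. by rewrite !dotE; ring. Qed.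
Lemma dotDl u v w : dot (u + v) w = dot u w + dot v w.
Proof. by rewrite !dotE !mxE; ring. Qed.
Lemma dotDr u v w : dot w (u + v) = dot w u + dot w v.
Proof. by rewrite !dotE !mxE; ring. Qed.
Lemma dotZl k u w : dot (k *: u) w = k * dot u w.
Proof. by rewrite !dotE !mxE; ring. Qed.
Lemma dotZr k u w : dot w (k *: u) = k * dot w u.
Proof. by rewrite !dotE !mxE; ring. Qed.
Lemma dotNl u w : dot (- u) w = - dot u w.
Proof. by rewrite !dotE !mxE; ring. Qed.
Lemma dotNr u w : dot w (- u) = - dot w u.
Proof. by rewrite !dotE !mxE; ring. Qed.
Lemma dot0l w : dot 0 w = 0.
Proof. by rewrite !dotE !mxE; ring. Qed.
Lemma dot0r w : dot w 0 = 0.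
Proof. by rewrite !dotE !mxE; ring. Qed.
Lemma dot_suml (I : Type) (l : seq I) (P : pred I) (F : I -> 'rV[R]_2) w :
  dot (\sum_(i <- l | P i) F i) w = \sum_(i <- l | P i) dot (F i) w.
Proof.
by elim/big_rec2: _ => [|i x y _ <-]; [rewrite dot0l|rewrite dotDl].
Qed.
Lemma dot_ge0 u : 0 <= dot u u.
Proof. by rewrite dotE addr_ge0 // -expr2 sqr_ge0. Qed.
Lemma dot_eq0 u : (dot u u == 0) = (u == 0).
Proof.
apply/eqP/eqP => [|->]; last exact: dot0l.
rewrite dotE => H.
have [H0 H1] : u 0 0 = 0 /\ u 0 1 = 0 by split; nra.
apply/rowP => i; rewrite mxE; case: i => -[|[|//]] hi.
  by rewrite -[RHS]H0; congr (u _ _); exact/val_inj.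
by rewrite -[RHS]H1; congr (u _ _); exact/val_inj.
Qed.
Lemma dot_gt0 u : (0 < dot u u) = (u != 0).
Proof. by rewrite lt_neqAle dot_ge0 andbT eq_sym dot_eq0. Qed.
Lemma enorm2 u : enorm u ^+ 2 = dot u u.
Proof. by rewrite sqr_sqrtr // dot_ge0. Qed.
Lemma enorm_ge0 u : 0 <= enorm u. Proof. exact: sqrtr_ge0. Qed.
Lemma enorm_gt0 u : (0 < enorm u) = (u != 0).
Proof. by rewrite sqrtr_gt0 dot_gt0. Qed.
Lemma dot_CS u v : `|dot u v| <= enorm u * enorm v.
Proof.
rewrite -ler_sqr ?nnegrE ?mulr_ge0 ?enorm_ge0 // exprMn !enorm2 -normrX ger0_norm ?sqr_ge0 //.
rewrite !dotE -subr_ge0.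
apply: le_trans (sqr_ge0 (u 0 0 * v 0 1 - u 0 1 * v 0 0)) _.
by rewrite le_eqVlt; apply/orP; left; apply/eqP; ring.
Qed.
End Dot.

(** * The Newtonian potential *)

Section Potential.
Context {R : realType} {N : nat} {m : 'I_N -> R}.
Hypothesis hm : forall k, 0 < m k.
Implicit Types (r s u v w p x : config R N) (a b : R) (j k : 'I_N).
Local Notation U := (potential m).

Definition noncoll : set (config R N) := [set r | ~ collision r].

Definition sep j k r : 'rV[R]_2 := row j r - row k r.

Definition isep j k r : R := (enorm (sep j k r))^-1.

Lemma sepD j k r s : sep j k (r + s) = sep j k r + sep j k s.
Proof. by apply/rowP => i; rewrite !mxE; ring. Qed.
Lemma sepZ j k a r : sep j k (a *: r) = a *: sep j k r.
Proof. by apply/rowP => i; rewrite !mxE; ring. Qed.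

Lemma sepC j k r : sep k j r = - sep j k r.
Proof. by rewrite /sep opprB. Qed.
Lemma isepC j k r : isep k j r = isep j k r.
Proof. by rewrite /isep sepC /enorm dotNl dotNr opprK. Qed.

Lemma noncoll_sep r j k : noncoll r -> j != k -> sep j k r != 0.
Proof.
move=> nr jk; rewrite subr_eq0; apply/eqP => E; apply: nr.
by exists j, k.
Qed.

Lemma noncollP r : (forall j k, j != k -> sep j k r != 0) -> noncoll r.
Proof.
by move=> H [j [k [jk E]]]; have := H j k jk; rewrite /sep E subrr eqxx.
Qed.

Lemma noncoll_dot r j k : noncoll r -> j != k -> 0 < dot (sep j k r) (sep j k r).
Proof. by move=> nr jk; rewrite dot_gt0 noncoll_sep. Qed.

Lemma isep_gt0 r j k : noncoll r -> j != k -> 0 < isep j k r.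
Proof. by move=> nr jk; rewrite invr_gt0 enorm_gt0 noncoll_sep. Qed.

Lemma is_diff_sep2 r j k : is_diff r (fun r => dot (sep j k r) (sep j k r))
  (fun v => 2 * dot (sep j k r) (sep j k v)).
Proof.
pose F i r := r j i - r k i : R; pose dF i v := v j i - v k i : R.
have E (i : 'I_2) s : sep j k s 0 i = F i s by rewrite !mxE.
have D i : is_diff r (F i) (F i).
  apply: is_diff_eqfun (is_diff_fadd (is_diff_mxcoord r j i)
    (is_diff_fmul (is_diff_fcst (-1) r) (is_diff_mxcoord r k i))) => v;
  by rewrite /F; ring.
apply: is_diff_eqfun (is_diff_fadd (is_diff_fmul (D 0) (D 0)) (is_diff_fmul (D 1) (D 1))) => v;
  by rewrite !dotE !E; ring.
Qed.

Lemma smooth_sep2 (O : set (config R N)) j k :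
  smooth O (fun r => dot (sep j k r) (sep j k r)).
Proof.
pose F i r := r j i + -1 * r k i : R.
have D i : smooth O (F i).
  apply: smooth_add; first exact: smooth_mxcoord.
  by apply: smooth_mul; [exact: smooth_cst|exact: smooth_mxcoord].
apply: (smooth_ext (smooth_add (smooth_mul (D 0) (D 0)) (smooth_mul (D 1) (D 1)))) => x _.
by rewrite dotE !mxE /F; ring.
Qed.

Lemma noncoll_open : open noncoll.
Proof.
rewrite openE => r nr; rewrite /interior.
have H (jk : 'I_N * 'I_N) : \forall x \near r, jk.1 != jk.2 -> sep jk.1 jk.2 x != 0.
  case: (eqVneq jk.1 jk.2) => [_|jk']; first by near=> x.
  have /differentiable_continuous : differentiable
    (fun r => dot (sep jk.1 jk.2 r) (sep jk.1 jk.2 r)) r.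
    by have [] := is_diff_sep2 r jk.1 jk.2.
  move=> /cvgr_gt/(_ 0 (noncoll_dot nr jk')).
  by apply: filterS => x /=; rewrite dot_gt0.
have H' : \forall x \near r, forall jk : 'I_N * 'I_N,
    jk.1 != jk.2 -> sep jk.1 jk.2 x != 0 by exact: filter_forall H.
apply: filterS H' => x Hx.
by apply: noncollP => j k; exact: (Hx (j, k)).
Unshelve. all: by end_near. Qed.

Lemma is_diff_isep r j k : noncoll r -> j != k ->
  is_diff r (isep j k) (fun v => - isep j k r ^+ 3 * dot (sep j k r) (sep j k v)).
Proof.
move=> nr jk; have := @is_diff_rsqrt _ _ (fun r => dot (sep j k r) (sep j k r)) _ _
  (noncoll_dot nr jk) (is_diff_sep2 r j k).
apply: is_diff_eqfun => v; first exact: erefl.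
by rewrite /isep /enorm; set x := (Num.sqrt _)^-1; field.
Qed.

Lemma smooth_isep j k : j != k -> smooth noncoll (isep j k).
Proof.
move=> jk; apply: smooth_rsqrt; first exact: smooth_sep2.
by move=> x nx; exact: noncoll_dot.
Qed.

Let ltn_neq j k : (j < k)%N -> j != k.
Proof. by move=> jk; rewrite -val_eqE /= neq_ltn jk. Qed.

Lemma smooth_potential : smooth noncoll U.
Proof.
apply: smooth_sum => j _; apply: smooth_sum => k /ltn_neq jk.
by apply: smooth_mul; [exact: smooth_cst|exact: smooth_isep].
Qed.

Lemma is_diff_potential r : noncoll r ->
  is_diff r U (fun v => \sum_(j < N) \sum_(k < N | (j < k)%N)
    - (m j * m k * isep j k r ^+ 3) * dot (sep j k r) (sep j k v)).
Proof.
move=> nr.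
have H j k : (j < k)%N -> is_diff r (fun r => m j * m k / enorm (row j r - row k r))
   (fun v => - (m j * m k * isep j k r ^+ 3) * dot (sep j k r) (sep j k v)).
  move=> /ltn_neq jk.
  apply: is_diff_eqfun (is_diff_fmul (is_diff_fcst (m j * m k) r) (is_diff_isep nr jk)) => v //.
  by ring.
apply: is_diff_fsum => j _; apply: is_diff_fsum => k jk; exact: H.
Qed.

Lemma pd_potential_pairs r v : noncoll r -> pd v U r = \sum_(j < N) \sum_(k < N | (j < k)%N)
    - (m j * m k * isep j k r ^+ 3) * dot (sep j k r) (sep j k v).
Proof. by move=> nr; rewrite (is_diff_pd (is_diff_potential nr)). Qed.

(** Turns the sum over pairs defining the potential into the forces acting on each body.
  *)
Lemma sum_pairs (A : 'I_N -> 'I_N -> R) :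
  \sum_(j < N) \sum_(k < N | (j < k)%N) (A j k + A k j) = \sum_k \sum_(j | j != k) A j k.
Proof.
have E k : \sum_(j | j != k) A j k = \sum_(j < N | (j < k)%N) A j k + \sum_(j < N | (k < j)%N) A j k.
  rewrite (bigID (fun j : 'I_N => (j < k)%N)) /=; congr (_ + _); apply: eq_bigl => j.
    by rewrite -val_eqE /= neq_ltn; case: ltngtP.
  by rewrite -val_eqE /= neq_ltn; case: ltngtP.
rewrite (eq_bigr _ (fun k _ => E k)) big_split /=.
under eq_bigr do rewrite big_split.
rewrite big_split /=; congr (_ + _).
by rewrite (exchange_big_dep xpredT).
Qed.

Lemma pd_potential r v : noncoll r -> pd v U r = \sum_k \sum_(j | j != k)
    (m j * m k * isep j k r ^+ 3) * dot (sep j k r) (row k v).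
Proof.
move=> nr; rewrite pd_potential_pairs // -sum_pairs; apply: eq_bigr => j _.
apply: eq_bigr => k _; rewrite (isepC j k) (sepC j k) {2}/sep dotDr !dotNr dotNl.
by ring.
Qed.

Lemma pd_potential2 r v w : noncoll r -> pd w (pd v U) r = \sum_k \sum_(j | j != k)
    m j * m k * (isep j k r ^+ 3 * dot (sep j k w) (row k v)
      - 3 * isep j k r ^+ 5 * dot (sep j k r) (sep j k w) * dot (sep j k r) (row k v)).
Proof.
move=> nr.
have E x : noncoll x -> \sum_k \sum_(j | j != k)
    (m j * m k * isep j k x ^+ 3) * dot (sep j k x) (row k v) = pd v U x.
  by move=> nx; rewrite pd_potential.
suff D : is_diff r (fun x => \sum_k \sum_(j | j != k)
      (m j * m k * isep j k x ^+ 3) * dot (sep j k x) (row k v))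
    (fun w => \sum_k \sum_(j | j != k)
    m j * m k * (isep j k r ^+ 3 * dot (sep j k w) (row k v)
      - 3 * isep j k r ^+ 5 * dot (sep j k r) (sep j k w) * dot (sep j k r) (row k v))).
  exact: (is_diff_pd_ext noncoll_open w nr E D).
apply: is_diff_fsum => k _; apply: is_diff_fsum => j jk.
have D1 : is_diff r (fun x => dot (sep j k x) (row k v)) (fun w => dot (sep j k w) (row k v)).
  have D i : is_diff r (fun x => sep j k x 0 i) (fun x => sep j k x 0 i).
    apply: is_diff_eqfun (is_diff_fadd (is_diff_mxcoord r j i)
      (is_diff_fmul (is_diff_fcst (-1) r) (is_diff_mxcoord r k i))) => x;
    by rewrite !mxE; ring.
  apply: is_diff_eqfun (is_diff_fadd (is_diff_fmul (is_diff_fcst (row k v 0 0) r) (D 0))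
    (is_diff_fmul (is_diff_fcst (row k v 0 1) r) (D 1))) => x;
  by rewrite dotE; ring.
have Di := is_diff_isep nr jk.
have := is_diff_fmul (is_diff_fmul (is_diff_fcst (m j * m k) r)
  (is_diff_fmul Di (is_diff_fmul Di Di))) D1.
apply: is_diff_eqfun => x; rewrite /=; ring.
Qed.

Lemma pd_potential_translation r v : noncoll r -> (forall j k, row j v = row k v) ->
  pd v U r = 0.
Proof.
move=> nr H; rewrite pd_potential_pairs //; rewrite big1 // => j _; rewrite big1 // => k _.
by rewrite /sep (H j k) subrr dot0r mulr0.
Qed.

Lemma potential_ge0 r : 0 <= U r.
Proof.
apply: sumr_ge0 => j _; apply: sumr_ge0 => k _.
by rewrite divr_ge0 ?enorm_ge0 // mulr_ge0 // ltW.
Qed.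

Lemma isep_le_potential r j k : j != k -> m j * m k * isep j k r <= U r.
Proof.
wlog jk : j k / (j < k)%N => [H|_].
  move=> jk; have := jk; rewrite -val_eqE /= neq_ltn => /orP[/H|/H]; first exact.
  by rewrite isepC (mulrC (m k)) => ->//; rewrite eq_sym.
have P j' k' : 0 <= m j' * m k' / enorm (row j' r - row k' r).
  by rewrite divr_ge0 ?enorm_ge0 // mulr_ge0 // ltW.
rewrite /potential (bigD1 j) //= (bigD1 k) //= -addrA lerDl addr_ge0 //.
  exact: sumr_ge0.
by apply: sumr_ge0 => ? _; exact: sumr_ge0.
Qed.

End Potential.

(** * The scaled potential and its symmetries *)

Section ScaledPotential.
Context {R : realType} {N : nat} {m : 'I_N -> R}.
Hypothesis hm : forall k, 0 < m k.
Hypothesis hN : (2 <= N)%N.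
Implicit Types (r s u v w p x z : config R N) (a b : R) (j k : 'I_N).
Local Notation dotm := (mass_dot m).
Local Notation nrm := (mass_norm m).
Local Notation U := (potential m).
Local Notation f := (scaled_potential m).
Local Notation O := (@noncoll R N).
Let oO : open O := @noncoll_open R N.

Lemma noncoll_neq0 r : O r -> r != 0.
Proof.
move=> nr; pose j : 'I_N := Ordinal (ltn_trans (ltn0Sn 0) hN).
pose k : 'I_N := Ordinal hN; have jk : j != k by [].
apply/eqP => E; have := noncoll_sep nr jk.
by rewrite E -(scale0r 0) sepZ scale0r eqxx.
Qed.

Lemma noncoll_norm r : O r -> 0 < nrm r.
Proof. by move=> /noncoll_neq0; rewrite mass_norm_gt0. Qed.

Lemma noncoll_mass_dot r : O r -> 0 < dotm r r.
Proof. by move=> nr; rewrite -mass_norm2 // exprn_gt0 // noncoll_norm. Qed.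

Lemma scaled_potentialE r : f r = nrm r * U r.
Proof. by rewrite /scaled_potential /inertia sqrtr_sqr ger0_norm ?mass_norm_ge0. Qed.

Lemma is_diff_mass_dot r : is_diff r (fun r => dotm r r) (fun v => 2 * dotm r v).
Proof.
have H : is_diff r (fun r => \sum_k \sum_i m k * (r k i * r k i))
    (fun v => \sum_k \sum_i m k * (2 * (r k i * v k i))).
  apply: is_diff_fsum => k _; apply: is_diff_fsum => i _.
  have D := is_diff_mxcoord r k i.
  by apply: is_diff_eqfun (is_diff_fmul (is_diff_fcst (m k) r) (is_diff_fmul D D)) => v //;
     ring.
apply: is_diff_eqfun H => v; rewrite mass_dotE // mulr_sumr; apply: eq_bigr => k _.
by rewrite mulr_sumr; apply: eq_bigr => i _; ring.
Qed.

Lemma smooth_mass_dot : smooth O (fun r => dotm r r).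
Proof.
have H : smooth O (fun r => \sum_k \sum_i m k * (r k i * r k i)).
  apply: smooth_sum => k _; apply: smooth_sum => i _.
  apply: smooth_mul; first exact: smooth_cst.
  by apply: smooth_mul; exact: smooth_mxcoord.
by apply: smooth_ext H _ => x _; rewrite mass_dotE.
Qed.

Lemma smooth_scaled_potential : smooth O f.
Proof.
have H := smooth_mul (smooth_mul smooth_mass_dot
  (smooth_rsqrt smooth_mass_dot noncoll_mass_dot)) (@smooth_potential R N m).
apply: smooth_ext H _ => x nx /=.
have n0 := noncoll_norm nx.
rewrite scaled_potentialE -(mass_norm2 hm) sqrtr_sqr ger0_norm ?mass_norm_ge0 //.
by field; rewrite gt_eqF.
Qed.

Lemma pd_scaled_potential r v : O r ->
  pd v f r = dotm r v / nrm r * U r + nrm r * pd v U r.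
Proof.
move=> nr; have n0 := noncoll_norm nr.
have D1 := @is_diff_fsqrt _ _ (fun r => dotm r r) _ _ (noncoll_mass_dot nr) (is_diff_mass_dot r).
have D2 := smooth_diff oO (@smooth_potential R N m) nr.
have D : is_diff r f (fun v => dotm r v / nrm r * U r + nrm r * pd v U r).
  apply: is_diff_eqfun (is_diff_fmul D1 D2) => x.
    by rewrite scaled_potentialE.
  by rewrite -/(nrm r); field; rewrite gt_eqF.
by rewrite (is_diff_pd D).
Qed.

(** Multiplication by the complex number [a + b i]. *)
Definition simil a b x : config R N := a *: x + b *: rot x.

Lemma similD a b x z : simil a b (x + z) = simil a b x + simil a b z.
Proof. by rewrite /simil rotD !scalerDr addrACA. Qed.

Lemma similZ a b t x : simil a b (t *: x) = t *: simil a b x.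
Proof. by rewrite /simil rotZ scalerDr !scalerA (mulrC a) (mulrC b). Qed.

Lemma similM a b a' b' x :
  simil a b (simil a' b' x) = simil (a * a' - b * b') (a * b' + b * a') x.
Proof.
rewrite /simil rotD !rotZ rotK; move: (rot x) => y.
by apply/matrixP => k i; rewrite !mxE; ring.
Qed.

Lemma simil1 x : simil 1 0 x = x.
Proof. by rewrite /simil scale1r scale0r addr0. Qed.

Lemma mass_dot_simil a b x z :
  dotm (simil a b x) (simil a b z) = (a ^+ 2 + b ^+ 2) * dotm x z.
Proof.
by rewrite /simil !mdE !rot_dotl rotK !mdE; ring.
Qed.

Lemma mass_norm_simil a b x : nrm (simil a b x) = Num.sqrt (a ^+ 2 + b ^+ 2) * nrm x.
Proof. by rewrite /mass_norm mass_dot_simil sqrtrM // addr_ge0 ?sqr_ge0. Qed.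

Lemma enorm_sep_simil a b j k x :
  enorm (sep j k (simil a b x)) = Num.sqrt (a ^+ 2 + b ^+ 2) * enorm (sep j k x).
Proof.
rewrite /enorm -sqrtrM ?addr_ge0 ?sqr_ge0 //; congr Num.sqrt.
by rewrite !dotE !mxE /=; ring.
Qed.

Lemma noncoll_simil a b x : 0 < a ^+ 2 + b ^+ 2 -> O x -> O (simil a b x).
Proof.
move=> ab nx; apply: noncollP => j k jk.
by rewrite -enorm_gt0 enorm_sep_simil; apply: mulr_gt0;
  [rewrite sqrtr_gt0|rewrite enorm_gt0 noncoll_sep].
Qed.

Lemma potential_simil a b x : U (simil a b x) = (Num.sqrt (a ^+ 2 + b ^+ 2))^-1 * U x.
Proof.
rewrite /potential mulr_sumr; apply: eq_bigr => j _; rewrite mulr_sumr; apply: eq_bigr => k _.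
by rewrite -!/(sep j k _) enorm_sep_simil invfM; ring.
Qed.

Lemma scaled_potential_simil a b x : 0 < a ^+ 2 + b ^+ 2 -> f (simil a b x) = f x.
Proof.
move=> ab; have s0 : 0 < Num.sqrt (a ^+ 2 + b ^+ 2) by rewrite sqrtr_gt0.
rewrite !scaled_potentialE mass_norm_simil potential_simil.
by field; rewrite gt_eqF.
Qed.

(** The derivatives in the directions of the symmetries are read off from the
  restriction to a line, on which the function is constant or explicit. *)
Lemma pd_line_eq (g : config R N -> R) (h : R -> R) x v dh : smooth O g -> O x ->
  (\forall t \near (0 : R), g (x + t *: v) = h t) -> is_derive (0 : R) (1 : R) h dh ->
  pd v g x = dh.
Proof.
move=> sg Ox E [_ <-].
have Ox0 : O (x + (0 : R) *: v) by rewrite scale0r addr0.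
have D := smooth_is_derive_line oO sg Ox0.
have [_] := near_eq_is_derive E D; rewrite scale0r addr0 => <- //.
Qed.

Lemma pd_scaled_potential_self x : O x -> pd x f x = 0.
Proof.
move=> Ox; apply: (pd_line_eq (h := fun=> f x) smooth_scaled_potential Ox _ (is_derive_cst _ _ _)).
near=> t.
have -> : x + t *: x = simil (1 + t) 0 x by rewrite /simil scale0r addr0 scalerDl scale1r.
rewrite scaled_potential_simil //.
have : -1 < t by near: t; apply: lt_nbhsr; rewrite oppr_lt0.
by nra.
Unshelve. all: by end_near. Qed.

Lemma pd_scaled_potential_rot x : O x -> pd (rot x) f x = 0.
Proof.
move=> Ox; apply: (pd_line_eq (h := fun=> f x) smooth_scaled_potential Ox _ (is_derive_cst _ _ _)).
near=> t.
have -> : x + t *: rot x = simil 1 t x by rewrite /simil scale1r.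
by rewrite scaled_potential_simil // expr1n ltr_wpDr // sqr_ge0.
Unshelve. all: by end_near. Qed.

Lemma pd_scaled_potential_simil a b x v : 0 < a ^+ 2 + b ^+ 2 -> O x ->
  pd (simil a b v) f (simil a b x) = pd v f x.
Proof.
move=> ab Ox; apply: (pd_line_eq (h := fun t => f (x + t *: v)) smooth_scaled_potential).
- exact: noncoll_simil.
- by near=> t; rewrite -similZ -similD scaled_potential_simil.
- have Ox0 : O (x + (0 : R) *: v) by rewrite scale0r addr0.
  by have := smooth_is_derive_line oO smooth_scaled_potential Ox0; rewrite scale0r addr0.
Unshelve. all: by end_near. Qed.

Definition translation v : Prop := forall j k, row j v = row k v.

(** Centering is proved below by testing against translations, along which the potential
  is constant. *)
Lemma centeredP x : reflect (forall v, translation v -> dotm x v = 0) (x \in centered m).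
Proof.
rewrite mem_centered; apply: (iffP eqP) => [E v tv|H].
  pose k : 'I_N := Ordinal hN.
  have -> : dotm x v = dot (\sum_k m k *: row k x) (row k v).
    rewrite dot_suml /mass_dot; apply: eq_bigr => j _.
    by rewrite dotZl (tv j k).
  by rewrite E dot0l.
pose t : config R N := \matrix_(k, i) (\sum_j m j *: row j x) 0 i.
have Rt k : row k t = \sum_j m j *: row j x by apply/rowP => i; rewrite !mxE.
have tt : translation t by move=> j k; rewrite !Rt.
have := H t tt.
have -> : dotm x t = dot (\sum_k m k *: row k x) (\sum_k m k *: row k x).
  rewrite [RHS]dot_suml /mass_dot; apply: eq_bigr => j _.
  by rewrite dotZl Rt.
by move/eqP; rewrite dot_eq0 => /eqP.
Qed.

Lemma rot_translation v : translation v -> translation (rot v).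
Proof.
move=> tv j k; apply/rowP => i; have /rowP := tv j k => E.
by have := E 0; have := E 1; rewrite !mxE => -> ->.
Qed.

Lemma centered_rot x : x \in centered m -> rot x \in centered m.
Proof.
move=> /centeredP cx; apply/centeredP => v tv.
by rewrite rot_dotl cx ?oppr0 //; exact: rot_translation.
Qed.

Lemma pd_scaled_potential_translation x v : O x -> x \in centered m -> translation v ->
  pd v f x = 0.
Proof.
move=> Ox /centeredP cx tv; rewrite pd_scaled_potential // cx // mul0r mul0r add0r.
by rewrite pd_potential_translation // mulr0.
Qed.

(** The gradient for the mass scalar product. *)
Definition grad (g : config R N -> R) x : config R N :=
  \matrix_(k, i) ((m k)^-1 * pd (delta_mx k i) g x).

Lemma gradE g x v : dotm (grad g x) v = pd v g x.
Proof.
rewrite mass_dotE pd_coord; apply: eq_bigr => k _; apply: eq_bigr => i _.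
by rewrite mxE; field; rewrite gt_eqF.
Qed.

(** The weak form is the one that comes out of the variational arguments; the force on
  one body is recovered by moving that body alone. *)
Lemma central_configP p (lambda : R) : O p -> p \in centered m ->
  (forall v, pd v U p = - lambda * dotm p v) -> central_config m p.
Proof.
move=> Op cp H; split => //; exists lambda => k.
apply/rowP => i.
have := H (delta_mx k i); rewrite pd_potential //.
have rz j : j != k -> row j (delta_mx k i : config R N) = 0.
  by move=> jk; apply/rowP => l; rewrite !mxE (negbTE jk).
rewrite (bigD1 k) //= [X in _ + X]big1 ?addr0; last first.
  by move=> j jk; rewrite big1 // => l _; rewrite rz // dot0r mulr0.
have dr (u : 'rV[R]_2) : dot u (row k (delta_mx k i : config R N)) = u 0 i.
  rewrite /dot (bigD1 i) //= big1 ?addr0; last first.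
    by move=> j ji; rewrite !mxE (negbTE ji) andbF mulr0.
  by rewrite !mxE !eqxx mulr1.
rewrite /mass_dot [in RHS](bigD1 k) //= [X in _ * (_ + X)]big1 ?addr0; last first.
  by move=> j jk; rewrite rz // dot0r mulr0.
rewrite dr => E.
rewrite summxE !mxE.
have -> : - (lambda * m k) * p k i = - lambda * (m k * row k p 0 i) by rewrite !mxE; ring.
rewrite -E; apply: eq_bigr => j jk.
by rewrite dr !mxE /isep exprVn.
Qed.

Lemma crit_central_config p : O p -> p \in centered m -> grad f p = 0 ->
  central_config m p.
Proof.
move=> Op cp G0; have n0 := noncoll_norm Op.
apply: (@central_configP p (U p / nrm p ^+ 2)) => // v.
have := gradE f p v; rewrite G0 mass_dot0l pd_scaled_potential // => E.
apply: (mulfI (x := nrm p)); first by rewrite gt_eqF.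
apply/eqP; rewrite -subr_eq0; apply/eqP; rewrite [RHS]E; field.
by rewrite gt_eqF.
Qed.

Lemma sep_bound : exists2 K : R, 0 < K & forall j k v, enorm (sep j k v) <= K * nrm v.
Proof.
have [C C0 H] := mass_norm_equiv hm; exists (4 * C); first by rewrite mulr_gt0.
move=> j k v; have [_ Hv] := H v.
have c i : `|sep j k v 0 i| <= 2 * `|v|.
  rewrite !mxE (le_trans (ler_normB _ _)) //.
  by have := mx_norm_le v j i; have := mx_norm_le v k i; lra.
have := c 0; have := c 1; move: (sep j k v) => s h1 h0.
apply: (@le_trans _ _ (`|s 0 0| + `|s 0 1|)); last by lra.
rewrite -ler_sqr ?nnegrE ?enorm_ge0 ?addr_ge0 // enorm2 dotE sqrrD.
by rewrite !real_normK ?num_real // -!expr2 -addrA lerD2l lerDr mulrn_wge0 // mulr_ge0.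
Qed.

(** Two bodies are at a distance at most a multiple of the norm, so one term of the
  potential is enough. *)
Lemma scaled_potential_lower : exists2 c : R, 0 < c & forall x, O x -> c <= f x.
Proof.
pose j : 'I_N := Ordinal (ltn_trans (ltn0Sn 0) hN).
pose k : 'I_N := Ordinal hN; have jk : j != k by [].
have [K K0 H] := sep_bound.
exists (m j * m k / K) => [|x Ox]; first by rewrite !mulr_gt0 // invr_gt0.
have n0 := noncoll_norm Ox.
rewrite scaled_potentialE; apply: le_trans (ler_wpM2l (ltW n0) (isep_le_potential hm x jk)).
rewrite mulrCA ler_pM2l ?mulr_gt0 // -[leLHS]mul1r ler_pdivrMr // /isep mulrAC.
by rewrite ler_pdivlMr ?mul1r ?enorm_gt0 ?noncoll_sep // mulrC; exact: H.
Qed.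

(** The differential of the inverse of a distance is of the order of its square, and
  every inverse distance is at most a multiple of the potential. *)
Lemma pd_potential_bound : exists2 C : R, 0 < C &
  forall x v, O x -> `|pd v U x| <= C * U x ^+ 2 * nrm v.
Proof.
have [K K0 H] := sep_bound.
pose C := \sum_(j < N) \sum_(k < N | (j < k)%N) (m j * m k)^-1 * K.
have C0 : 0 <= C.
  do 2 (apply: sumr_ge0 => ? _); rewrite mulr_ge0 ?(ltW K0) // invr_ge0.
  by rewrite mulr_ge0 // ltW.
exists (C + 1) => [|x v Ox]; first by rewrite ltr_wpDl.
apply: (@le_trans _ _ (C * U x ^+ 2 * nrm v)); last first.
  by rewrite ler_wpM2r ?mass_norm_ge0 // ler_wpM2r ?sqr_ge0 // lerDl.
rewrite pd_potential_pairs // (le_trans (ler_norm_sum _ _ _)) // !mulr_suml.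
apply: ler_sum => j _; rewrite (le_trans (ler_norm_sum _ _ _)) // !mulr_suml.
apply: ler_sum => k jk.
have jk' : j != k by rewrite -val_eqE /= neq_ltn jk.
have mm : 0 < m j * m k by exact: mulr_gt0.
have i0 := isep_gt0 Ox jk'; set i := isep j k x in i0 *.
have e0 : 0 < enorm (sep j k x) by rewrite enorm_gt0 noncoll_sep.
have ie : i * enorm (sep j k x) = 1 by rewrite /i /isep mulVf // gt_eqF.
have mi : 0 <= m j * m k * i ^+ 3.
  by apply: mulr_ge0; [exact: ltW|apply: exprn_ge0; exact: ltW].
rewrite normrM normrN (ger0_norm mi).
apply: (@le_trans _ _ (m j * m k * i ^+ 3 * (enorm (sep j k x) * enorm (sep j k v)))).
  by apply: ler_wpM2l => //; exact: dot_CS.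
have -> : m j * m k * i ^+ 3 * (enorm (sep j k x) * enorm (sep j k v)) =
   (m j * m k)^-1 * (m j * m k * i) ^+ 2 * enorm (sep j k v) * (i * enorm (sep j k x)).
  by field; rewrite gt_eqF //= gt_eqF.
rewrite ie mulr1.
have -> : (m j * m k)^-1 * K * U x ^+ 2 * nrm v = (m j * m k)^-1 * U x ^+ 2 * (K * nrm v).
  by ring.
have mmi : 0 <= (m j * m k)^-1 by rewrite invr_ge0 ltW.
apply: ler_pM; [by rewrite mulr_ge0 // sqr_ge0|exact: enorm_ge0| |exact: H].
apply: ler_wpM2l => //; rewrite ler_sqr ?nnegrE ?potential_ge0 //.
  exact: isep_le_potential.
by apply: mulr_ge0; exact: ltW.
Qed.

Lemma diff2E (g : config R N -> R) r u v : diff2 g r u v = pd u (pd v g) r.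
Proof.
by rewrite /diff2 pdE; congr ('d _ r u); apply/funext => s; rewrite pdE.
Qed.

Lemma diff3E (g : config R N -> R) r u v w : diff3 g r u v w = pd u (pd v (pd w g)) r.
Proof.
by rewrite /diff3 pdE; congr ('d _ r u); apply/funext => s; rewrite diff2E.
Qed.

End ScaledPotential.

(** * Calculus along orbits *)

Section RealHelpers.
Context {R : realType}.
Implicit Types (g dg : R -> R) (a b t : R).

Lemma is_derive_mulc (k : R) g (dg : R) t : is_derive t (1 : R) g dg ->
  is_derive t (1 : R) (fun t => k * g t) (k * dg).
Proof. by move=> D; exact: (is_deriveZ k D). Qed.

Lemma is_derive_addc (k : R) g (dg : R) t : is_derive t (1 : R) g dg ->
  is_derive t (1 : R) (fun t => k + g t) dg.
Proof.
move=> D; have := is_deriveD (@is_derive_cst _ R R k t 1) D.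
by rewrite add0r.
Qed.

Lemma is_derive_inv g (dg : R) t : g t != 0 -> is_derive t (1 : R) g dg ->
  is_derive t (1 : R) (fun t => (g t)^-1) (- (g t) ^- 2 * dg).
Proof.
move=> n0 [e1 E1]; apply: DeriveDef; first exact: derivableV.
by rewrite (deriveV n0 e1) E1.
Qed.

Lemma MVT_is_derive g dg a b : a < b ->
  (forall t, a <= t <= b -> is_derive t (1 : R) g (dg t)) ->
  exists2 c, a < c < b & g b - g a = dg c * (b - a).
Proof.
move=> ab D.
have [||c + E] := @MVT R g dg a b ab; last 1 first.
- by rewrite in_itv /= => H; exists c.
- by move=> t; rewrite in_itv /= => /andP[h1 h2]; apply: D; rewrite !ltW.
- apply: continuous_in_subspaceT => t; rewrite inE /= in_itv /= => H.
  exact: is_derive_continuous (D t H).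
Qed.

Lemma is_derive_homo g dg a b : a <= b ->
  (forall t, a <= t <= b -> is_derive t (1 : R) g (dg t)) ->
  (forall t, a < t < b -> 0 <= dg t) -> g a <= g b.
Proof.
rewrite le_eqVlt => /predU1P[->//|ab] D P.
have [c H E] := MVT_is_derive ab D.
by rewrite -subr_ge0 E mulr_ge0 ?P // subr_ge0 ltW.
Qed.

Lemma is_derive_homo_lt g dg a b : a < b ->
  (forall t, a <= t <= b -> is_derive t (1 : R) g (dg t)) ->
  (forall t, a < t < b -> 0 < dg t) -> g a < g b.
Proof.
move=> ab D P; have [c H E] := MVT_is_derive ab D.
by rewrite -subr_gt0 E mulr_gt0 ?P // subr_gt0.
Qed.

Lemma is_derive_const g a b : a <= b ->
  (forall t, a <= t <= b -> is_derive t (1 : R) g 0) -> g a = g b.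
Proof.
rewrite le_eqVlt => /predU1P[->//|ab] D.
have [c H E] := MVT_is_derive ab D.
by apply/esym/eqP; rewrite -subr_eq0 E mul0r.
Qed.

Lemma first_exit g a b (l : R) : (forall t, a <= t <= b -> {for t, continuous g}) ->
  a <= b -> g a < l -> l <= g b ->
  exists2 c, a < c <= b & l <= g c /\ forall t, a <= t < c -> g t < l.
Proof.
move=> gc ab ga gb.
pose S : set R := [set t | a <= t <= b /\ l <= g t].
have S0 : S !=set0 by exists b; split => //; rewrite ab lexx.
have Slb : has_lbound S by exists a => t [/andP[]].
have ca : a <= inf S by apply: lb_le_inf => // t [/andP[]].
have cb : inf S <= b by apply: ge_inf => //; split => //; rewrite ab lexx.
have lt_inf t : a <= t < inf S -> g t < l.
  move=> /andP[h1 h2]; rewrite ltNge; apply/negP => lt.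
  have : inf S <= t.
    by apply: ge_inf => //; split => //; rewrite h1 (le_trans (ltW h2)).
  by rewrite leNgt h2.
have lc : l <= g (inf S).
  rewrite leNgt; apply/negP => gl.
  have cc : {for inf S, continuous g} by apply: gc; rewrite ca cb.
  have /nbhs_ballP[e /= e0 He] : \forall t \near inf S, g t < l.
    by move: cc => /cvgr_lt/(_ l gl).
  have [t [/andP[h1 h2] h3] h4] : exists2 t, S t & t < inf S + e.
    by apply: inf_adherent => //; split.
  have : g t < l.
    apply: He; rewrite -ball_normE /= distrC ger0_norm ?subr_ge0.
      by rewrite ltrBlDl.
    by apply: ge_inf => //; split => //; rewrite h1.
  by rewrite ltNge h3.
exists (inf S); last by split.
rewrite cb andbT lt_neqAle ca andbT; apply/eqP => E.
by move: lc; rewrite -E leNgt ga.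
Qed.

Lemma exprn_add_le (x y : R) n : 0 <= x -> 0 <= y ->
  (x + y) ^+ n <= 2 ^+ n * (x ^+ n + y ^+ n).
Proof.
move=> x0 y0; wlog xy : x y x0 y0 / x <= y => [H|].
  have [/H|/ltW/H] := leP x y; first exact.
  by rewrite [y + x]addrC [y ^+ n + _]addrC; apply.
apply: (@le_trans _ _ ((2 * y) ^+ n)).
  by rewrite lerXn2r ?nnegrE ?addr_ge0 ?mulr_ge0 //; lra.
by rewrite exprMn ler_wpM2l ?exprn_ge0 // lerDr exprn_ge0.
Qed.

End RealHelpers.

Section OrbitDerivatives.
Context {R : realType} {N : nat} {m : 'I_N -> R}.
Hypothesis hm : forall k, 0 < m k.
Implicit Types (x y : R -> config R N) (t : R).
Local Notation dotm := (mass_dot m).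
Local Notation O := (@noncoll R N).

Lemma is_derive_mass_dot x y dx dy t : is_derive t (1 : R) x dx ->
  is_derive t (1 : R) y dy ->
  is_derive t (1 : R) (fun t => dotm (x t) (y t)) (dotm dx (y t) + dotm (x t) dy).
Proof.
move=> Dx Dy.
have D1 := is_derive_comp (is_deriveD Dx Dy) (is_diff_mass_dot (m := m) _).
have D2 := is_derive_comp (is_deriveB Dx Dy) (is_diff_mass_dot (m := m) _).
have D := is_deriveZ (4^-1) (is_deriveB D1 D2).
apply: is_derive_eq.
  apply: (near_eq_is_derive _ D); near=> u => /=.
  rewrite !fctE /= /GRing.scale /= !mdE (mass_dotC (y u)).
  by field.
rewrite /GRing.scale /= !fctE /= !mdE (mass_dotC (y t) dx).
by field.
Unshelve. all: by end_near. Qed.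

Lemma is_derive_coord x dx t k i : is_derive t (1 : R) x dx ->
  is_derive t (1 : R) (fun t => x t k i : R) (dx k i).
Proof. by move=> D; exact: is_derive_comp D (is_diff_mxcoord (x t) k i). Qed.

Lemma is_derive_mx x (dx : config R N) t :
  (forall k i, is_derive t (1 : R) (fun t => x t k i : R) (dx k i)) ->
  is_derive t (1 : R) x dx.
Proof.
move=> D.
have ex : derivable x t 1 by apply/derivable_mxP => k i; have [] := D k i.
apply: DeriveDef => //; apply/matrixP => k i.
by rewrite derive_mx // mxE; have [_ ->] := D k i.
Qed.

Lemma is_derive_scale (c : R -> R) (dc : R) x dx t : is_derive t (1 : R) c dc ->
  is_derive t (1 : R) x dx ->
  is_derive t (1 : R) (fun t => c t *: x t) (c t *: dx + dc *: x t).
Proof.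
move=> Dc Dx; apply: is_derive_mx => k i.
rewrite (_ : (fun t => _) = (c * (fun t => x t k i : R))); last first.
  by apply/funext => u; rewrite !mxE.
apply: is_derive_eq; first exact: is_deriveM Dc (is_derive_coord k i Dx).
by rewrite !mxE /GRing.scale /= (mulrC dc).
Qed.

Lemma is_derive_fsum (I : Type) (l : seq I) (F : I -> R -> R) (dF : I -> R) t :
  (forall i, is_derive t (1 : R) (F i) (dF i)) ->
  is_derive t (1 : R) (fun t => \sum_(i <- l) F i t) (\sum_(i <- l) dF i).
Proof.
move=> D; elim: l => [|i l IH].
  rewrite big_nil (_ : (fun _ => _) = cst 0); first exact: is_derive_cst.
  by apply/funext => u; rewrite big_nil.
rewrite big_cons (_ : (fun _ => _) = F i + (fun t => \sum_(i <- l) F i t)).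
  exact: is_deriveD.
by apply/funext => u; rewrite big_cons.
Qed.

Lemma is_derive_pd (g : config R N -> R) x u dx du t : smooth O g -> O (x t) ->
  is_derive t (1 : R) x dx -> is_derive t (1 : R) u du ->
  is_derive t (1 : R) (fun t => pd (u t) g (x t)) (pd dx (pd (u t) g) (x t) + pd du g (x t)).
Proof.
move=> sg Ox Dx Du.
have oO := @noncoll_open R N.
have D (ki : 'I_N * 'I_2) : is_derive t (1 : R)
    (fun t => u t ki.1 ki.2 * pd (delta_mx ki.1 ki.2) g (x t))
    (u t ki.1 ki.2 * pd dx (pd (delta_mx ki.1 ki.2) g) (x t) +
     pd (delta_mx ki.1 ki.2) g (x t) * du ki.1 ki.2).
  have D1 := is_derive_coord ki.1 ki.2 Du.
  have D2 := is_derive_comp Dx (smooth_diff oO (smooth_pd oO (delta_mx ki.1 ki.2) sg) Ox).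
  exact: is_deriveM D1 D2.
have E h : pd (u h) g (x h) = \sum_ki u h ki.1 ki.2 * pd (delta_mx ki.1 ki.2) g (x h).
  by rewrite pd_coord pair_big.
rewrite (_ : (fun t => _) = (fun h => \sum_ki u h ki.1 ki.2 * pd (delta_mx ki.1 ki.2) g (x h)));
  last by apply/funext => h.
apply: is_derive_eq; first exact: is_derive_fsum D.
rewrite big_split /=; congr (_ + _).
  rewrite (smooth_pdC oO) // pd_coord pair_big /=; apply: eq_bigr => ki _.
  by rewrite (smooth_pdC oO).
by rewrite pd_coord pair_big /=; apply: eq_bigr => ki _; rewrite mulrC.
Qed.

End OrbitDerivatives.

(** * McGehee variables of a collapsing orbit *)

Section McGehee.
Context {R : realType} {N : nat} {m : 'I_N -> R}.
Hypothesis hm : forall k, 0 < m k.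
Hypothesis hN : (2 <= N)%N.
Local Notation dotm := (mass_dot m).
Local Notation nrm := (mass_norm m).
Local Notation O := (@noncoll R N).
Local Notation U := (potential m).
Local Notation f := (scaled_potential m).
Local Notation G := (grad (m := m) (scaled_potential m)).
Let oO : open O := @noncoll_open R N.

(** McGehee variables of a collapsing orbit: [sg] is the square root of the size, [s]
  the normalized shape, [v] and [w] the radial and tangential velocities multiplied by
  [sg]. All equations carry the same singular factor [sg ^ -3], which only changes the
  speed along trajectories; what is left is regular up to the collision [sg = 0], where
  it is gradient-like. *)
Record mcgehee (a T : R) (s w : R -> config R N) (sg v : R -> R) (h : R) : Prop := {
  mg_noncoll : forall t, a < t < T -> O (s t);
  mg_centered : forall t, a < t < T -> s t \in centered m;
  mg_unit : forall t, a < t < T -> nrm (s t) = 1;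
  mg_sg_gt0 : forall t, a < t < T -> 0 < sg t;
  mg_orth : forall t, a < t < T -> dotm (s t) (w t) = 0;
  mg_energy : forall t, a < t < T ->
    2^-1 * (v t ^+ 2 + dotm (w t) (w t)) - f (s t) = sg t ^+ 2 * h;
  mg_dsg : forall t, a < t < T ->
    is_derive t (1 : R) sg ((sg t)^-1 ^+ 3 * (v t * sg t / 2));
  mg_dv : forall t, a < t < T -> is_derive t (1 : R) v
    ((sg t)^-1 ^+ 3 * (dotm (w t) (w t) / 2 + sg t ^+ 2 * h));
  mg_ds : forall t, a < t < T -> is_derive t (1 : R) s ((sg t)^-1 ^+ 3 *: w t);
  mg_dpsi : forall t, a < t < T -> is_derive t (1 : R) (fun t => pd (w t) f (s t))
    ((sg t)^-1 ^+ 3 * (dotm (G (s t)) (G (s t)) - v t * pd (w t) f (s t) / 2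
      + pd (w t) (pd (w t) f) (s t)))
}.

Section Orbit.
Context (r : R -> config R N) (a T : R).
Hypothesis aT : a < T.
Hypothesis sol : solution_on m [set t | a < t < T] r.
Local Notation y := (r^`()%classic).
Local Notation z := (r^`(2)%classic).

Let inside t : a < t < T -> O (r t).
Proof. by move=> /sol[]. Qed.

Lemma orbit_dr t : a < t < T -> is_derive t (1 : R) r (y t).
Proof.
by move=> /sol[_ _ [D _ _]]; rewrite derive1E; exact: derivableP.
Qed.

Lemma orbit_dy t : a < t < T -> is_derive t (1 : R) y (z t).
Proof.
move=> /sol[_ _ [_ D _]]; rewrite derive1nS derive1n1.
by rewrite (derive1E y); exact: derivableP.
Qed.

Lemma orbit_newton t u : a < t < T -> dotm (z t) u = pd u U (r t).
Proof.
move=> tT; have [_ _ [_ _ E]] := sol tT; rewrite pd_potential; last exact: inside.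
rewrite /mass_dot; apply: eq_bigr => k _.
rewrite -dotZl E dot_suml; apply: eq_bigr => j jk.
by rewrite dotZl /isep exprVn (mulrC (m k)).
Qed.

Definition energy t := 2^-1 * dotm (y t) (y t) - U (r t).

Lemma energy_const t u : a < t < T -> a < u < T -> energy t = energy u.
Proof.
wlog tu : t u / t <= u => [H|] tT uT.
  by have [/H|/ltW/H] := leP t u; [exact|move=> /(_ uT tT)].
apply: is_derive_const tu _ => e /andP[e1 e2].
have eT : a < e < T by case/andP: tT => h1 _; case/andP: uT => _ h2; rewrite (lt_le_trans h1) ?(le_lt_trans e2).
have D1 := is_derive_mass_dot (m := m) (orbit_dy eT) (orbit_dy eT).
have D2 := is_derive_comp (orbit_dr eT) (smooth_diff oO (@smooth_potential R N m) (inside eT)).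
have D := is_deriveB (is_deriveZ 2^-1 D1) D2.
apply: is_derive_eq D _.
by rewrite (mass_dotC (y e)) orbit_newton // /GRing.scale /=; field.
Qed.

Let rho t := nrm (r t).
Let sg t := Num.sqrt (rho t).
Let v t := dotm (r t) (y t) / sg t.
Let s t := normalized m (r t).
Let w t := sg t *: y t - v t *: s t.

(** Newton's equations say that the acceleration is the mass gradient of the potential;
  homogeneity of the potential separates the size from the shape. *)
Lemma orbit_mcgehee : mcgehee a T s w sg v (energy ((a + T) / 2)).
Proof.
have mid : a < (a + T) / 2 < T by have := mid_in_itvoo aT; rewrite in_itv.
have rho0 t : a < t < T -> 0 < rho t.
  by move=> tT; rewrite /rho (noncoll_norm hm hN) //; exact: inside.
have sg0 t : a < t < T -> 0 < sg t by move=> tT; rewrite sqrtr_gt0 rho0.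
have sgE t : a < t < T -> rho t = sg t ^+ 2.
  by move=> tT; rewrite sqr_sqrtr // ltW // rho0.
have sE t : a < t < T -> s t = (sg t)^-1 ^+ 2 *: r t.
  by move=> tT; rewrite /s /normalized -/(rho t) sgE // exprVn.
have rE t : a < t < T -> r t = sg t ^+ 2 *: s t.
  by move=> tT; rewrite sE // scalerA exprVn mulfV ?scale1r // expf_neq0 // gt_eqF // sg0.
have rr t : a < t < T -> dotm (r t) (r t) = sg t ^+ 4.
  by move=> tT; rewrite -mass_norm2 // -/(rho t) sgE // -exprM.
have ry t : a < t < T -> dotm (r t) (y t) = sg t * v t.
  by move=> tT; rewrite /v; field; rewrite gt_eqF // sg0.
have ss t : a < t < T -> dotm (s t) (s t) = 1.
  move=> tT; rewrite sE // !mdE rr //; field.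
  by rewrite gt_eqF // sg0.
have sy t : a < t < T -> dotm (s t) (y t) = v t / sg t.
  move=> tT; rewrite sE // !mdE ry //; field.
  by rewrite gt_eqF // sg0.
have sO t : a < t < T -> O (s t).
  move=> tT; have -> : s t = simil ((sg t)^-1 ^+ 2) 0 (r t).
    by rewrite sE // /simil scale0r addr0.
  apply: noncoll_simil; last exact: inside.
  by rewrite expr0n addr0 !exprn_gt0 // invr_gt0 sg0.
have fs t : a < t < T -> f (s t) = f (r t).
  move=> tT; have -> : s t = simil ((sg t)^-1 ^+ 2) 0 (r t).
    by rewrite sE // /simil scale0r addr0.
  rewrite scaled_potential_simil //.
  by rewrite expr0n addr0 !exprn_gt0 // invr_gt0 sg0.
have vE t : v t = dotm (r t) (y t) / sg t by [].
have rhoN t : rho t = nrm (r t) by [].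
have wE t : w t = sg t *: y t - v t *: s t by [].
have rhoE : rho = fun t => Num.sqrt (dotm (r t) (r t)) by [].
have sgdef : sg = fun t => Num.sqrt (rho t) by [].
have fr t : a < t < T -> f (r t) = sg t ^+ 2 * U (r t).
  by move=> tT; rewrite scaled_potentialE -/(rho t) sgE.
clearbody w s v sg rho.
have sw t : a < t < T -> dotm (s t) (w t) = 0.
  move=> tT; rewrite wE !mdE ss // sy //; field.
  by rewrite gt_eqF // sg0.
have ww t : a < t < T -> dotm (w t) (w t) = sg t ^+ 2 * dotm (y t) (y t) - v t ^+ 2.
  move=> tT; rewrite wE !mdE ss // (mass_dotC (y t) (s t)) sy //; field.
  by rewrite gt_eqF // sg0.
have en t : a < t < T -> 2^-1 * (v t ^+ 2 + dotm (w t) (w t)) - f (s t) =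
    sg t ^+ 2 * energy ((a + T) / 2).
  move=> tT; rewrite ww // fs // fr // (energy_const mid tT) /energy; by field.
have drho t : a < t < T -> is_derive t (1 : R) (fun t => dotm (r t) (r t)) (2 * (sg t * v t)).
  move=> tT; have D := is_derive_mass_dot (m := m) (orbit_dr tT) (orbit_dr tT).
  by apply: is_derive_eq D _; rewrite (mass_dotC (y t)) ry //; ring.
have drho1 t : a < t < T -> is_derive t (1 : R) rho (v t / sg t).
  move=> tT.
  have D := is_derive_comp (drho t tT) (is_diff_fsqrt (g := id) _ (is_diff_id _)).
  have := D; rewrite /= rr // => /(_ (exprn_gt0 _ (sg0 t tT))) D'.
  rewrite rhoE; apply: is_derive_eq D' _.
  rewrite (_ : sg t ^+ 4 = (sg t ^+ 2) ^+ 2); last by rewrite -exprM.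
  rewrite sqrtr_sqr ger0_norm ?sqr_ge0 //; field.
  by rewrite gt_eqF // sg0.
have dsg t : a < t < T -> is_derive t (1 : R) sg ((sg t)^-1 ^+ 3 * (v t * sg t / 2)).
  move=> tT.
  have D := is_derive_comp (drho1 t tT) (is_diff_fsqrt (g := id) (rho0 t tT) (is_diff_id _)).
  rewrite [in is_derive _ _ sg _]sgdef; apply: is_derive_eq D _.
  rewrite (_ : Num.sqrt _ = sg t); last by rewrite sgdef.
  by field; rewrite gt_eqF // sg0.
have dsi t : a < t < T -> is_derive t (1 : R) (fun t => (sg t)^-1)
    (- ((sg t)^-1 ^+ 4 * v t / 2)).
  move=> tT; have [ex E] := dsg t tT; have n0 : sg t != 0 by rewrite gt_eqF // sg0.
  apply: DeriveDef; first exact: derivableV.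
  by rewrite deriveV // E /GRing.scale /=; field.
have yE t : a < t < T -> y t = (sg t)^-1 *: (w t + v t *: s t).
  by move=> tT; rewrite wE subrK scalerA mulVf ?scale1r // gt_eqF // sg0.
have ds t : a < t < T -> is_derive t (1 : R) s ((sg t)^-1 ^+ 3 *: w t).
  move=> tT; have n0 : sg t != 0 by rewrite gt_eqF // sg0.
  have D := is_derive_scale (is_deriveX 2 (dsi t tT)) (orbit_dr tT).
  apply: is_derive_eq; first apply: (near_eq_is_derive _ D).
    have : \forall u \near t, u \in `]a, T[%R by apply: near_in_itvoo; rewrite in_itv.
    by apply: filterS => u; rewrite in_itv /= => uT; rewrite !fctE sE.
  rewrite !fctE /= /GRing.scale /= yE // [r t in LHS]rE //.
  by apply/matrixP => k i; rewrite !mxE; field.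
have dv t : a < t < T -> is_derive t (1 : R) v
    ((sg t)^-1 ^+ 3 * (dotm (w t) (w t) / 2 + sg t ^+ 2 * energy ((a + T) / 2))).
  move=> tT; have n0 : sg t != 0 by rewrite gt_eqF // sg0.
  have D := is_deriveM (is_derive_mass_dot (m := m) (orbit_dr tT) (orbit_dy tT)) (dsi t tT).
  have vf : (fun t => dotm (r t) (y t)) * (fun t => (sg t)^-1) = v.
    by apply/funext => u; rewrite vE.
  rewrite vf in D; apply: is_derive_eq D _; rewrite /GRing.scale /=.
  rewrite ry // (mass_dotC (r t) (z t)) (orbit_newton (r t) tT).
  have -> : pd (r t) U (r t) = - U (r t).
    have := pd_scaled_potential_self hm hN (inside tT).
    rewrite pd_scaled_potential //; last exact: inside.
    rewrite -mass_norm2 // => E.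
    have n1 : nrm (r t) != 0 by rewrite -rhoN gt_eqF // rho0.
    apply: (mulfI n1); apply/eqP; rewrite -subr_eq0; apply/eqP; rewrite -[RHS]E.
    by field.
  have := en t tT; rewrite ww // fs // fr // => E.
  have E' : dotm (y t) (y t) = (2 * (sg t ^+ 2 * energy ((a + T) / 2)) + 2 * (sg t ^+ 2 * U (r t))) / sg t ^+ 2.
    by rewrite -E; field.
  by rewrite E'; field.
have dw t : a < t < T -> is_derive t (1 : R) w
    ((sg t *: z t + ((sg t)^-1 ^+ 3 * (v t * sg t / 2)) *: y t) -
     (v t *: ((sg t)^-1 ^+ 3 *: w t) + ((sg t)^-1 ^+ 3 *
       (dotm (w t) (w t) / 2 + sg t ^+ 2 * energy ((a + T) / 2))) *: s t)).
  move=> tT; have D := is_deriveB (is_derive_scale (dsg t tT) (orbit_dy tT))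
    (is_derive_scale (dv t tT) (ds t tT)).
  have wf : (fun t => sg t *: y t) - (fun t => v t *: s t) = w.
    by apply/funext => u; rewrite wE.
  by rewrite wf in D.
have sf := smooth_scaled_potential hm hN.
split => // [t tT|t tT|t tT].
- apply/centeredP => // u tu; rewrite sE // mass_dotZl.
  have [cr _ _] := sol tT; move/centeredP: cr => /(_ hN u tu) ->; exact: mulr0.
- by apply/eqP; rewrite -(@eqrXn2 _ 2) ?mass_norm_ge0 // mass_norm2 // ss // expr1n.
have D := is_derive_pd sf (sO t tT) (ds t tT) (dw t tT).
have n0 : sg t != 0 by rewrite gt_eqF // sg0.
apply: is_derive_eq D _.
set g := G (s t); set psi := pd (w t) f (s t).
have gpd u : pd u f (s t) = dotm g u by rewrite gradE.
have gs : dotm g (s t) = 0 by rewrite -gpd pd_scaled_potential_self // ; exact: sO.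
have gw : dotm g (w t) = psi by rewrite -gpd.
rewrite gpd !mdE gs gw.
have -> : dotm g (y t) = psi / sg t.
  by rewrite yE // !mdE gs gw; field.
rewrite pdZ.
have -> : dotm g (z t) = (sg t)^-1 ^+ 4 * dotm g g.
  rewrite mass_dotC (orbit_newton g tT).
  have E1 := pd_scaled_potential hm hN g (inside tT).
  have E2 : pd (sg t ^+ 2 *: g) f (r t) = dotm g g.
    have s2 : 0 < (sg t ^+ 2) ^+ 2 + 0 ^+ 2 :> R by rewrite expr0n addr0 !exprn_gt0 // sg0.
    rewrite -gpd -(pd_scaled_potential_simil hm hN g s2 (sO t tT)).
    by rewrite /simil !scale0r !addr0 -rE.
  have rg : dotm (r t) g = 0 by rewrite rE // mass_dotZl (mass_dotC (s t)) gs mulr0.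
  rewrite rg !mul0r add0r -rhoN sgE // in E1.
  rewrite pdZ E1 in E2; rewrite -E2.
  by field.
by field.
Qed.

End Orbit.

Lemma total_collision_mcgehee (r : R -> config R N) (a T : R) :
  total_collision_forward m r a T -> exists w sg v h,
    mcgehee a T (fun t => normalized m (r t)) w sg v h /\
    sg t @[t --> T^'-] --> (0 : R).
Proof.
move=> [aT sol r0]; do 4 eexists; split; first exact: orbit_mcgehee aT sol.
suff : Num.sqrt (mass_norm m (r t)) @[t --> T^'-] --> Num.sqrt (0 : R) by rewrite sqrtr0.
exact: (@cvg_comp _ _ _ _ Num.sqrt _ _ _ r0 (@sqrt_continuous R 0)).
Qed.

End McGehee.

(** * Compactness of the sublevels of the potential *)

Section Compactness.
Context {R : realType}.

Lemma vec_mx_continuous a b : continuous (@vec_mx R a b).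
Proof.
move=> x A /nbhs_ballP[e /= e0 eA]; apply/nbhs_ballP; exists e => //= y xy.
apply: eA; move: xy; rewrite -!ball_normE /=; apply: le_lt_trans.
rewrite -linearB /= {1}/Num.Def.normr /= mx_normrE bigmax_le // => -[i j] _ /=.
by rewrite mxE mx_norm_le.
Qed.

Lemma mxvec_norm_le a b (x : 'M[R]_(a, b)) : `|mxvec x| <= `|x|.
Proof.
rewrite {1}/Num.Def.normr /= mx_normrE bigmax_le // => -[i j] _ /=.
have [k l] := mxvec_indexP j; rewrite (ord1 i) mxvecE.
exact: mx_norm_le.
Qed.

(** The Heine-Borel theorem for row vectors, transported by [mxvec]. *)
Lemma mx_bounded_closed_compact a b (A : set 'M[R]_(a, b)) (M : R) :
  (forall x, A x -> `|x| <= M) -> closed A -> compact A.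
Proof.
move=> bA cA.
have -> : A = vec_mx @` (vec_mx @^-1` A).
  apply/seteqP; split=> [x Ax|_ [y Ay <-]//].
  by exists (mxvec x); rewrite ?mxvecK //= mxvecK.
apply: continuous_compact.
  by apply: continuous_subspaceT => x; exact: vec_mx_continuous.
apply: bounded_closed_compact.
  exists M; split; first exact: num_real.
  move=> t Mt x /= Ax; rewrite -(vec_mxK x) (le_trans (mxvec_norm_le _)) //.
  by rewrite (le_trans (bA _ Ax)) // ltW.
by apply: closed_comp cA => x _; exact: vec_mx_continuous.
Qed.

End Compactness.

Section LevelSets.
Context {R : realType} {N : nat} {m : 'I_N -> R}.
Hypothesis hm : forall k, 0 < m k.
Hypothesis hN : (2 <= N)%N.
Local Notation dotm := (mass_dot m).
Local Notation nrm := (mass_norm m).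
Local Notation O := (@noncoll R N).
Local Notation f := (scaled_potential m).
Let oO : open O := @noncoll_open R N.

(** Described by lower bounds on the mutual distances rather than by a bound on
  [scaled_potential], which makes it visibly closed among all configurations, collisions
  included. *)
Definition unit_sublevel (M : R) : set (config R N) :=
  [set x | [/\ x \in centered m, nrm x = 1 & forall jk : 'I_N * 'I_N, jk.1 != jk.2 ->
      m jk.1 * m jk.2 <= M * enorm (sep jk.1 jk.2 x)]].

Lemma unit_sublevelP M x : O x -> x \in centered m -> nrm x = 1 -> f x <= M ->
  unit_sublevel M x.
Proof.
move=> Ox cx nx fx; split => // -[j k] /= jk.
rewrite -ler_pdivrMr ?enorm_gt0 ?noncoll_sep //.
apply: le_trans (isep_le_potential hm x jk) _.
by move: fx; rewrite scaled_potentialE nx mul1r.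
Qed.

Lemma unit_sublevel_noncoll M x : unit_sublevel M x -> O x.
Proof.
move=> [cx nx Hx]; apply: noncollP => j k jk; apply/eqP => E.
have := Hx (j, k) jk; rewrite /= E /enorm dot0l sqrtr0 mulr0 leNgt.
by rewrite mulr_gt0.
Qed.

Lemma mass_norm_continuous : continuous (mass_norm m : config R N -> R).
Proof.
move=> x A /nbhs_ballP[e /= e0 eA].
apply/(near_mass_norm hm); exists e => // y xy.
apply: eA; rewrite -ball_normE /=; apply: le_lt_trans xy; rewrite ler_norml lerBlDr lerBrDr addrC.
have h1 := mass_normD hm (y - x) x; have h2 := mass_normD hm (x - y) y.
move: h1 h2; rewrite !subrK (mass_normB x y) => h1 h2.
by apply/andP; split; lra.
Qed.

Lemma mass_dot_continuousl v : continuous ((mass_dot m)^~ v : config R N -> R).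
Proof.
move=> x; have [C C0 H] := mass_norm_equiv hm.
move=> A /nbhs_ballP[e /= e0 eA].
apply/(near_mass_norm hm); exists (e / (nrm v + 1)).
  by rewrite divr_gt0 // ltr_wpDl ?mass_norm_ge0.
move=> y xy; apply: eA; rewrite -ball_normE /= -mass_dotBl (le_lt_trans (mass_CS hm _ _)) // mass_normB.
have n0 := mass_norm_ge0 (m := m) (y - x); have nv := mass_norm_ge0 (m := m) v.
rewrite ltr_pdivlMr in xy; last by lra.
by apply: le_lt_trans xy; rewrite ler_wpM2l // lerDl.
Qed.

Lemma enorm_sep_continuous j k (M : R) :
  continuous (fun x : config R N => M * enorm (sep j k x)).
Proof.
move=> x; have D : {for x, continuous (fun x : config R N => dot (sep j k x) (sep j k x))}.
  by apply: differentiable_continuous; have [] := is_diff_sep2 x j k.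
have E : {for x, continuous (fun x : config R N => enorm (sep j k x))}.
  exact: (@cvg_comp _ _ _ _ Num.sqrt _ _ _ D (@sqrt_continuous R _)).
exact: (@continuousM _ _ (cst M) _ x (@cst_continuous _ _ _ _) E).
Qed.

Lemma unit_sublevel_compact M : compact (unit_sublevel M).
Proof.
have [C C0 H] := mass_norm_equiv hm.
apply: (@mx_bounded_closed_compact _ _ _ _ C).
  by move=> x [_ nx _]; have [_] := H x; rewrite nx mulr1.
have E : unit_sublevel M =
   \bigcap_(v in [set v | translation v]) ((mass_dot m)^~ v @^-1` [set 0]) `&`
   (mass_norm m @^-1` [set 1]) `&`
   \bigcap_(jk in [set jk : 'I_N * 'I_N | jk.1 != jk.2])
     ((fun x => M * enorm (sep jk.1 jk.2 x)) @^-1` [set y | m jk.1 * m jk.2 <= y]).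
  apply/seteqP; split=> [x [cx nx Hx]|x [[cx nx] Hx]].
    by split => //; split => // v tv /=; move/(centeredP hN): cx; exact.
  by split => //; apply/(centeredP hN) => v tv; exact: cx.
rewrite E; apply: closedI; first apply: closedI.
- apply: closed_bigI => v _; apply: closed_comp; last exact: closed_eq.
  by move=> x _; exact: mass_dot_continuousl.
- apply: closed_comp; last exact: closed_eq.
  by move=> x _; exact: mass_norm_continuous.
apply: closed_bigI => jk _; apply: closed_comp; last exact: closed_ge.
by move=> x _; exact: enorm_sep_continuous.
Qed.

Lemma smooth_bounded_sublevel M (g : config R N -> R) : smooth O g ->
  exists2 B : R, 0 <= B & forall x, unit_sublevel M x -> `|g x| <= B.
Proof.
move=> sg; have : compact (g @` unit_sublevel M).
  apply: continuous_compact; last exact: unit_sublevel_compact.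
  apply: continuous_in_subspaceT => x; rewrite inE => /unit_sublevel_noncoll.
  exact: (smooth_continuous oO).
move=> /compact_bounded[B [_ HB]].
exists (`|B| + 1) => [|x Kx]; first by rewrite addr_ge0.
apply: HB; last by exists x.
by rewrite (le_lt_trans (ler_norm B)) // ltrDl.
Qed.

Lemma pd2_bounded_sublevel M (g : config R N -> R) : smooth O g ->
  exists2 B : R, 0 <= B & forall x w, unit_sublevel M x ->
    `|pd w (pd w g) x| <= B * dotm w w.
Proof.
move=> sg; have [C C0 H] := mass_norm_equiv hm.
pose I := ('I_N * 'I_2)%type.
have D (ij : I * I) := cid2 (smooth_bounded_sublevel M
   (smooth_pd oO (delta_mx ij.1.1 ij.1.2) (smooth_pd oO (delta_mx ij.2.1 ij.2.2) sg))).
exists (\sum_ij s2val (D ij) * C ^+ 2).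
  by apply: sumr_ge0 => ij _; rewrite mulr_ge0 ?sqr_ge0 //; exact: (s2valP (D ij)).
move=> x w Kx; have Ox := unit_sublevel_noncoll Kx.
have -> : pd w (pd w g) x = \sum_(ij : I * I) w ij.1.1 ij.1.2 * w ij.2.1 ij.2.2 *
    pd (delta_mx ij.1.1 ij.1.2) (pd (delta_mx ij.2.1 ij.2.2) g) x.
  rewrite pd_coord pair_big /=.
  under eq_bigr => i _.
    rewrite (smooth_pdC oO) // pd_coord pair_big /=.
    rewrite mulr_sumr.
    over.
  rewrite pair_big /=; apply: eq_bigr => -[[i1 i2] [j1 j2]] _ /=.
  by rewrite (smooth_pdC oO) // mulrA.
rewrite (le_trans (ler_norm_sum _ _ _)) // mulr_suml; apply: ler_sum => ij _.
have wC k i : `|w k i| <= C * nrm w by apply: le_trans (mx_norm_le _ _ _) (H w).2.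
rewrite !normrM mulrC -mulrA; apply: ler_pM => //; first exact: (s2valP' (D ij)).
rewrite -mass_norm2 // -exprMn expr2; exact: ler_pM.
Qed.

End LevelSets.

(** * Asymptotics of the radial velocity *)

Section Asymptotics.
Context {R : realType} {N : nat} {m : 'I_N -> R}.
Hypothesis hm : forall k, 0 < m k.
Hypothesis hN : (2 <= N)%N.
Local Notation dotm := (mass_dot m).
Local Notation O := (@noncoll R N).

Lemma cvg_left_small (g : R -> R) (T : R) : g t @[t --> T^'-] --> (0 : R) ->
  forall e, 0 < e -> exists2 t0, t0 < T & forall t, t0 < t < T -> `|g t| < e.
Proof.
move=> /cvgrPdist_lt H e e0; have [d /= d0 Hd] := H e e0.
exists (T - d); first by rewrite ltrBlDr ltrDl.
move=> t /andP[t1 t2]; have := Hd t; rewrite /= sub0r normrN; apply => //.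
by rewrite ger0_norm ?subr_ge0 ?(ltW t2) // ltrBlDl -ltrBlDr.
Qed.

Lemma mcgehee_sub a a' T s w sg v h : a <= a' ->
  mcgehee (m := m) a T s w sg v h -> mcgehee (m := m) a' T s w sg v h.
Proof.
move=> aa' H; have S t : a' < t < T -> a < t < T.
  by move=> /andP[h1 ->]; rewrite andbT (le_lt_trans aa').
by split=> t /S tT; [apply: (mg_noncoll H)|apply: (mg_centered H)|apply: (mg_unit H)
  |apply: (mg_sg_gt0 H)|apply: (mg_orth H)|apply: (mg_energy H)|apply: (mg_dsg H)
  |apply: (mg_dv H)|apply: (mg_ds H)|apply: (mg_dpsi H)].
Qed.

Section Flow.
Context (a T : R) (s w : R -> config R N) (sg v : R -> R) (h : R).
Hypothesis aT : a < T.
Hypothesis H : mcgehee (m := m) a T s w sg v h.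
Hypothesis sg0 : sg t @[t --> T^'-] --> (0 : R).
Let q t := (sg t)^-1 ^+ 3.
Let F t := dotm (w t) (w t).

Let sub t1 t2 t : a < t1 -> t2 < T -> t1 <= t <= t2 -> a < t < T.
Proof. by move=> h1 h2 /andP[h3 h4]; rewrite (lt_le_trans h1) //= (le_lt_trans h4). Qed.

Lemma sg_small e : 0 < e -> exists2 t0, a <= t0 < T & forall t, t0 < t < T -> sg t < e.
Proof.
move=> /(cvg_left_small sg0)[t0 t0T Ht].
exists (Num.max a t0); first by rewrite le_max lexx /= gt_max aT.
move=> t; rewrite gt_max => /andP[/andP[_ h1] h2].
by apply: le_lt_trans (ler_norm _) (Ht t _); rewrite h1.
Qed.

Let q_gt0 t : a < t < T -> 0 < q t.
Proof. by move=> tT; rewrite exprn_gt0 // invr_gt0 (mg_sg_gt0 H). Qed.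

Let F_ge0 t : 0 <= F t. Proof. exact: mass_dot_ge0. Qed.

Lemma is_derive_sg2 t : a < t < T ->
  is_derive t (1 : R) (fun t => sg t ^+ 2) (q t * (v t * sg t ^+ 2)).
Proof.
move=> tT; have D := is_deriveM (mg_dsg H tT) (mg_dsg H tT).
apply: is_derive_eq D _; rewrite /GRing.scale /= -/(q t); by field.
Qed.

(** Otherwise the size would be nondecreasing and could not tend to zero. *)
Lemma not_expanding t1 : a < t1 < T -> ~ (forall t, t1 <= t < T -> 0 <= v t).
Proof.
move=> /andP[a1 t1T] Hv.
have t1i : a < t1 < T by rewrite a1.
have [t0 /andP[a0 t0T] Hs] := sg_small (mg_sg_gt0 H t1i).
have [t2 /andP[h1 h2]] : exists t2, Num.max t0 t1 < t2 < T.
  exists ((Num.max t0 t1 + T) / 2).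
  have M : Num.max t0 t1 < T by rewrite gt_max t0T.
  by have := mid_in_itvoo M; rewrite in_itv.
move: h1; rewrite gt_max => /andP[h01 h11].
have : sg t1 <= sg t2.
  apply: (is_derive_homo (ltW h11)) => t Ht; first exact: (mg_dsg H (sub a1 h2 Ht)).
  have tT : a < t < T by apply: (sub a1 h2); case/andP: Ht => *; rewrite !ltW.
  have vt : 0 <= v t by apply: Hv; case/andP: Ht => u1 u2; rewrite ltW // (lt_trans u2).
  by rewrite mulr_ge0 ?(ltW (q_gt0 tT)) // divr_ge0 // mulr_ge0 // ltW // (mg_sg_gt0 H).
by rewrite leNgt Hs // h01.
Qed.

(** Let [c ^ 2] be a lower bound of the scaled potential and [rho = sg ^ 2] the size. By
  the energy relation [rho * (v + c)] is nondecreasing near the collision. If [v]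
  exceeded [- c] at one time, this quantity would stay above a positive constant, so [v]
  would be nonnegative as soon as [rho] is small, which [not_expanding] forbids. *)
Lemma inward_speed : exists2 c : R, 0 < c &
  exists2 t0, a <= t0 < T & forall t, t0 < t < T -> v t <= - c.
Proof.
have [c0 c00 Hc0] := scaled_potential_lower hm hN.
set c := Num.sqrt c0; have cc : c ^+ 2 = c0 by rewrite sqr_sqrtr // ltW.
have c_gt0 : 0 < c by rewrite sqrtr_gt0.
exists c => //.
have [t0 /andP[a0 t0T] Hs] : exists2 t0, a <= t0 < T &
    forall t, t0 < t < T -> 2 * (sg t ^+ 2 * `|h|) <= c0 / 2.
  have e0 : 0 < Num.sqrt (c0 / (4 * (`|h| + 1))).
    by rewrite sqrtr_gt0 divr_gt0 // mulr_gt0 // ltr_wpDl.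
  have [t0 h0 Hs] := sg_small e0; exists t0 => // t tT; have := Hs t tT.
  have s0 : 0 < sg t.
    apply: (mg_sg_gt0 H); case/andP: tT => u1 ->; rewrite andbT.
    by case/andP: h0 => u2 _; rewrite (le_lt_trans u2).
  rewrite -ltr_sqr ?nnegrE ?(ltW s0) ?(ltW e0) // sqr_sqrtr; last first.
    by rewrite ltW // divr_gt0 // mulr_gt0 // ltr_wpDl.
  have h1 : 0 <= `|h| by []; rewrite ltr_pdivlMr; last by lra.
  have := sqr_ge0 (sg t); nra.
exists t0; first by rewrite a0.
move=> t1 /andP[t01 t1T]; rewrite leNgt; apply/negP => vt1.
have at1 : a < t1 by exact: le_lt_trans t01.
pose Y t := sg t ^+ 2 * (v t + c).
pose dY t := q t * (sg t ^+ 2 * (v t * (v t + c) + F t / 2 + sg t ^+ 2 * h)).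
have DY t : a < t < T -> is_derive t (1 : R) Y (dY t).
  move=> tT.
  have D1 := is_deriveD (mg_dv H tT) (is_derive_cst c t 1).
  have D := is_deriveM (is_derive_sg2 tT) D1.
  by apply: is_derive_eq D _; rewrite /GRing.scale /= !fctE /dY -/(q t) -/(F t); ring.
have dY0 t : t0 < t < T -> 0 <= dY t.
  move=> tT; have aT' : a < t < T.
    by case/andP: tT => u1 ->; rewrite andbT (le_lt_trans a0).
  rewrite mulr_ge0 ?(ltW (q_gt0 aT')) // mulr_ge0 ?sqr_ge0 //.
  have E := mg_energy H aT'; rewrite -/(F t) in E.
  have := Hc0 _ (mg_noncoll H aT'); rewrite -cc => Hf.
  have := Hs t tT; have h1 : - `|h| <= h by rewrite lerNl -normrN ler_norm.
  have := sqr_ge0 (sg t); have := sqr_ge0 (v t + c); rewrite -cc => u1 u2 u3.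
  nra.
have Ymono t : t1 <= t < T -> Y t1 <= Y t.
  move=> /andP[u1 u2]; apply: (is_derive_homo u1) => [z|z] /andP[z1 z2].
    by apply: DY; rewrite (lt_le_trans at1) ?(le_lt_trans z2).
  by apply: dY0; rewrite (lt_trans t01) ?(lt_trans z2).
have Y1 : 0 < Y t1.
  rewrite mulr_gt0 ?exprn_gt0 //; last by lra.
  by apply: (mg_sg_gt0 H); rewrite at1.
have e0 : 0 < Num.sqrt (Y t1 / c) by rewrite sqrtr_gt0 divr_gt0.
have [t2 /andP[a2 t2T] Hs2] := sg_small e0.
have [t3 /andP[h1 h2]] : exists t3, Num.max t1 t2 < t3 < T.
  exists ((Num.max t1 t2 + T) / 2).
  have M : Num.max t1 t2 < T by rewrite gt_max t1T.
  by have := mid_in_itvoo M; rewrite in_itv.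
move: h1; rewrite gt_max => /andP[h13 h23].
apply: (@not_expanding t3); first by rewrite (le_lt_trans a2).
move=> t /andP[u1 u2].
have tT : a < t < T by rewrite (lt_le_trans (le_lt_trans a2 h23)).
have s0 := mg_sg_gt0 H tT.
have := Hs2 t; rewrite (lt_le_trans h23) // u2 => /(_ isT).
rewrite -ltr_sqr ?nnegrE ?(ltW s0) ?(ltW e0) // sqr_sqrtr ?(ltW (divr_gt0 _ _)) //.
rewrite ltr_pdivlMr // => Hc.
have := Ymono t; rewrite (ltW (lt_le_trans h13 u1)) u2 => /(_ isT); rewrite {2}/Y => Hy.
rewrite leNgt; apply/negP => vn.
have := exprn_gt0 2 s0; nra.
Qed.

(** In the rescaled time whose speed is [q = sg ^ -3], the function [ln sg] tends to
  minus infinity at a bounded rate, so this time is infinite and a bounded function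
  cannot grow in it at a uniform rate. *)
Lemma no_uniform_growth V (Z dZ : R -> R) B e : 0 < V -> 0 < e ->
  (forall t, a < t < T -> - V <= v t) ->
  (forall t, a < t < T -> is_derive t (1 : R) Z (dZ t)) ->
  (forall t, a < t < T -> q t * e <= dZ t) ->
  (forall t, a < t < T -> Z t <= B) -> False.
Proof.
move=> V0 e0 Hv DZ dZe ZB.
pose k := 2 * e / V; have k0 : 0 < k by rewrite divr_gt0 // mulr_gt0.
pose L t := Z t + k * ln (sg t).
pose dL t := dZ t + k * (q t * v t / 2).
have DL t : a < t < T -> is_derive t (1 : R) L (dL t).
  move=> tT; have s0 := mg_sg_gt0 H tT.
  have Dl := is_derive_comp (mg_dsg H tT) (differentiableP _).
  have [/derivable1_diffP dl El] := is_derive1_ln s0.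
  have [/derivable1_diffP ds Es] := mg_dsg H tT.
  have Dln : is_derive t (1 : R) (fun t => ln (sg t)) (q t * v t / 2).
    have d := @differentiable_comp _ _ _ _ sg (@ln R) t ds dl.
    apply: DeriveDef; first by apply/derivable1_diffP.
    rewrite -derive1E (@derive1_comp _ sg (@ln R) t); [|exact/derivable1_diffP|exact/derivable1_diffP].
    by rewrite !derive1E El Es -/(q t); field; rewrite gt_eqF.
  by have D := is_deriveD (DZ t tT) (is_deriveZ k Dln).
have dL0 t : a < t < T -> 0 <= dL t.
  move=> tT; have := dZe t tT; have := Hv t tT; have := q_gt0 tT.
  have E : k * V = 2 * e by rewrite /k mulfVK // gt_eqF.
  move=> q0 v0; rewrite /dL => d0.
  have : - (k * V) <= k * v t by rewrite -mulrN ler_pM2l.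
  rewrite E => h1; nra.
have [t1 t1T] : exists t1, a < t1 < T.
  by exists ((a + T) / 2); have := mid_in_itvoo aT; rewrite in_itv.
have [t2 /andP[a2 t2T] Hs] := sg_small (expR_gt0 ((L t1 - B) / k)).
have [t3 /andP[h1 h2]] : exists t3, Num.max t1 t2 < t3 < T.
  exists ((Num.max t1 t2 + T) / 2); case/andP: t1T => _ t1T.
  have M : Num.max t1 t2 < T by rewrite gt_max t1T.
  by have := mid_in_itvoo M; rewrite in_itv.
move: h1; rewrite gt_max => /andP[h13 h23]; case/andP: (t1T) => a1 _.
have t3i : a < t3 < T by rewrite (lt_trans a1).
have : L t1 <= L t3.
  apply: (is_derive_homo (ltW h13)) => t ht; first exact: (DL _ (sub a1 h2 ht)).
  by apply: dL0; apply: (sub a1 h2); case/andP: ht => *; rewrite !ltW.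
have := Hs t3; rewrite h23 h2 => /(_ isT); have s3 := mg_sg_gt0 H t3i.
rewrite -(@ltr_ln R) ?posrE ?expR_gt0 // expRK ltr_pdivlMr // => u1.
have := ZB t3 t3i; rewrite {2}/L; rewrite mulrC in u1; lra.
Qed.

End Flow.
End Asymptotics.

(** * Lyapunov function of a collapsing orbit *)

Section Lyapunov.
Context {R : realType} {N : nat} {m : 'I_N -> R}.
Hypothesis hm : forall k, 0 < m k.
Hypothesis hN : (2 <= N)%N.
Local Notation dotm := (mass_dot m).
Local Notation nrm := (mass_norm m).
Local Notation O := (@noncoll R N).
Local Notation U := (potential m).
Local Notation f := (scaled_potential m).
Local Notation G := (grad (m := m) (scaled_potential m)).
Let oO : open O := @noncoll_open R N.
Let sf := smooth_scaled_potential hm hN.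

(** The properties on which convergence rests. Writing [mu = |w|^2 + |grad f (s)|^2 +
  sg^2], the function [Z] increases at a rate at least a multiple of [sg ^ -3 mu], stays
  below the value [- sqrt (2 f (p))], and differs from it by at most a multiple of [|f
  (s) - f (p)| + mu]; the shape accumulates at [p] along times at which [mu] tends to
  zero. *)
Record gradient_like (a T : R) (s w : R -> config R N) (sg : R -> R)
    (p : config R N) (Z dZ : R -> R) (d A P : R) : Prop := {
  gl_noncoll : O p;
  gl_centered : p \in centered m;
  gl_unit : nrm p = 1;
  gl_crit : forall u, pd u f p = 0;
  gl_dZ : forall t, a < t < T -> is_derive t (1 : R) Z (dZ t);
  gl_growth : forall t, a < t < T -> (sg t)^-1 ^+ 3 * (d *
    (dotm (w t) (w t) + dotm (G (s t)) (G (s t)) + sg t ^+ 2)) <= dZ t;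
  gl_upper : forall t, a < t < T -> Z t <= - Num.sqrt (2 * f p);
  gl_gap : forall t, a < t < T -> - Num.sqrt (2 * f p) - Z t <= A * (`|f (s t) - f p| +
    (dotm (w t) (w t) + dotm (G (s t)) (G (s t)) + sg t ^+ 2));
  gl_bound : forall t, a < t < T ->
    dotm (w t) (w t) + dotm (G (s t)) (G (s t)) + sg t ^+ 2 <= P;
  gl_cluster : forall e t1, 0 < e -> t1 < T -> exists2 t, a < t < T & [/\ t1 < t,
    nrm (s t - p) < e &
    dotm (w t) (w t) + dotm (G (s t)) (G (s t)) + sg t ^+ 2 < e]
}.

Section Flow.
Context (a T : R) (s w : R -> config R N) (sg v : R -> R) (h c : R).
Hypothesis aT : a < T.
Hypothesis H : mcgehee (m := m) a T s w sg v h.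
Hypothesis sg0 : sg t @[t --> T^'-] --> (0 : R).
Hypothesis c0 : 0 < c.
Hypothesis vc : forall t, a < t < T -> v t <= - c.
Let q t := (sg t)^-1 ^+ 3.
Let F t := dotm (w t) (w t).
Let kappa := (`|h| + 1) / c.
Let G0 t := v t - kappa * sg t ^+ 2.
Let dG0 t := q t * (F t / 2 + sg t ^+ 2 * h - kappa * (v t * sg t ^+ 2)).

Let sub t1 t2 t : a < t1 -> t2 < T -> t1 <= t <= t2 -> a < t < T.
Proof. by move=> h1 h2 /andP[h3 h4]; rewrite (lt_le_trans h1) //= (le_lt_trans h4). Qed.

Let q_gt0 t : a < t < T -> 0 < q t.
Proof. by move=> tT; rewrite exprn_gt0 // invr_gt0 (mg_sg_gt0 H). Qed.

Let F_ge0 t : 0 <= F t. Proof. exact: mass_dot_ge0. Qed.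

Let kappa_ge0 : 0 <= kappa.
Proof. by rewrite divr_ge0 ?(ltW c0) // addr_ge0. Qed.

(** [G0] is the radial velocity corrected by a multiple of the size; the correction
  absorbs the energy term in its derivative, which becomes nonnegative. *)
Lemma is_derive_G0 t : a < t < T -> is_derive t (1 : R) G0 (dG0 t).
Proof.
move=> tT; have D := is_deriveB (mg_dv H tT) (is_deriveZ kappa (is_derive_sg2 H tT)).
by apply: is_derive_eq D _; rewrite /GRing.scale /= -/(q t) -/(F t) /dG0; ring.
Qed.

Lemma dG0_ge t : a < t < T -> q t * (F t / 2 + sg t ^+ 2) <= dG0 t.
Proof.
move=> tT; rewrite ler_wpM2l ?(ltW (q_gt0 tT)) // -addrA lerD2l.
have h1 : - `|h| <= h by rewrite lerNl -normrN ler_norm.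
have E : kappa * c = `|h| + 1 by rewrite /kappa mulfVK // gt_eqF.
have h3 : `|h| + 1 <= - kappa * v t.
  by rewrite -E mulNr -mulrN ler_wpM2l // lerNr vc.
have := sqr_ge0 (sg t); nra.
Qed.

Lemma dG0_ge0 t : a < t < T -> 0 <= dG0 t.
Proof.
move=> tT; apply: le_trans (dG0_ge tT); rewrite mulr_ge0 ?(ltW (q_gt0 tT)) //.
by rewrite addr_ge0 ?sqr_ge0 // divr_ge0.
Qed.

Lemma G0_homo t1 t2 : a < t1 -> t1 <= t2 -> t2 < T -> G0 t1 <= G0 t2.
Proof.
move=> h1 h2 h3; apply: (is_derive_homo h2) => t ht.
  by apply: is_derive_G0; exact: sub ht.
apply: dG0_ge0; apply: (sub h1 h3); case/andP: ht => *; by rewrite !ltW.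
Qed.

Lemma G0_le0 t : a < t < T -> G0 t <= 0.
Proof.
move=> tT; have := vc tT; have : 0 <= kappa * sg t ^+ 2 by rewrite mulr_ge0 // sqr_ge0.
by have := c0; rewrite /G0; lra.
Qed.

Lemma radial_bounded : exists2 V, 0 < V & exists2 t0, a <= t0 < T &
  forall t, t0 < t < T -> `|v t| <= V.
Proof.
have [t0] : exists t0, a < t0 < T.
  by exists ((a + T) / 2); have := mid_in_itvoo aT; rewrite in_itv.
move=> /andP[a0 t0T]; exists (`|G0 t0| + 1); first by rewrite ltr_wpDl.
exists t0; first by rewrite (ltW a0).
move=> t /andP[h1 h2]; have tT : a < t < T by rewrite (lt_trans a0).
have := G0_homo a0 (ltW h1) h2; have := vc tT.
have : 0 <= kappa * sg t ^+ 2 by rewrite mulr_ge0 // sqr_ge0.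
have : - `|G0 t0| <= G0 t0 by rewrite lerNl -normrN ler_norm.
rewrite {4}/G0 ler_norml => u1 u2 u3 u4.
by have n0 : 0 <= `|G0 t0| by []; have := c0; move=> cc; apply/andP; split; lra.
Qed.

Let midT : exists t, a < t < T.
Proof. by exists ((a + T) / 2); have := mid_in_itvoo aT; rewrite in_itv. Qed.

Lemma is_derive_F t : a < t < T ->
  is_derive t (1 : R) F (q t * (2 * pd (w t) f (s t) - v t * F t)).
Proof.
move=> tT.
have D1 := is_derive_comp (mg_ds H tT) (smooth_diff oO sf (mg_noncoll H tT)).
have D2 := is_derive_sg2 H tT.
have D3 := is_deriveM (mg_dv H tT) (mg_dv H tT).
have D := is_deriveB (is_deriveD (is_derive_mulc 2 D1) (is_derive_mulc (2 * h) D2)) D3.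
apply: is_derive_eq.
  apply: (near_eq_is_derive _ D).
  have : \forall u \near t, u \in `]a, T[%R by apply: near_in_itvoo; rewrite in_itv.
  apply: filterS => u; rewrite in_itv /= => uT; rewrite !fctE /GRing.scale /=.
  have := mg_energy H uT; rewrite -/(F u). lra.
rewrite /GRing.scale /= pdZ -/(q t) -/(F t).
set p := pd _ _ _; set g := sg t ^+ 2; by field.
Qed.

Hypothesis sg1 : forall t, a < t < T -> sg t <= 1.

Lemma potential_along t : a < t < T ->
  f (s t) <= 2^-1 * (v t ^+ 2 + F t) + `|h|.
Proof.
move=> tT; have := mg_energy H tT; rewrite -/(F t).
have h1 : - h <= `|h| by rewrite -normrN ler_norm.
have s1 : sg t ^+ 2 <= 1 by rewrite expr_le1 // ?sg1 // ltW // (mg_sg_gt0 H).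
have := sqr_ge0 (sg t); have : 0 <= `|h| by [].
have h2 : - (sg t ^+ 2 * h) <= `|h|.
  rewrite -mulrN; have [h0|h0] := leP 0 (- h); last first.
    by apply: le_trans (normr_ge0 h); rewrite mulr_ge0_le0 ?sqr_ge0 // ltW.
  by apply: le_trans h1; rewrite -[leRHS]mul1r ler_wpM2r.
by lra.
Qed.

(** The energy relation bounds the potential by [1 + F], and the differential of the
  potential is at most quadratic in the potential; hence [F' <= q K (1 + F)^3], and the
  increments of [(F / (1 + F))^2] are at most those of [4 K G0]. As [G0] is
  nondecreasing and bounded, its late increments are small, and [F] is small at some
  late time, since otherwise [G0] would grow at a uniform rate. *)
Lemma shape_velocity_bounded V : 0 < V -> (forall t, a < t < T -> `|v t| <= V) ->
  exists2 t0, a <= t0 < T & forall t, t0 < t < T -> F t <= 1.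
Proof.
move=> V0 Hv.
have [C C0 HC] := pd_potential_bound hm.
pose K1 := 2^-1 * V ^+ 2 + 2^-1 + `|h|.
pose K := 2 * (C * K1 ^+ 2) + V.
have K10 : 0 < K1 by have := normr_ge0 h; have := sqr_ge0 V; rewrite /K1; lra.
have K0 : 0 < K by rewrite addr_gt0 // !mulr_gt0 // exprn_gt0.
have psiB t : a < t < T -> `|pd (w t) f (s t)| <= C * K1 ^+ 2 * (1 + F t) ^+ 3.
  move=> tT; rewrite pd_scaled_potential //; last exact: mg_noncoll H t tT.
  rewrite (mg_orth H tT) !mul0r add0r (mg_unit H tT) mul1r.
  apply: (le_trans (HC _ _ (mg_noncoll H tT))).
  have fU : U (s t) = f (s t) by rewrite scaled_potentialE (mg_unit H tT) mul1r.
  have F1 : 0 <= 1 + F t by rewrite addr_ge0.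
  have f1 : f (s t) <= K1 * (1 + F t).
    apply: (le_trans (potential_along tT)).
    have v2 : v t ^+ 2 <= V ^+ 2.
      rewrite -(real_normK (num_real (v t))).
      by apply: lerXn2r; rewrite ?nnegrE ?(ltW V0) ?Hv.
    have := normr_ge0 h; have := F_ge0 t; have := sqr_ge0 V; rewrite /K1 => *; nra.
  have f0 : 0 <= f (s t) by rewrite -fU potential_ge0.
  have n1 : nrm (w t) <= 1 + F t.
    rewrite -ler_sqr ?nnegrE ?mass_norm_ge0 // mass_norm2 // -/(F t).
    have := F_ge0 t; nra.
  rewrite fU [_ ^+ 3]exprSr mulrA; apply: ler_pM => //.
  - by rewrite mulr_ge0 ?(ltW C0) // sqr_ge0.
  - exact: mass_norm_ge0.
  rewrite -mulrA ler_pM2l // -exprMn.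
  by apply: lerXn2r; rewrite ?nnegrE // mulr_ge0 // ltW.
pose dF t := q t * (2 * pd (w t) f (s t) - v t * F t).
have dFB t : a < t < T -> dF t <= q t * (K * (1 + F t) ^+ 3).
  move=> tT; rewrite /dF ler_wpM2l ?(ltW (q_gt0 tT)) //.
  have := psiB t tT; rewrite ler_norml => /andP[_ h1].
  have := Hv t tT; rewrite ler_norml => /andP[h2 _].
  have F3 : F t <= (1 + F t) ^+ 3.
    have := F_ge0 t; have := sqr_ge0 (F t); move: (F t) => x; rewrite !exprS expr0; nra.
  have : - v t * F t <= V * (1 + F t) ^+ 3.
    apply: (@le_trans _ _ (V * F t)); first by rewrite ler_wpM2r // lerNl.
    by rewrite ler_wpM2l // ltW.
  rewrite /K; move: h1; move: ((1 + F t) ^+ 3) => X; lra.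
pose th t := F t * (1 + F t)^-1.
pose L t := 4 * K * G0 t - th t ^+ 2.
pose dth t := F t * (- (1 + F t) ^- 2 * dF t) + (1 + F t)^-1 * dF t.
have F1 t : 0 < 1 + F t by rewrite ltr_pwDl.
have Dth t : a < t < T -> is_derive t (1 : R) th (dth t).
  move=> tT; have DF := is_derive_F tT.
  have n0 : 1 + F t != 0 by rewrite gt_eqF.
  have D2 := @is_derive_inv _ (fun t => 1 + F t) _ _ n0 (is_derive_addc 1 DF).
  exact: (is_deriveM DF D2).
pose dL t := 4 * K * (q t * (F t / 2 + sg t ^+ 2 * h - kappa * (v t * sg t ^+ 2))) -
     (th t * dth t + th t * dth t).
have DL t : a < t < T -> is_derive t (1 : R) L (dL t).
  move=> tT; have D0 := is_derive_G0 tT.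
  exact: (is_deriveB (is_deriveZ (4 * K) D0) (is_deriveM (Dth t tT) (Dth t tT))).
have dL0 t : a < t < T -> 0 <= dL t.
  move=> tT; rewrite /dL; have g0 := dG0_ge tT.
  have E : th t * dth t = F t / (1 + F t) ^+ 3 * dF t.
    by rewrite /th /dth; field; rewrite gt_eqF.
  have q0 := q_gt0 tT.
  have : th t * dth t <= q t * K * F t.
    rewrite E; apply: (@le_trans _ _ (F t / (1 + F t) ^+ 3 * (q t * (K * (1 + F t) ^+ 3)))).
      by rewrite ler_wpM2l ?dFB // divr_ge0 // exprn_ge0 // ltW.
    rewrite le_eqVlt; apply/orP; left; apply/eqP; field.
    by rewrite gt_eqF.
  have : q t * (F t / 2) <= q t * (F t / 2 + sg t ^+ 2 * h - kappa * (v t * sg t ^+ 2)).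
    by apply: le_trans g0; rewrite ler_wpM2l ?(ltW q0) // lerDl sqr_ge0.
  move: (q t * (_ - _)) => X h1 h2; have : 4 * K * (q t * (F t / 2)) <= 4 * K * X.
    by rewrite ler_wpM2l // mulr_ge0 // ltW.
  by move: h2; rewrite -/(q t); nra.
have Lmono t1 t2 : a < t1 -> t1 <= t2 -> t2 < T -> L t1 <= L t2.
  move=> h1 h2 h3; apply: (@is_derive_homo _ L dL t1 t2 h2) => t ht; first exact: (DL _ (sub h1 h3 ht)).
  by apply: dL0; apply: (sub h1 h3); case/andP: ht => *; rewrite !ltW.
pose S : set R := [set G0 t | t in [set t | a < t < T]].
have [tm tmT] := midT.
have hS : has_sup S.
  split; first by exists (G0 tm); exists tm.
  by exists 0 => _ [t tT <-]; exact: (G0_le0 tT).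
(* after [t0] the increments of [G0] are at most [(64 * K)^-1], those of [th ^ 2] at most 1/16 *)
have [_ [t0 t0T <-] g0] : exists2 y, S y & sup S - (64 * K)^-1 < y.
  by apply: sup_adherent => //; rewrite invr_gt0 mulr_gt0.
have [t1 t1T Ft1] : exists2 t1, t0 < t1 < T & F t1 <= 4^-1.
  apply: contrapT => nF.
  have /andP[a0 t0T'] := t0T.
  have H' := mcgehee_sub (ltW a0) H.
  have S' t : t0 < t < T -> a < t < T by move=> /andP[h1 ->]; rewrite andbT (lt_trans a0).
  apply: (@no_uniform_growth _ _ m t0 T s w sg v h t0T' H' sg0 V G0
    (fun t => q t * (F t / 2 + sg t ^+ 2 * h - kappa * (v t * sg t ^+ 2))) 0 8^-1 V0).
  - by rewrite invr_gt0.
  - by move=> t /S' /Hv; rewrite ler_norml => /andP[].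
  - by move=> t /S' tT; exact: (is_derive_G0 tT).
  - move=> t tT; have tT' := S' t tT; apply: (le_trans _ (dG0_ge tT')).
    rewrite -/(q t) ler_wpM2l ?(ltW (q_gt0 tT')) //.
    have : 4^-1 < F t by rewrite ltNge; apply/negP => Ft; apply: nF; exists t.
    by have := sqr_ge0 (sg t); rewrite -/(F t); lra.
  - by move=> t /S'; exact: G0_le0.
have [a0 t0T'] := andP t0T; have [t01 t1T'] := andP t1T.
have a1 : a < t1 by exact: lt_trans t01.
exists t1; first by rewrite (ltW a1).
move=> t /andP[h1 h2]; have tT : a < t < T by rewrite (lt_trans a1).
have : G0 t <= sup S by apply: ub_le_sup; [case: hS|exists t].
have := G0_homo a0 (ltW t01) t1T'; move=> g1 g2.
have g3 : G0 t - G0 t1 <= (64 * K)^-1 by lra.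
have := Lmono t1 t a1 (ltW h1) h2; rewrite /L => g4.
have g5 : 4 * K * (G0 t - G0 t1) <= 16^-1.
  apply: (@le_trans _ _ (4 * K * (64 * K)^-1)); first by rewrite ler_wpM2l // mulr_ge0 // ltW.
  by rewrite le_eqVlt; apply/orP; left; apply/eqP; field; rewrite gt_eqF.
have th1 : th t1 <= 4^-1.
  by rewrite /th ler_pdivrMr //; have := F_ge0 t1; lra.
have th10 : 0 <= th t1 by rewrite /th divr_ge0 // ltW.
have th2 : th t1 ^+ 2 <= 16^-1.
  apply: (@le_trans _ _ (4^-1 ^+ 2)); first by apply: lerXn2r; rewrite ?nnegrE // invr_ge0.
  lra.
have th3 : th t ^+ 2 <= 8^-1 by lra.
have th4 : th t <= 2^-1.
  have : 0 <= th t by rewrite /th divr_ge0 // ltW.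
  nra.
by move: th4; rewrite /th ler_pdivrMr //; lra.
Qed.

Context (V : R).
Hypothesis V0 : 0 < V.
Hypothesis Hv : forall t, a < t < T -> `|v t| <= V.
Hypothesis F1 : forall t, a < t < T -> F t <= 1.

Let psi t := pd (w t) f (s t).
Let g2 t := dotm (G (s t)) (G (s t)).
Let mu t := F t + g2 t + sg t ^+ 2.

Let g2_ge0 t : 0 <= g2 t. Proof. exact: mass_dot_ge0. Qed.

Let M := 2^-1 * (V ^+ 2 + 1) + `|h|.

Let sM t : a < t < T -> unit_sublevel (m := m) M (s t).
Proof.
move=> tT; apply: (unit_sublevelP hm).
- exact: (mg_noncoll H tT).
- exact: (mg_centered H tT).
- exact: (mg_unit H tT).
apply: (le_trans (potential_along tT)); rewrite lerD2r ler_pM2l ?invr_gt0 // lerD ?F1 //.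
rewrite -(real_normK (num_real (v t))).
by apply: lerXn2r; rewrite ?nnegrE ?(ltW V0) ?Hv.
Qed.

Let psiE t : psi t = dotm (G (s t)) (w t).
Proof. by rewrite gradE. Qed.

Let psi_le t : `|psi t| <= (F t + g2 t) / 2.
Proof.
rewrite psiE (le_trans (mass_CS hm _ _)) //.
have := sqr_ge0 (nrm (G (s t)) - nrm (w t)).
by rewrite sqrrB !mass_norm2 // -/(F t) -/(g2 t); lra.
Qed.

Lemma grad_bounded : exists2 P : R, 0 < P & forall t, a < t < T -> g2 t <= P.
Proof.
have [C C0 HC] := pd_potential_bound hm.
have M0 : 0 < M by have := normr_ge0 h; have := sqr_ge0 V; rewrite /M; lra.
exists ((C * M ^+ 2) ^+ 2) => [|t tT]; first by rewrite !exprn_gt0 // mulr_gt0 // exprn_gt0.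
have Os := mg_noncoll H tT; have ns := mg_unit H tT.
rewrite /g2 -mass_norm2 //.
have C2 : 0 <= C * M ^+ 2 by rewrite mulr_ge0 ?(ltW C0) // sqr_ge0.
apply: lerXn2r; rewrite ?nnegrE ?mass_norm_ge0 //.
have [->|n0] := eqVneq (nrm (G (s t))) 0 => //.
have np : 0 < nrm (G (s t)) by rewrite lt_neqAle mass_norm_ge0 eq_sym n0.
rewrite -(ler_pM2r np) -expr2 mass_norm2 // gradE //.
rewrite pd_scaled_potential // [dotm (s t) _]mass_dotC gradE //.
rewrite pd_scaled_potential_self // !mul0r add0r ns mul1r (le_trans (ler_norm _)) //.
rewrite (le_trans (HC _ _ Os)) // ler_pM2r // ler_pM2l //.
have fU : U (s t) = f (s t) by rewrite scaled_potentialE ns mul1r.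
have fM : f (s t) <= M.
  apply: (le_trans (potential_along tT)); rewrite lerD2r ler_pM2l ?invr_gt0 // lerD ?F1 //.
  rewrite -(real_normK (num_real (v t))).
  by apply: lerXn2r; rewrite ?nnegrE ?(ltW V0) ?Hv.
by rewrite fU; apply: lerXn2r; rewrite ?nnegrE -?fU ?potential_ge0 ?(ltW M0) // fU.
Qed.

(** The function is [Z = G0 + e psi] with [psi = df (s) w]. The growth of [G0] controls
  [|w|^2] and the size; the growth of [psi] adds [|grad f (s)|^2], up to terms that a
  small [e] makes negligible, because the Hessian of [f] is bounded on the compact set
  of the shapes visited. As [v] is negative, the comparison of [Z] with [- S] follows
  from the energy relation [v^2 = 2 f (s) - |w|^2 + 2 h sg^2]. *)
Lemma lyapunov : exists Z dZ : R -> R, exists d A : R, [/\ 0 < d, 0 < A &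
  [/\ forall t, a < t < T -> is_derive t (1 : R) Z (dZ t),
   forall t, a < t < T -> q t * (d * mu t) <= dZ t,
   forall t S, a < t < T -> 0 <= S ->
     `|Z t + S| <= A * (`|2 * f (s t) - S ^+ 2| + mu t) &
   forall t, a < t < T -> Z t <= F t + g2 t]].
Proof.
have [C2 C20 HC2] := pd2_bounded_sublevel hm hN M sf.
pose k := C2 + V ^+ 2 / 8 + 1.
have k1 : 1 <= k by have := sqr_ge0 V; rewrite /k; lra.
pose e := (4 * k)^-1.
have ke : k * e = 4^-1 by rewrite /e; field; rewrite gt_eqF //; lra.
have e0 : 0 < e by rewrite invr_gt0 mulr_gt0 //; lra.
have e1 : e <= 4^-1 by nra.
pose Z t := G0 t + e * psi t.
pose dZ t := q t * (F t / 2 + sg t ^+ 2 * h - kappa * (v t * sg t ^+ 2)) +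
  e * (q t * (g2 t - v t * psi t / 2 + pd (w t) (pd (w t) f) (s t))).
pose A := 2 / c + (2 * `|h| + 1) / c + kappa + 1.
exists Z, dZ, (e / 2), A; split; first by rewrite divr_gt0.
  have := normr_ge0 h; have : 0 < c^-1 by rewrite invr_gt0.
  move: kappa_ge0 => kk cc hh; rewrite /A.
  have : 0 <= (2 * `|h| + 1) / c by rewrite mulr_ge0 ?(ltW cc) // addr_ge0 // mulr_ge0.
  by lra.
split=> [t tT|t tT|t S tT S0|t tT].
- exact: (is_deriveD (is_derive_G0 tT) (is_derive_mulc e (mg_dpsi H tT))).
- have q0 := q_gt0 tT.
  apply: (@le_trans _ _ (q t * (F t / 2 + sg t ^+ 2) +
     e * (q t * (g2 t - v t * psi t / 2 + pd (w t) (pd (w t) f) (s t))))); last first.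
    by rewrite lerD2r; exact: (dG0_ge tT).
  rewrite (mulrCA e (q t)) -mulrDr ler_pM2l //.
  have := HC2 _ (w t) (sM tT); rewrite ler_norml -/(F t) => /andP[h2 _].
  have pF : psi t ^+ 2 <= F t * g2 t.
    rewrite psiE -(real_normK (num_real _)).
    apply: (@le_trans _ _ ((nrm (G (s t)) * nrm (w t)) ^+ 2)).
      by apply: lerXn2r; rewrite ?nnegrE ?mulr_ge0 ?mass_norm_ge0 // mass_CS.
    by rewrite exprMn !mass_norm2 // mulrC.
  have vp : v t * psi t / 2 <= g2 t / 2 + V ^+ 2 / 8 * F t.
    have vV : `|v t * psi t| <= V * `|psi t| by rewrite normrM ler_wpM2r // Hv.
    have : V * `|psi t| <= g2 t + V ^+ 2 / 4 * F t.
      have X0 : 0 <= g2 t + V ^+ 2 / 4 * F t.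
        by rewrite addr_ge0 // mulr_ge0 // divr_ge0 // sqr_ge0.
      rewrite -ler_sqr ?nnegrE ?mulr_ge0 ?(ltW V0) // exprMn real_normK ?num_real //.
      have := sqr_ge0 (g2 t - V ^+ 2 / 4 * F t).
      have : V ^+ 2 * psi t ^+ 2 <= V ^+ 2 * (F t * g2 t) by rewrite ler_wpM2l // sqr_ge0.
      by rewrite sqrrB sqrrD; lra.
    by have := ler_norm (v t * psi t); lra.
  have : e * (g2 t / 2 - (C2 + V ^+ 2 / 8) * F t) <=
    e * (g2 t - v t * psi t / 2 + pd (w t) (pd (w t) f) (s t)).
    by rewrite ler_pM2l //; lra.
  have kE : (C2 + V ^+ 2 / 8) = k - 1 by rewrite /k; lra.
  have : e * (k - 1) * F t <= 4^-1 * F t.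
    by rewrite ler_wpM2r // mulrBr mulr1 mulrC ke; lra.
  have : e * F t <= 4^-1 * F t by rewrite ler_wpM2r.
  have := sqr_ge0 (sg t); have := F_ge0 t; have := g2_ge0 t.
  have : e * sg t ^+ 2 <= 4^-1 * sg t ^+ 2 by rewrite ler_wpM2r // sqr_ge0.
  rewrite kE /mu; move: (F t) (g2 t) (sg t ^+ 2) => X Y W; lra.
- have E := mg_energy H tT; rewrite -/(F t) in E.
  have cv : c <= S - v t by have := vc tT; lra.
  have vS : `|v t + S| * c <= `|2 * f (s t) - S ^+ 2| + 2 * (sg t ^+ 2 * `|h|) + F t.
    apply: (@le_trans _ _ (`|v t + S| * `|S - v t|)).
      by rewrite ler_wpM2l // (le_trans cv) // ler_norm.
    rewrite -normrM.
    have -> : (v t + S) * (S - v t) = - (2 * f (s t) - S ^+ 2) - 2 * (sg t ^+ 2 * h) + F t.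
      by have : v t ^+ 2 = 2 * (sg t ^+ 2 * h) + 2 * f (s t) - F t; lra.
    rewrite (le_trans (ler_normD _ _)) // (ger0_norm (F_ge0 t)) lerD2r.
    rewrite (le_trans (ler_normB _ _)) // normrN lerD2l normrM (ger0_norm (ler0n _ 2)).
    by rewrite normrM (ger0_norm (sqr_ge0 _)).
  have -> : Z t + S = (v t + S) + (- (kappa * sg t ^+ 2)) + e * psi t.
    by rewrite /Z /G0; ring.
  rewrite (le_trans (ler_normD _ _)) //.
  have h1 := ler_normD (v t + S) (- (kappa * sg t ^+ 2)).
  rewrite normrN (ger0_norm (mulr_ge0 kappa_ge0 (sqr_ge0 _))) in h1.
  have h2 : `|e * psi t| <= mu t.
    rewrite normrM (gtr0_norm e0); have := psi_le t; have := normr_ge0 (psi t).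
    have := F_ge0 t; have := g2_ge0 t; have := sqr_ge0 (sg t); rewrite /mu; nra.
  have h3 : `|v t + S| <= (2 / c) * `|2 * f (s t) - S ^+ 2| + (2 * `|h| + 1) / c * mu t.
    rewrite -(ler_pM2r c0); apply: (le_trans vS).
    have -> : (2 / c * `|2 * f (s t) - S ^+ 2| + (2 * `|h| + 1) / c * mu t) * c =
      2 * `|2 * f (s t) - S ^+ 2| + (2 * `|h| + 1) * mu t by field; rewrite gt_eqF.
    have := normr_ge0 (2 * f (s t) - S ^+ 2); have := normr_ge0 h.
    have := F_ge0 t; have := g2_ge0 t; have := sqr_ge0 (sg t); rewrite /mu.
    move: (F t) (g2 t) (sg t ^+ 2) `|h| => X Y W hh x1 x2 x3 x4 x5; nra.
  have h4 : kappa * sg t ^+ 2 <= kappa * mu t.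
    by rewrite ler_wpM2l // /mu lerDr addr_ge0.
  have mu0 : 0 <= mu t by rewrite /mu !addr_ge0 // sqr_ge0.
  have B0 : 0 <= `|2 * f (s t) - S ^+ 2| by [].
  have c20 : 0 <= 2 / c by rewrite divr_ge0 // ltW.
  have hc0 : 0 <= (2 * `|h| + 1) / c by rewrite divr_ge0 ?(ltW c0) // addr_ge0 // mulr_ge0.
  move: h1 h2 h3 h4 kappa_ge0; rewrite /A.
  move: (2 / c) (_ / c) kappa `|_ - S ^+ 2| (mu t) mu0 B0 c20 hc0 => x1 x2 x3 x4 x5 *.
  nra.
- have := G0_le0 tT => g0.
  have := psi_le t; have := ler_norm (psi t); have := F_ge0 t; have := g2_ge0 t.
  have := normr_ge0 (psi t); rewrite /Z; nra.
Qed.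

End Flow.
End Lyapunov.

(** * Critical limit shapes *)

Section LimitShapes.
Context {R : realType} {N : nat} {m : 'I_N -> R}.
Hypothesis hm : forall k, 0 < m k.
Hypothesis hN : (2 <= N)%N.
Local Notation dotm := (mass_dot m).
Local Notation nrm := (mass_norm m).
Local Notation O := (@noncoll R N).
Local Notation f := (scaled_potential m).
Local Notation G := (grad (m := m) (scaled_potential m)).
Let oO : open O := @noncoll_open R N.
Let sf := smooth_scaled_potential hm hN.

(** The accumulation point is that of a sequence of times at which [mu] is below [1 /
  n.+1]. *)
Lemma cluster_point (a T : R) (K : set (config R N)) (s : R -> config R N) (mu : R -> R) :
  a < T -> compact K -> (forall t, a < t < T -> K (s t)) ->
  (forall e t1, 0 < e -> t1 < T -> exists2 t, a < t < T & t1 < t /\ mu t < e) ->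
  exists2 p, K p & forall e t1, 0 < e -> t1 < T ->
    exists2 t, a < t < T & [/\ t1 < t, nrm (s t - p) < e & mu t < e].
Proof.
move=> aT cK sK Hmu.
have e_gt0 n : 0 < n.+1%:R^-1 :> R by [].
have Te n : T - n.+1%:R^-1 < T by rewrite ltrBlDr ltrDl.
pose u n : R := s2val (cid2 (Hmu _ _ (e_gt0 n) (Te n))).
have uT n : a < u n < T by exact: (s2valP (cid2 (Hmu _ _ (e_gt0 n) (Te n)))).
have uH n : T - n.+1%:R^-1 < u n /\ mu (u n) < n.+1%:R^-1.
  exact: (s2valP' (cid2 (Hmu _ _ (e_gt0 n) (Te n)))).
have [p Kp cp] : exists2 p, K p & cluster (s (u n) @[n --> \oo]) p.
  have FK : (s (u n) @[n --> \oo]) K by exists 0%N => // n _; apply: sK.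
  have PF : ProperFilter (s (u n) @[n --> \oo]) by exact: fmap_proper_filter.
  have [p [Kp cp]] := cK _ PF FK.
  by exists p.
exists p => // e t1 e0 t1T.
have N1 : nbhs p [set x | nrm (x - p) < e] by apply/(near_mass_norm hm); exists e.
have N2 : (s (u n) @[n --> \oo]) [set s (u n) | n in [set n | T - u n < T - t1 /\ mu (u n) < e]].
  have m0 : 0 < Num.min (T - t1) e by rewrite lt_min subr_gt0 t1T.
  have [k _ Hk] := near_infty_natSinv_lt (PosNum m0).
  exists k => // n /= kn; exists n => //=.
  have := Hk n kn; rewrite /= lt_min => /andP[h1 h2].
  have [h3 h4] := uH n; split; last exact: lt_trans h2.
  by apply: lt_trans h1; rewrite ltrBlDr -ltrBlDl.
have [x [[n [h1 h2] <-] h3]] := cp _ _ N2 N1.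
exists (u n) => //; split => //.
by move: h1; rewrite ltrD2l ltrN2.
Qed.

(** After restriction to late times all the bounds hold. Since [Z] is bounded, [mu]
  cannot stay above a positive constant; a shape [p] at which the orbit accumulates
  while [mu] tends to zero is critical, and [Z] being nondecreasing stays below the
  value [- sqrt (2 f (p))] that it approaches along these times. *)
Theorem collision_gradient_like (a T : R) s w sg v (h : R) : a < T ->
  mcgehee (m := m) a T s w sg v h -> sg t @[t --> T^'-] --> (0 : R) ->
  exists a' p Z dZ d A P, [/\ a <= a' < T, 0 < d, 0 < A, 0 < P &
    gradient_like (m := m) a' T s w sg p Z dZ d A P].
Proof.
move=> aT H sg0.
have [c c0 [t0 /andP[a0 t0T] vc]] := inward_speed hm hN aT H sg0.
have {}H := mcgehee_sub a0 H.
have [V V0 [t1 /andP[a1 t1T] Hv]] := radial_bounded hm t0T H c0 vc.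
have [t2 /andP[a2 t2T] sg1] := sg_small t1T sg0 ltr01.
have a02 : t0 <= t2 by exact: le_trans a2.
have {}H := mcgehee_sub a02 H.
have {}vc t : t2 < t < T -> v t <= - c.
  by move=> /andP[h1 h2]; apply: vc; rewrite (le_lt_trans a02 h1).
have {}Hv t : t2 < t < T -> `|v t| <= V.
  by move=> /andP[h1 h2]; apply: Hv; rewrite (le_lt_trans a2 h1).
have {}sg1 t : t2 < t < T -> sg t <= 1 by move=> /sg1/ltW.
have [t3 /andP[a3 t3T] F1] := shape_velocity_bounded hm hN t2T H sg0 c0 vc sg1 V0 Hv.
have {}H := mcgehee_sub a3 H.
have a33 t : t3 < t < T -> t2 < t < T.
  by move=> /andP[h1 ->]; rewrite (le_lt_trans a3 h1).
have {}vc t : t3 < t < T -> v t <= - c by move=> /a33/vc.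
have {}Hv t : t3 < t < T -> `|v t| <= V by move=> /a33/Hv.
have {}sg1 t : t3 < t < T -> sg t <= 1 by move=> /a33/sg1.
have [Z [dZ [d [A [d0 A0 [DZ dZge Zgap Zle]]]]]] :=
  lyapunov hm hN H c0 vc sg1 V0 Hv F1.
have [P P0 g2P] := grad_bounded hm hN H sg1 V0 Hv F1.
have sM t : t3 < t < T -> unit_sublevel (m := m) (2^-1 * (V ^+ 2 + 1) + `|h|) (s t).
  move=> tT; apply: (unit_sublevelP hm).
  - exact: (mg_noncoll H tT).
  - exact: (mg_centered H tT).
  - exact: (mg_unit H tT).
  apply: (le_trans (potential_along H sg1 tT)).
  rewrite lerD2r ler_pM2l ?invr_gt0 // lerD ?F1 //.
  rewrite -(real_normK (num_real (v t))).
  by apply: lerXn2r; rewrite ?nnegrE ?(ltW V0) ?Hv.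
pose mu t := dotm (w t) (w t) + dotm (G (s t)) (G (s t)) + sg t ^+ 2.
have mu0 t : 0 <= mu t by rewrite !addr_ge0 ?mass_dot_ge0 // sqr_ge0.
have cl e t4 : 0 < e -> t4 < T -> exists2 t, t3 < t < T & t4 < t /\ mu t < e.
  move=> e0 t4T; apply: contrapT => nH.
  have M : Num.max t3 t4 < T by rewrite gt_max t3T.
  have M3 : t3 <= Num.max t3 t4 by rewrite le_max lexx.
  have S t : Num.max t3 t4 < t < T -> t3 < t < T.
    by move=> /andP[h1 ->]; rewrite (le_lt_trans M3 h1).
  have H' := mcgehee_sub M3 H.
  apply: (@no_uniform_growth _ _ m _ T s w sg v h M H' sg0 V Z dZ (1 + P) (d * e) V0).
  - exact: mulr_gt0.
  - by move=> t /S/Hv; rewrite ler_norml => /andP[].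
  - by move=> t /S; exact: DZ.
  - move=> t tT; apply: (le_trans _ (dZge t (S t tT))).
    rewrite ler_pM2l ?exprn_gt0 ?invr_gt0 ?(mg_sg_gt0 H (S t tT)) // ler_pM2l //.
    rewrite leNgt; apply/negP => mue; apply: nH; exists t; first exact: S.
    by split => //; case/andP: tT; rewrite gt_max => /andP[].
  - by move=> t /S tT; apply: (le_trans (Zle t tT)); rewrite lerD ?F1 ?g2P.
have ge_min_l x y : Num.min x y <= x :> R by rewrite ge_min lexx.
have ge_min_r x y : Num.min x y <= y :> R by rewrite ge_min lexx orbT.
have [p Kp Hp] := cluster_point t3T (@unit_sublevel_compact _ _ _ hm hN _) sM cl.
have Op := unit_sublevel_noncoll hm Kp.
have [cp np _] := Kp.
have crit u : pd u f p = 0.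
  apply: contrapT => /eqP nz.
  have cont := smooth_continuous oO (smooth_pd oO u sf) Op.
  have pz : 0 < `|pd u f p| / 2 by rewrite divr_gt0 // normr_gt0.
  move/cvgrPdist_lt : cont => /(_ _ pz)/(near_mass_norm hm)[e e0 He].
  pose e' := Num.min e ((`|pd u f p| / (2 * (nrm u + 1))) ^+ 2).
  have nu := mass_norm_ge0 (m := m) u.
  have x0 : 0 < `|pd u f p| / (2 * (nrm u + 1)).
    by rewrite divr_gt0 ?normr_gt0 // mulr_gt0 // ltr_wpDl.
  have e'0 : 0 < e' by rewrite lt_min e0 exprn_gt0.
  have [t tT [_ h1 h2]] := Hp e' t3 e'0 t3T.
  have h3 := He (s t) (lt_le_trans h1 (ge_min_l _ _)).
  have h4 : nrm (G (s t)) < `|pd u f p| / (2 * (nrm u + 1)).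
    rewrite -ltr_sqr ?nnegrE ?mass_norm_ge0 ?(ltW x0) // mass_norm2 //.
    apply: le_lt_trans (lt_le_trans h2 (ge_min_r _ _)).
    by rewrite /mu addrAC lerDr addr_ge0 ?mass_dot_ge0 // sqr_ge0.
  have h5 : `|pd u f (s t)| <= nrm (G (s t)) * nrm u by rewrite -(gradE hm) mass_CS.
  have h6 : nrm (G (s t)) * nrm u <= `|pd u f p| / 2.
    apply: (@le_trans _ _ (`|pd u f p| / (2 * (nrm u + 1)) * (nrm u + 1))).
      by rewrite ler_pM ?mass_norm_ge0 ?(ltW h4) // lerDl.
    by rewrite le_eqVlt; apply/orP; left; apply/eqP; field; rewrite gt_eqF // ltr_wpDl.
  have h7 := ler_normD (pd u f p - pd u f (s t)) (pd u f (s t)).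
  by rewrite subrK in h7; lra.
have f0 : 0 <= f p by rewrite scaled_potentialE mulr_ge0 ?mass_norm_ge0 ?potential_ge0.
pose S := Num.sqrt (2 * f p).
have S0 : 0 <= S by exact: sqrtr_ge0.
have S2 : S ^+ 2 = 2 * f p by rewrite sqr_sqrtr // mulr_ge0.
have gap t : t3 < t < T -> `|Z t + S| <= 2 * A * (`|f (s t) - f p| + mu t).
  move=> tT; apply: (le_trans (Zgap t S tT S0)).
  rewrite S2 -mulrBr normrM (ger0_norm (ler0n _ 2)).
  by have := mu0 t; have := normr_ge0 (f (s t) - f p); rewrite -/(mu t); nra.
have up t : t3 < t < T -> Z t <= - S.
  move=> tT; rewrite leNgt; apply/negP => ZS.
  pose eta := (Z t + S) / (8 * A).
  have eta0 : 0 < eta by rewrite divr_gt0 ?mulr_gt0 // -ltrBlDr sub0r.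
  have cont := smooth_continuous oO sf Op.
  move/cvgrPdist_lt : cont => /(_ _ eta0)/(near_mass_norm hm)[e e0 He].
  have e'0 : 0 < Num.min e eta by rewrite lt_min e0.
  have [/andP[_ tT']] := (tT, tT).
  have [u uT [tu h1 h2]] := Hp _ t e'0 tT'.
  have h3 := He (s u) (lt_le_trans h1 (ge_min_l _ _)).
  have h4 := lt_le_trans h2 (ge_min_r _ _).
  have h5 := gap u uT.
  have Zm : Z t <= Z u.
    apply: (is_derive_homo (ltW tu)) => z /andP[z1 z2].
      apply: DZ; case/andP: tT => t3t _; case/andP: uT => _ uT.
      by rewrite (lt_le_trans t3t z1) (le_lt_trans z2 uT).
    have zT : t3 < z < T.
      case/andP: tT => t3t _; case/andP: uT => _ uT.
      by rewrite (lt_trans t3t z1) (lt_trans z2 uT).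
    apply: (le_trans _ (dZge z zT)); rewrite mulr_ge0 //.
      by rewrite exprn_ge0 // invr_ge0 ltW // (mg_sg_gt0 H zT).
    by rewrite mulr_ge0 ?(ltW d0) // mu0.
  have h6 := ler_norm (Z u + S).
  have E : 8 * A * eta = Z t + S by rewrite /eta; field; rewrite gt_eqF.
  rewrite distrC in h3.
  have h7 : 2 * A * (`|f (s u) - f p| + mu u) <= 2 * A * (2 * eta).
    by rewrite ler_pM2l ?mulr_gt0 //; lra.
  have h8 : 0 < A * eta by exact: mulr_gt0.
  by lra.
exists t3, p, Z, dZ, d, (2 * A), (1 + P + 1); split => //.
- by rewrite t3T (le_trans a0) // (le_trans a02).
- by rewrite mulr_gt0.
- by rewrite !addr_gt0.
split => // [t tT|t tT].
- apply: (le_trans _ (gap t tT)); rewrite -/S -normrN opprD [- Z t + _]addrC.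
  exact: ler_norm.
- rewrite lerD ?lerD ?F1 ?g2P // expr_le1 ?sg1 // ltW //; exact: (mg_sg_gt0 H tT).
Qed.

End LimitShapes.

(** * Convergence of the shape *)

Section Convergence.
Context {R : realType} {N : nat} {m : 'I_N -> R}.
Hypothesis hm : forall k, 0 < m k.
Hypothesis hN : (2 <= N)%N.
Local Notation dotm := (mass_dot m).
Local Notation nrm := (mass_norm m).
Local Notation O := (@noncoll R N).
Local Notation f := (scaled_potential m).
Local Notation G := (grad (m := m) (scaled_potential m)).
Let oO : open O := @noncoll_open R N.
Let sf := smooth_scaled_potential hm hN.

(** The gradient inequality with exponent [n / n.+1], written with natural powers. *)
Definition lojasiewicz_at (p : config R N) : Prop := exists n : nat, exists C d : R,
  [/\ (0 < n)%N, 0 < C, 0 < d & forall x, O x -> x \in centered m -> nrm x = 1 ->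
    nrm (x - p) < d -> `|f x - f p| ^+ n <= C * nrm (G x) ^+ n.+1].

(** The length argument of Lojasiewicz. Let [E] be the gap between [Z] and [- sqrt (2 f
  (p))] and [pp] the square root of [mu]. The gradient inequality gives [E ^ n <= C1 *
  pp ^ n.+1], so [E ^ (1 / n.+1)] decreases at a rate at least [c1 q pp] while the
  shape, close to [p], moves at a speed at most [q pp]. The length travelled is then
  bounded by a multiple of [E ^ (1 / n.+1)], which is arbitrarily small at the times
  when the shape is close to [p], and the shape cannot leave a small ball around [p] any
  more. *)
Theorem gradient_like_cvg (a T : R) s w sg v (h : R) p Z dZ d A P :
  a < T -> mcgehee (m := m) a T s w sg v h ->
  0 < d -> 0 < A -> 0 < P -> gradient_like (m := m) a T s w sg p Z dZ d A P ->
  lojasiewicz_at p -> s t @[t --> T^'-] --> p.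
Proof.
move=> aT H d0 A0 P0 GL [n [C [dl [n0 C0 dl0 Loj]]]].
pose q t := (sg t)^-1 ^+ 3.
pose mu t := dotm (w t) (w t) + dotm (G (s t)) (G (s t)) + sg t ^+ 2.
pose pp t := Num.sqrt (mu t).
have q0 t : a < t < T -> 0 < q t.
  by move=> tT; rewrite exprn_gt0 // invr_gt0 (mg_sg_gt0 H).
have mu0 t : a < t < T -> 0 < mu t.
  by move=> tT; rewrite ltr_wpDl ?addr_ge0 ?mass_dot_ge0 // exprn_gt0 // (mg_sg_gt0 H).
have pp0 t : a < t < T -> 0 < pp t by move=> tT; rewrite sqrtr_gt0 mu0.
have pp2 t : a < t < T -> pp t ^+ 2 = mu t by move=> tT; rewrite sqr_sqrtr // ltW // mu0.
have wpp t : nrm (w t) <= pp t.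
  by rewrite /pp ler_wsqrtr // /mu -addrA lerDl addr_ge0 ?mass_dot_ge0 // sqr_ge0.
have Gpp t : nrm (G (s t)) <= pp t.
  by rewrite /pp ler_wsqrtr // /mu addrAC lerDr addr_ge0 ?mass_dot_ge0 // sqr_ge0.
pose E t := - Num.sqrt (2 * f p) - Z t.
have DZ t : a < t < T -> is_derive t (1 : R) Z (dZ t) by exact: (gl_dZ GL).
have dZge t : a < t < T -> q t * (d * mu t) <= dZ t by exact: (gl_growth GL).
have dZ0 t : a < t < T -> 0 < dZ t.
  move=> tT; apply: lt_le_trans (dZge t tT).
  by rewrite mulr_gt0 ?q0 // mulr_gt0 // mu0.
have E0 t : a < t < T -> 0 < E t.
  move=> tT; have /andP[at' tT'] := tT; pose u := (t + T) / 2.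
  have /andP[tu uT] : t < u < T by have := mid_in_itvoo tT'; rewrite in_itv.
  have auT : a < u < T by rewrite (lt_trans at' tu).
  rewrite subr_gt0; apply: (lt_le_trans _ (gl_upper GL auT)).
  apply: (is_derive_homo_lt tu) => z /andP[z1 z2].
    by apply: DZ; rewrite (lt_le_trans at' z1) (le_lt_trans z2 uT).
  by apply: dZ0; rewrite (lt_trans at' z1) (lt_trans z2 uT).
pose Q := P + 1.
pose C1 := (2 * A) ^+ n * (C + Q ^+ n.-1).
have Q0 : 0 < Q by rewrite addr_gt0.
have C10 : 0 < C1.
  by rewrite mulr_gt0 ?exprn_gt0 ?mulr_gt0 // addr_gt0 // exprn_gt0.
have Epp t : a < t < T -> nrm (s t - p) < dl -> E t ^+ n <= C1 * pp t ^+ n.+1.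
  move=> tT sp.
  have L1 := Loj _ (mg_noncoll H tT) (mg_centered H tT) (mg_unit H tT) sp.
  have muge0 : 0 <= mu t by rewrite ltW // mu0.
  have ppge0 : 0 <= pp t by rewrite ltW // pp0.
  apply: (@le_trans _ _ ((A * (`|f (s t) - f p| + mu t)) ^+ n)).
    apply: lerXn2r; rewrite ?nnegrE ?(ltW (E0 _ tT)) //.
      by apply: mulr_ge0; [exact: ltW|exact: addr_ge0].
    exact: (gl_gap GL).
  rewrite exprMn; apply: (@le_trans _ _ (A ^+ n * (2 ^+ n * (`|f (s t) - f p| ^+ n + mu t ^+ n)))).
    by rewrite ler_wpM2l ?exprn_ge0 ?(ltW A0) // exprn_add_le.
  rewrite mulrA -exprMn [A * 2]mulrC /C1 -mulrA ler_pM2l ?exprn_gt0 ?mulr_gt0 // mulrDl.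
  apply: lerD.
    apply: (le_trans L1); rewrite ler_pM2l //.
    by apply: lerXn2r; rewrite ?nnegrE ?mass_norm_ge0.
  have -> : mu t ^+ n = pp t ^+ n.-1 * pp t ^+ n.+1.
    by rewrite -pp2 // -exprM -exprD mul2n -addnn addnS -addSn prednK.
  rewrite ler_wpM2r ?exprn_ge0 //.
  apply: lerXn2r; rewrite ?nnegrE ?(ltW Q0) //.
  have := gl_bound GL tT; rewrite -/(mu t) -pp2 // /Q; nra.
pose N1 : R := n.+1%:R.
have N10 : 0 < N1 by rewrite ltr0n.
(* the power [E ^ (1 / n.+1)], as an exponential *)
pose phi t := expR (ln (E t) / N1).
pose dphi t := phi t * (- dZ t / E t / N1).
have phi0 t : 0 < phi t by exact: expR_gt0.
have phiE t : a < t < T -> phi t ^+ n.+1 = E t.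
  move=> tT; rewrite /phi -expRM_natl -/N1 mulrCA divff ?mulr1 ?gt_eqF //.
  by rewrite lnK // posrE E0.
have Dphi t : a < t < T -> is_derive t (1 : R) phi (dphi t).
  move=> tT.
  have DE : is_derive t (1 : R) E (- dZ t).
    have D := is_derive_addc (- Num.sqrt (2 * f p)) (is_derive_mulc (-1) (DZ t tT)).
    rewrite (_ : E = (fun t => - Num.sqrt (2 * f p) + -1 * Z t)).
      by apply: is_derive_eq D _; rewrite mulN1r.
    by apply/funext => u; rewrite /E mulN1r.
  have [/derivable1_diffP dl' El] := is_derive1_ln (E0 t tT).
  have [/derivable1_diffP ds Es] := DE.
  have Dln : is_derive t (1 : R) (fun t => N1^-1 * ln (E t)) (- dZ t / E t / N1).
    have d1 := @differentiable_comp _ _ _ _ E (@ln R) t ds dl'.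
    have D1 : is_derive t (1 : R) (fun t => ln (E t)) (- dZ t / E t).
      apply: DeriveDef; first by apply/derivable1_diffP.
      rewrite -derive1E (@derive1_comp _ E (@ln R) t); [|exact/derivable1_diffP|exact/derivable1_diffP].
      by rewrite !derive1E El Es mulrC.
    by apply: is_derive_eq (is_derive_mulc N1^-1 D1) _; rewrite mulrC.
  have [/derivable1_diffP dl2 El2] := Dln.
  have [/derivable1_diffP de Ee] := is_derive_expR (N1^-1 * ln (E t)).
  rewrite (_ : phi = expR \o (fun t => N1^-1 * ln (E t))); last first.
    by apply/funext => u; rewrite /phi /= mulrC.
  have d1 := @differentiable_comp _ _ _ _ (fun t => N1^-1 * ln (E t)) (@expR R) t dl2 de.
  apply: DeriveDef; first by apply/derivable1_diffP.
  rewrite -derive1E derive1_comp; [|exact/derivable1_diffP|exact/derivable1_diffP].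
  by rewrite !derive1E El2 Ee /dphi /phi mulrC [ln _ / _]mulrC mulrC.
pose C2 := C1 + 1; have C20 : 0 < C2 by rewrite addr_gt0.
pose c1 := d / (N1 * C2).
have c10 : 0 < c1 by rewrite divr_gt0 // mulr_gt0.
have dphile t : a < t < T -> nrm (s t - p) < dl -> dphi t <= - (q t * (c1 * pp t)).
  move=> tT sp; have E1 := E0 t tT; have ph := phi0 t; have pt := pp0 t tT.
  have pn : phi t ^+ n <= C2 * pp t.
    have C2p : 0 <= C2 * pp t by rewrite mulr_ge0 // ltW.
    rewrite -(ler_pXn2r (ltn0Sn n)) ?nnegrE ?exprn_ge0 ?(ltW ph) //.
    rewrite -exprM mulnC exprM phiE // (le_trans (Epp t tT sp)) // exprMn.
    rewrite ler_pM2r ?exprn_gt0 // (@le_trans _ _ C2) //; first by rewrite lerDl.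
    by apply: ler_eXnr => //; rewrite /C2 lerDr ltW.
  have phn : 0 < phi t ^+ n by exact: exprn_gt0.
  have -> : dphi t = - (dZ t / phi t ^+ n / N1).
    rewrite /dphi -phiE // exprS; field.
    by rewrite !gt_eqF.
  rewrite lerN2 ler_pdivlMr // ler_pdivlMr //.
  apply: (le_trans _ (dZge t tT)); rewrite -pp2 //.
  have -> : q t * (c1 * pp t) * N1 * phi t ^+ n =
    q t * (c1 * (pp t * (N1 * phi t ^+ n))) by ring.
  rewrite (ler_pM2l (q0 t tT)).
  have -> : d * pp t ^+ 2 = c1 * (pp t * (N1 * (C2 * pp t))).
    by rewrite /c1; field; rewrite !gt_eqF.
  by rewrite (ler_pM2l c10) (ler_pM2l (pp0 t tT)) (ler_pM2l N10).
have len t1 t2 : a < t1 -> t1 <= t2 -> t2 < T ->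
    (forall t, t1 < t < t2 -> nrm (s t - p) < dl) ->
    nrm (s t2 - s t1) <= phi t1 / c1.
  move=> at1 t12 t2T Hin.
  have sub t : t1 <= t <= t2 -> a < t < T.
    by move=> /andP[z1 z2]; rewrite (lt_le_trans at1 z1) (le_lt_trans z2 t2T).
  set u := s t2 - s t1; pose k := nrm u / c1.
  have k0 : 0 <= k by rewrite divr_ge0 ?mass_norm_ge0 // ltW.
  pose L t := -1 * (dotm (s t) u + k * phi t).
  pose dL t := -1 * (dotm (q t *: w t) u + dotm (s t) 0 + k * dphi t).
  have : L t1 <= L t2.
    apply: (@is_derive_homo _ L dL t1 t2 t12) => t tT.
      have D1 := is_derive_mass_dot (m := m) (mg_ds H (sub t tT)) (is_derive_cst u t 1).
      exact: (is_derive_mulc (-1) (is_deriveD D1 (is_derive_mulc k (Dphi t (sub t tT))))).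
    have tT' : a < t < T by apply: sub; case/andP: tT => *; rewrite !ltW.
    rewrite /dL mass_dot0r addr0 mass_dotZl mulN1r oppr_ge0.
    have h1 : dotm (w t) u <= pp t * nrm u.
      by apply: (le_trans (mass_dot_le hm _ _)); rewrite ler_wpM2r ?mass_norm_ge0.
    have h2 := dphile t tT' (Hin t tT).
    have h3 : k * dphi t <= k * - (q t * (c1 * pp t)) by rewrite ler_wpM2l.
    have h4 : k * - (q t * (c1 * pp t)) = - (q t * (pp t * nrm u)).
      by rewrite /k; field; rewrite gt_eqF.
    have h5 : q t * dotm (w t) u <= q t * (pp t * nrm u) by rewrite ler_pM2l ?q0.
    by rewrite h4 in h3; have := lerD h5 h3; rewrite subrr.
  rewrite /L !mulN1r lerN2 => hL.
  have h1 : dotm u u <= k * phi t1.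
    have -> : dotm u u = dotm (s t2) u - dotm (s t1) u by rewrite -mass_dotBl.
    by have := mulr_ge0 k0 (ltW (phi0 t2)); lra.
  have [u0|u0] := eqVneq (nrm u) 0; first by rewrite u0 divr_ge0 // ltW.
  have un : 0 < nrm u by rewrite lt_neqAle eq_sym u0 mass_norm_ge0.
  rewrite -(ler_pM2l un) -expr2 mass_norm2 // (le_trans h1) // /k mulrAC.
  by rewrite mulrA.
have Op := gl_noncoll GL.
have main e : 0 < e -> exists2 t1, t1 < T & forall t, t1 < t < T -> nrm (s t - p) < e.
  move=> e_gt0; pose e' := Num.min e dl.
  have e'0 : 0 < e' by rewrite lt_min e_gt0.
  pose X := (c1 * (e' / 2)) ^+ n.+1 / (4 * A).
  have ce : 0 < c1 * (e' / 2) by apply: mulr_gt0 => //; exact: divr_gt0.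
  have X0 : 0 < X by apply: divr_gt0; [exact: exprn_gt0|exact: mulr_gt0].
  have cont := smooth_continuous oO sf Op.
  move/cvgrPdist_lt : cont => /(_ _ X0)/(near_mass_norm hm)[e1 e10 He].
  have m0 : 0 < Num.min (e' / 2) (Num.min e1 X) by rewrite !lt_min divr_gt0 // e10.
  have [t1 t1T [_ h1 h2]] := gl_cluster GL m0 aT.
  rewrite -/(mu t1) in h2; move: h1 h2; rewrite !lt_min => /and3P[h1 h1' _] /and3P[_ _ h2].
  have h3 := He _ h1'; rewrite distrC in h3.
  have h4 : E t1 < (c1 * (e' / 2)) ^+ n.+1.
    apply: (le_lt_trans (gl_gap GL t1T)); rewrite -/(mu t1).
    have : A * (`|f (s t1) - f p| + mu t1) <= A * (X + X).
      by rewrite ler_pM2l // lerD // ltW.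
    have -> : A * (X + X) = (c1 * (e' / 2)) ^+ n.+1 / 2.
      by rewrite /X; field; rewrite gt_eqF.
    have : 0 < (c1 * (e' / 2)) ^+ n.+1 by exact: exprn_gt0.
    by lra.
  have h5 : phi t1 / c1 < e' / 2.
    have p0 := phi0 t1.
    rewrite ltr_pdivrMr // mulrC -(ltr_pXn2r (ltn0Sn n)) ?nnegrE ?ltW //.
    by rewrite phiE.
  have /andP[at1 t1T'] := t1T.
  exists t1 => // t2 /andP[t12 t2T]; rewrite ltNge; apply/negP => far.
  have e'e : e' <= e by rewrite ge_min lexx.
  have e'dl : e' <= dl by rewrite ge_min lexx orbT.
  have sub t : t1 <= t <= t2 -> a < t < T.
    by move=> /andP[z1 z2]; rewrite (lt_le_trans at1 z1) (le_lt_trans z2 t2T).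
  have [t tT [tf tb]] : exists2 t, t1 < t <= t2 & e' <= nrm (s t - p) /\
      forall z, t1 <= z < t -> nrm (s z - p) < e'.
    apply: (@first_exit _ (fun t => nrm (s t - p))).
    - move=> t /sub tT.
      have [/derivable1_diffP ds _] := mg_ds H tT.
      have cs := differentiable_continuous ds.
      have cB : {for t, continuous (fun t => s t - p)}.
        exact: (@continuousB _ _ _ s (cst p) t cs (@cst_continuous _ _ _ _)).
      exact: (@cvg_comp _ _ _ _ (mass_norm m) _ _ _ cB (@mass_norm_continuous _ _ _ hm _)).
    - exact: ltW.
    - by lra.
    - exact: le_trans far.
  have /andP[t1t tt2] := tT.
  have := len t1 t at1 (ltW t1t) (le_lt_trans tt2 t2T).
  have Hin z : t1 < z < t -> nrm (s z - p) < dl.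
    by move=> /andP[z1 z2]; rewrite (lt_le_trans _ e'dl) // tb // (ltW z1).
  move=> /(_ Hin) h6.
  have h7 := mass_normD hm (s t - s t1) (s t1 - p).
  by rewrite addrA subrK in h7; lra.
move=> B /(near_mass_norm hm)[e e_gt0 He].
have [t1 t1T Ht] := main e e_gt0.
exists (T - t1); first by rewrite /= subr_gt0.
move=> t /= h1 h2; apply: He; apply: Ht; rewrite h2 andbT.
by move: h1; rewrite ger0_norm ?subr_ge0 ?(ltW h2) // ltrD2l ltrN2.
Qed.

End Convergence.

(** * Lyapunov-Schmidt reduction *)

Section ReductionArithmetic.
Context {R : realFieldType}.
Implicit Types a b c k lam w h x y : R.

Lemma norm_dist3_le a b c x y h :
  `|x| <= a -> `|y| <= c -> `|x - y - h| <= b -> h <= a + c + b.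
Proof. by rewrite !ler_norml => /andP[? ?] /andP[? ?] /andP[? ?]; lra. Qed.

(** The arithmetic of the reduction: [w] and [h] are the norms of the transverse
  component and of its image by the Hessian, [k] stands for [kappa ^ n] and [b] for the
  relative error of the Taylor formula. *)
Lemma reduction_transverse a b C k lam w h : 0 < lam -> b <= lam / 2 -> 0 <= w ->
  lam * w <= h -> h <= a + C * k + b * w -> w <= 2 / lam * (a + C * k).
Proof.
move=> lam0 bl w0 h1 h2; rewrite mulrAC ler_pdivlMr // mulrC.
by have := ler_wpM2r w0 bl; lra.
Qed.

Lemma reduction_kernel a b c C k lam w : 0 < lam -> 0 < c -> 0 <= b -> b <= lam / 2 ->
  b * C <= lam * c / 4 -> 0 <= a -> 0 <= k -> w <= 2 / lam * (a + C * k) ->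
  c * k <= a + b * w -> k <= 4 / c * a.
Proof.
move=> lam0 c0 b0 bl bC a0 k0 h1 h2.
have v1 : b * w <= b * (2 / lam) * a + b * C * (2 / lam) * k.
  by apply: (le_trans (ler_wpM2l b0 h1)); rewrite le_eqVlt; apply/orP; left; apply/eqP; ring.
have v2 : b * (2 / lam) * a <= a.
  rewrite -[leRHS]mul1r ler_wpM2r // mulrA ler_pdivrMr // mul1r; lra.
have v3 : b * C * (2 / lam) * k <= c / 2 * k.
  by rewrite ler_wpM2r // mulrA ler_pdivrMr //; lra.
by rewrite mulrAC ler_pdivlMr // mulrC; lra.
Qed.

End ReductionArithmetic.

Section Reduction.
Context {R : realType} {N : nat} {m : 'I_N -> R}.
Hypothesis hm : forall k, 0 < m k.
Hypothesis hN : (2 <= N)%N.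
Local Notation dotm := (mass_dot m).
Local Notation nrm := (mass_norm m).
Local Notation O := (@noncoll R N).
Local Notation f := (scaled_potential m).
Let oO : open O := @noncoll_open R N.
Let sf := smooth_scaled_potential hm hN.

Context (p : config R N).
Hypothesis Op : O p.
Hypothesis cp : p \in centered m.
Hypothesis np : nrm p = 1.

Lemma diter_mass_bound n : exists B d : R, [/\ 0 < B, 0 < d & forall x, nrm (x - p) < d ->
  O x /\ forall vs : seq (config R N), size vs = n ->
    `|diter vs f x| <= B * \prod_(v <- vs) nrm v].
Proof.
have [B B0 HB] := diter_locally_bounded oO n sf Op.
have [C C0 HC] := mass_norm_equiv hm.
have NO : \forall x \near p, O x by exact: open_nbhs_nbhs.
have [d d0 Hd] := (near_mass_norm hm _ _).1 (filterI NO HB).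
have Cn : 0 < C ^+ n by exact: exprn_gt0.
exists ((B + 1) * C ^+ n), d; split => //; first by rewrite mulr_gt0 // ltr_wpDl.
move=> x /Hd [Ox Hx]; split => // vs svs; apply: (le_trans (Hx vs svs)).
apply: (@le_trans _ _ (B * (C ^+ n * \prod_(v <- vs) nrm v))); last first.
  rewrite mulrA ler_wpM2r ?prodr_ge0 // => [v _|]; first exact: mass_norm_ge0.
  by rewrite ler_pM2r // lerDl.
rewrite ler_wpM2l // -svs; elim: vs {svs} => [|v vs IH]; first by rewrite !big_nil expr0 mul1r.
rewrite !big_cons /= exprS mulrACA; apply: ler_pM => //.
  by apply: prodr_ge0 => *.
exact: (HC v).2.
Qed.

Let seg x z (s : R) (d : R) : nrm (x - p) < d -> nrm (x + z - p) < d -> 0 <= s <= 1 ->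
  nrm (x + s *: z - p) < d.
Proof.
move=> h1 h2 /andP[s0 s1].
have -> : x + s *: z - p = (1 - s) *: (x - p) + s *: (x + z - p).
  by apply/matrixP => k i; rewrite !mxE; ring.
apply: (le_lt_trans (mass_normD hm _ _)); rewrite !mass_normZ.
have s1' : 0 <= 1 - s by lra.
rewrite !ger0_norm //.
pose M := Num.max (nrm (x - p)) (nrm (x + z - p)).
have Md : M < d by rewrite gt_max h1.
have h3 : nrm (x - p) <= M by rewrite le_max lexx.
have h4 : nrm (x + z - p) <= M by rewrite le_max lexx orbT.
have := ler_wpM2l s1' h3; have := ler_wpM2l s0 h4; lra.
Qed.

Lemma taylor_pd : exists B d : R, [/\ 0 < B, 0 < d & forall e x z u, e <= d ->
  nrm (x - p) < e -> nrm (x + z - p) < e ->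
  `|pd u f (x + z) - pd u f x - pd z (pd u f) p| <= B * e * nrm z * nrm u].
Proof.
have [B [d [B0 d0 HB]]] := diter_mass_bound 3.
exists B, d; split => // e x z u ed h1 h2.
have inO y : nrm (y - p) < e -> O y by move=> h; apply: (HB y (lt_le_trans h ed)).1.
have [s s01 ->] : exists2 s : R, 0 <= s <= 1 & pd u f (x + z) - pd u f x = pd z (pd u f) (x + s *: z).
  by apply: (smooth_MVT oO (smooth_pd oO u sf)) => s s01; apply: inO; exact: seg.
set y := x + s *: z; have hy : nrm (y - p) < e by exact: seg.
have e0 : 0 < e by apply: le_lt_trans h1; exact: mass_norm_ge0.
have hp : nrm (p - p) < e by rewrite subrr mass_norm0.
have hy' : nrm (p + (y - p) - p) < e by rewrite (addrC p (y - p)) subrK.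
have [t t01 E] : exists2 t : R, 0 <= t <= 1 &
    pd z (pd u f) (p + (y - p)) - pd z (pd u f) p = pd (y - p) (pd z (pd u f)) (p + t *: (y - p)).
  apply: (smooth_MVT oO (smooth_pd oO z (smooth_pd oO u sf))) => t t01.
  by apply: inO; exact: seg.
rewrite (addrC p (y - p)) subrK in E; rewrite E.
have hq : nrm (p + t *: (y - p) - p) < d by apply: (lt_le_trans _ ed); exact: seg.
have := (HB _ hq).2 [:: y - p; z; u] erefl.
rewrite /= !big_cons big_nil mulr1 => /le_trans; apply.
rewrite -!mulrA ler_pM2l //; apply: ler_pM => //; rewrite ?mass_norm_ge0 ?mulr_ge0 ?mass_norm_ge0 //.
exact: ltW.
Qed.

Lemma taylor_pot : exists B d : R, [/\ 0 < B, 0 < d & forall x z,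
  nrm (x - p) < d -> nrm (x + z - p) < d ->
  `|f (x + z) - f x - pd z f x| <= B * nrm z ^+ 2].
Proof.
have [B [d [B0 d0 HB]]] := diter_mass_bound 2.
exists B, d; split => // x z h1 h2.
have inO y : nrm (y - p) < d -> O y by move=> h; apply: (HB y h).1.
have [s s01 ->] : exists2 s : R, 0 <= s <= 1 & f (x + z) - f x = pd z f (x + s *: z).
  by apply: (smooth_MVT oO sf) => s s01; apply: inO; exact: seg.
have h3 : nrm (x + s *: z - p) < d by exact: seg.
have [t t01 ->] : exists2 t : R, 0 <= t <= 1 & pd z f (x + s *: z) - pd z f x =
    pd (s *: z) (pd z f) (x + t *: (s *: z)).
  by apply: (smooth_MVT oO (smooth_pd oO z sf)) => t t01; apply: inO; exact: seg.
have h4 : nrm (x + t *: (s *: z) - p) < d by exact: seg.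
have := (HB _ h4).2 [:: s *: z; z] erefl.
rewrite /= !big_cons big_nil mulr1 => /le_trans; apply.
case/andP: s01 => s0 s1.
rewrite ler_pM2l // mass_normZ (ger0_norm s0) -mulrA -expr2.
by rewrite -[leRHS]mul1r ler_wpM2r // sqr_ge0.
Qed.

(** A complement, among centered configurations, of the plane of the similarities of
  [p], along which [f] is constant. *)
Definition slice (z : config R N) : Prop :=
  [/\ z \in centered m, dotm z p = 0 & dotm z (rot p) = 0].

(** Here [a] bounds the norm of the restriction to the slice of the differential. *)
Definition slice_lojasiewicz : Prop := exists n : nat, exists C d : R,
  [/\ (0 < n)%N, 0 < C, 0 < d & forall z a, slice z -> nrm z < d -> 0 <= a ->
    (forall u, slice u -> `|pd u f (p + z)| <= a * nrm u) ->
    `|f (p + z) - f p| ^+ n <= C * a ^+ n.+1].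

(** Acts on all configurations; on centered ones it is the operator of the second
  differential. *)
Definition hess (u : config R N) : config R N := grad (m := m) (pd u f) p.

Lemma hessE u v : dotm (hess u) v = pd v (pd u f) p.
Proof. exact: gradE. Qed.

Lemma hess_sym u v : dotm (hess u) v = dotm u (hess v).
Proof. by rewrite [RHS]mass_dotC !hessE (smooth_pdC oO). Qed.

(** A slice point is written [y + w], where the Hessian is bounded below on [w], while
  the differential at [p + y] is of the order of [kappa ^ n] and is detected by a kernel
  vector [e]. Testing the differential at [p + y + w] on [hess w] bounds [w] by [a +
  kappa ^ n]; testing it on [e], where the Hessian vanishes, bounds [kappa ^ n] by [a]
  because the Taylor error is small. Thus [w] and [kappa ^ n] are [O (a)], the increment
  of [f] is [O (kappa ^ n.+1 + a ^ 2)], and its [n]-th power is [O (a ^ n.+1)]. *)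
Lemma lyapunov_schmidt (n : nat) (lam C c d : R) : (0 < n)%N -> 0 < lam -> 0 < C ->
  0 < c -> 0 < d ->
  (forall z, slice z -> nrm z < d -> exists y w kappa, [/\ z = y + w, slice y &
    [/\ slice (hess w), lam * nrm w <= nrm (hess w), nrm y <= C * nrm z &
    [/\ 0 <= kappa, forall u, slice u -> `|pd u f (p + y)| <= C * kappa ^+ n * nrm u,
       slice w,
       exists e, [/\ slice e, hess e = 0, nrm e <= 1 & c * kappa ^+ n <= `|pd e f (p + y)|] &
       `|f (p + y) - f p| <= C * kappa ^+ n.+1]]]) ->
  slice_lojasiewicz.
Proof.
move=> n0 lam0 C0 c0 d0 Hdec.
have [B1 [d1 [B10 d10 HB1]]] := taylor_pd.
have [B2 [d2 [B20 d20 HB2]]] := taylor_pot.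
have cont := smooth_continuous oO sf Op.
move/cvgrPdist_lt : cont => /(_ _ ltr01)/(near_mass_norm hm)[d3 d30 Hd3].
(* makes the Taylor error small against both the coercivity constant and the lower bound
  [c] detected by kernel vectors *)
pose e1 := Num.min d1 (Num.min (lam / (2 * B1)) (lam * c / (4 * B1 * C))).
have e10 : 0 < e1.
  by rewrite !lt_min d10 !divr_gt0 ?mulr_gt0.
have e1d1 : e1 <= d1 by rewrite ge_min lexx.
have e1a : B1 * e1 <= lam / 2.
  have : e1 <= lam / (2 * B1) by rewrite !ge_min lexx !orbT.
  by rewrite ler_pdivlMr ?mulr_gt0 //; lra.
have e1b : B1 * e1 * C <= lam * c / 4.
  have : e1 <= lam * c / (4 * B1 * C) by rewrite !ge_min lexx !orbT.
  rewrite ler_pdivlMr ?mulr_gt0 //; lra.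
pose C1 := C + 1.
have C10 : 0 < C1 by rewrite addr_gt0.
pose D := Num.min d (Num.min d3 (Num.min (e1 / C1) (d2 / C1))).
have D0 : 0 < D by rewrite !lt_min d0 d30 !divr_gt0.
pose K1 := 4 / c. pose K2 := 2 / lam * (1 + C * K1).
pose K3 := C * K1 * K2 + B2 * K2 ^+ 2.
have K10 : 0 < K1 by rewrite divr_gt0.
have K20 : 0 < K2.
  by apply: mulr_gt0; [exact: divr_gt0|apply: addr_gt0 => //; exact: mulr_gt0].
have K30 : 0 < K3.
  by apply: addr_gt0; apply: mulr_gt0 => //; [exact: mulr_gt0|exact: exprn_gt0].
pose K := 1 + 2 ^+ n * (C ^+ n * K1 ^+ n.+1 + K3 ^+ n).
have K4 : 0 < 2 ^+ n * (C ^+ n * K1 ^+ n.+1 + K3 ^+ n).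
  apply: mulr_gt0; first exact: exprn_gt0.
  by apply: addr_gt0; [apply: mulr_gt0; exact: exprn_gt0|exact: exprn_gt0].
exists n, K, D; split => //; first by rewrite addr_gt0.
move=> z a Sz; rewrite !lt_min => /and4P[zd zd3 ze1 zd2] a0 Ha.
have zp : p + z - p = z by rewrite addrC addKr.
have f1 : `|f (p + z) - f p| < 1.
  by rewrite distrC; apply: Hd3; rewrite zp.
have K1' : 1 <= K by rewrite lerDl ltW.
have [a1|a1] := ltP 1 a.
  apply: (@le_trans _ _ 1); first by rewrite exprn_ile1 // ltW.
  by rewrite -[leLHS]mulr1 ler_pM // exprn_ege1 // ltW.
have [y [w [kap [Ez Sy [Shw lw ny [k0 H1 Sw [e [Se he ne H2]] H3]]]]]] := Hdec z Sz zd.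
have n1 : nrm (p + y - p) <= C * nrm z by rewrite addrC addKr.
have C1z r : nrm z < r / C1 -> C * nrm z < r.
  rewrite ltr_pdivlMr // => h; apply: le_lt_trans h.
  by rewrite mulrC ler_wpM2l ?mass_norm_ge0 // lerDl.
have C1z' r : nrm z < r / C1 -> nrm z < r.
  rewrite ltr_pdivlMr // => h; apply: le_lt_trans h.
  by rewrite -[leLHS]mulr1 ler_wpM2l ?mass_norm_ge0 // lerDr ltW.
have Ezp : p + y + w = p + z by rewrite Ez addrA.
have T1 u : `|pd u f (p + z) - pd u f (p + y) - dotm (hess w) u| <= B1 * e1 * nrm w * nrm u.
  rewrite hess_sym mass_dotC hessE -Ezp; apply: HB1 => //.
    by apply: (le_lt_trans n1); exact: C1z.
  by rewrite Ezp zp; exact: C1z'.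
have T2 : `|f (p + z) - f (p + y) - pd w f (p + y)| <= B2 * nrm w ^+ 2.
  rewrite -Ezp; apply: HB2.
    by apply: (le_lt_trans n1); exact: C1z.
  by rewrite Ezp zp; exact: C1z'.
have w0 := mass_norm_ge0 (m := m) w.
have kn : 0 <= kap ^+ n by exact: exprn_ge0.
have hw : nrm (hess w) <= a + C * kap ^+ n + B1 * e1 * nrm w.
  have [->|h0] := eqVneq (nrm (hess w)) 0.
    by rewrite !addr_ge0 ?mulr_ge0 // ltW.
  have hp : 0 < nrm (hess w) by rewrite lt_neqAle eq_sym h0 mass_norm_ge0.
  rewrite -(ler_pM2r hp) -expr2 mass_norm2 //.
  have -> : (a + C * kap ^+ n + B1 * e1 * nrm w) * nrm (hess w) = a * nrm (hess w) +
      C * kap ^+ n * nrm (hess w) + B1 * e1 * nrm w * nrm (hess w) by ring.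
  exact: norm_dist3_le (Ha _ Shw) (H1 _ Shw) (T1 (hess w)).
have w1 : nrm w <= 2 / lam * (a + C * kap ^+ n).
  exact: reduction_transverse lam0 e1a w0 lw hw.
have k1 : kap ^+ n <= K1 * a.
  have be0 : 0 <= B1 * e1 by rewrite mulr_ge0 // ltW.
  apply: (reduction_kernel lam0 c0 be0 e1a e1b a0 kn w1).
  (* the Hessian term of the Taylor estimate vanishes on kernel vectors *)
  have := T1 e; rewrite hess_sym he mass_dot0r subr0 distrC => T1e.
  have := ler_normD (pd e f (p + y) - pd e f (p + z)) (pd e f (p + z)).
  rewrite subrK => u5; apply: (le_trans H2); apply: (le_trans u5).
  rewrite addrC; apply: lerD.
    by apply: (le_trans (Ha _ Se)); rewrite -[leRHS]mulr1 ler_wpM2l.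
  apply: (le_trans T1e); rewrite -[leRHS]mulr1 ler_wpM2l //.
  by rewrite mulr_ge0.
have w2 : nrm w <= K2 * a.
  apply: (le_trans w1).
  have -> : K2 * a = 2 / lam * (a + C * (K1 * a)) by rewrite /K2; ring.
  have l0 : 0 <= 2 / lam by rewrite divr_ge0 // ltW.
  by apply: ler_wpM2l => //; rewrite lerD2l ler_pM2l.
have F1 : `|f (p + z) - f p| <= C * kap ^+ n.+1 + K3 * a ^+ 2.
  have u1 := H1 _ Sw.
  have u2 : C * kap ^+ n * nrm w <= C * K1 * K2 * a ^+ 2.
    have -> : C * K1 * K2 * a ^+ 2 = C * (K1 * a) * (K2 * a) by ring.
    apply: ler_pM => //; first by rewrite mulr_ge0 // ltW.
    by apply: ler_wpM2l => //; exact: ltW.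
  have u3 : B2 * nrm w ^+ 2 <= B2 * K2 ^+ 2 * a ^+ 2.
    rewrite -mulrA ler_pM2l // -exprMn; apply: lerXn2r; rewrite ?nnegrE //.
    by rewrite mulr_ge0 // ltW.
  have E : f (p + z) - f p = (f (p + z) - f (p + y) - pd w f (p + y)) + pd w f (p + y) +
     (f (p + y) - f p) by ring.
  have := ler_normD ((f (p + z) - f (p + y) - pd w f (p + y)) + pd w f (p + y)) (f (p + y) - f p).
  have := ler_normD (f (p + z) - f (p + y) - pd w f (p + y)) (pd w f (p + y)).
  by rewrite -E /K3 mulrDl; lra.
have Cn : 0 <= C * kap ^+ n.+1 by rewrite mulr_ge0 ?(ltW C0) // exprn_ge0.
have Ka : 0 <= K3 * a ^+ 2 by rewrite mulr_ge0 ?(ltW K30) // exprn_ge0.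
apply: (@le_trans _ _ ((C * kap ^+ n.+1 + K3 * a ^+ 2) ^+ n)).
  by apply: lerXn2r; rewrite ?nnegrE // addr_ge0.
apply: (le_trans (exprn_add_le n Cn Ka)).
have an : 0 <= a ^+ n.+1 by exact: exprn_ge0.
apply: (@le_trans _ _ (2 ^+ n * (C ^+ n * K1 ^+ n.+1 + K3 ^+ n) * a ^+ n.+1)); last first.
  by rewrite ler_wpM2r // /K lerDr.
set an1 := a ^+ n.+1; have -> : 2 ^+ n * (C ^+ n * K1 ^+ n.+1 + K3 ^+ n) * an1 =
  2 ^+ n * (C ^+ n * (K1 ^+ n.+1 * an1) + K3 ^+ n * an1) by ring.
rewrite ler_pM2l ?exprn_gt0 // {}/an1; apply: lerD.
  rewrite exprMn ler_pM2l ?exprn_gt0 // -exprM mulnC exprM -exprMn.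
  by apply: lerXn2r; rewrite ?nnegrE // mulr_ge0 // ltW.
rewrite exprMn ler_pM2l ?exprn_gt0 //.
have -> : (a ^+ 2) ^+ n = a ^+ n.-1 * a ^+ n.+1.
  by rewrite -exprM -exprD mul2n -addnn addnS -addSn prednK.
by rewrite -[leRHS]mul1r ler_wpM2r // exprn_ile1.
Qed.

End Reduction.

(** * From the slice to the unit sphere *)

Section Slice.
Context {R : realType} {N : nat} {m : 'I_N -> R}.
Hypothesis hm : forall k, 0 < m k.
Hypothesis hN : (2 <= N)%N.
Local Notation dotm := (mass_dot m).
Local Notation nrm := (mass_norm m).
Local Notation O := (@noncoll R N).
Local Notation f := (scaled_potential m).
Local Notation G := (grad (m := m) (scaled_potential m)).
Let oO : open O := @noncoll_open R N.
Let sf := smooth_scaled_potential hm hN.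

Context (p : config R N).
Hypothesis Op : O p.
Hypothesis cp : p \in centered m.
Hypothesis np : nrm p = 1.
Hypothesis crit : forall u, pd u f p = 0.
Local Notation slice := (slice (m := m) p).
Local Notation hess := (hess (m := m) p).

Let pp : dotm p p = 1. Proof. by rewrite -mass_norm2 // np expr1n. Qed.

Lemma mass_norm_rot x : nrm (rot x) = nrm x.
Proof. by rewrite /mass_norm rot_dot. Qed.

Lemma centered_simil a b x : x \in centered m -> simil a b x \in centered m.
Proof. by move=> cx; rewrite memvD ?memvZ ?(centered_rot hN). Qed.

(** A shape close to [p] is moved into [p + slice] by the similarity that makes its
  components along [p] and [rot p] equal to [1] and [0]. This similarity is close to the
  identity and preserves [f]. *)
Lemma slice_to_lojasiewicz : slice_lojasiewicz (m := m) p -> lojasiewicz_at (m := m) p.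
Proof.
move=> [n [C [d [n0 C0 d0 H]]]].
exists n, (C * 2 ^+ n.+1), (Num.min 4^-1 (d / 6)); split => //.
- by rewrite mulr_gt0 // exprn_gt0.
- by rewrite lt_min; apply/andP; split; [rewrite invr_gt0|exact: divr_gt0].
move=> x Ox cx nx; rewrite lt_min => /andP[e4 ed].
set e := nrm (x - p) in e4 ed.
have e0 : 0 <= e by exact: mass_norm_ge0.
pose al := dotm x p; pose be := dotm x (rot p).
have al1 : `|al - 1| <= e.
  by have := mass_CS hm (x - p) p; rewrite mass_dotBl pp np mulr1 -/al -/e.
have be1 : `|be| <= e.
  have := mass_CS hm (x - p) (rot p).
  by rewrite mass_dotBl dot_rot_self subr0 mass_norm_rot np mulr1 -/be -/e.
have [al2 al3] : 3 / 4 <= al /\ al <= 5 / 4.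
  by move: al1; rewrite ler_norml => /andP[]; lra.
have [be2 be3] : - e <= be /\ be <= e by move: be1; rewrite ler_norml => /andP[].
pose D := al ^+ 2 + be ^+ 2.
have D1 : 9 / 16 <= D by have := sqr_ge0 be; rewrite /D; nra.
have D2 : D <= 4 by rewrite /D; nra.
have D0 : 0 < D by lra.
(* [a + b i] is the inverse of [al + be i] *)
pose a := al / D; pose b := - be / D.
have ab : 0 < a ^+ 2 + b ^+ 2.
  have -> : a ^+ 2 + b ^+ 2 = D^-1 by rewrite /a /b /D; field; rewrite gt_eqF.
  by rewrite invr_gt0.
pose x' := simil a b x; pose z := x' - p.
have x'E : x' = p + z by rewrite /z addrC subrK.
have E1 : a * al - b * be = 1 by rewrite /a /b /D; field; rewrite gt_eqF.
have E2 : a * be + b * al = 0 by rewrite /a /b /D; field; rewrite gt_eqF.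
have sz : slice z.
  split.
  - by rewrite memvB // centered_simil.
  - by rewrite mass_dotBl pp /x' /simil !mdE rot_dotl -/al -/be mulrN E1 subrr.
  - by rewrite mass_dotBl dot_rot_self subr0 /x' /simil !mdE rot_dot -/al -/be E2.
have nz : nrm z < d.
  have a1 : `|a - 1| <= 3 * e.
    have -> : a - 1 = (al * (1 - al) - be ^+ 2) / D by rewrite /a /D; field; rewrite gt_eqF.
    rewrite normrM normfV (gtr0_norm D0) ler_pdivrMr //.
    apply: (@le_trans _ _ (27 / 16 * e)); last by nra.
    apply: (le_trans (ler_normB _ _)); rewrite normrM (distrC 1 al) (ger0_norm (sqr_ge0 be)).
    have al0 : 0 <= al by lra.
    rewrite (ger0_norm al0).
    have : be ^+ 2 <= e ^+ 2 by rewrite -(real_normK (num_real be)); apply: lerXn2r; rewrite ?nnegrE.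
    by have := normr_ge0 (al - 1); nra.
  have b1 : `|b| <= 2 * e.
    rewrite /b normrM normrN normfV (gtr0_norm D0) ler_pdivrMr //; nra.
  have -> : z = (a - 1) *: x + b *: rot x + (x - p).
    by rewrite /z /x' /simil; apply/matrixP => k i; rewrite !mxE; ring.
  apply: (le_lt_trans (mass_normD hm _ _)); rewrite -/e.
  have := mass_normD hm ((a - 1) *: x) (b *: rot x).
  rewrite !mass_normZ mass_norm_rot nx !mulr1 => h1.
  by rewrite ltr_pdivlMr // in ed; lra.
have fx : f (p + z) = f x by rewrite -x'E scaled_potential_simil.
rewrite -fx.
have -> : C * 2 ^+ n.+1 * nrm (G x) ^+ n.+1 = C * (2 * nrm (G x)) ^+ n.+1.
  by rewrite exprMn mulrA.
apply: (H z) => //; first by rewrite mulr_ge0 // mass_norm_ge0.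
move=> u _; rewrite -x'E /x'.
have Eu : u = simil a b (simil al be u) by rewrite similM E1 E2 simil1.
rewrite {1}Eu pd_scaled_potential_simil // -(gradE hm) (le_trans (mass_CS hm _ _)) //.
rewrite mass_norm_simil mulrA; apply: ler_wpM2r; first exact: mass_norm_ge0.
rewrite mulrC; apply: ler_wpM2r; first exact: mass_norm_ge0.
have -> : 2 = Num.sqrt (2 ^+ 2) :> R by rewrite sqrtr_sqr ger0_norm.
by rewrite ler_wsqrtr // -/D; lra.
Qed.

Lemma crit_simil a b v : 0 < a ^+ 2 + b ^+ 2 -> pd v f (simil a b p) = 0.
Proof.
move=> ab; set D := a ^+ 2 + b ^+ 2 in ab.
have Ev : v = simil a b (simil (a / D) (- b / D) v).
  have e1 : a * (a / D) - b * (- b / D) = 1 by rewrite /D; field; rewrite gt_eqF.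
  have e2 : a * (- b / D) + b * (a / D) = 0 by rewrite /D; field; rewrite gt_eqF.
  by rewrite similM e1 e2 simil1.
by rewrite Ev pd_scaled_potential_simil.
Qed.

(** Criticality persists along the similarities of [p], so its derivative along them
  vanishes. *)
Lemma hess_self : hess p = 0.
Proof.
apply/eqP; rewrite -(mass_dot_eq0 hm); apply/eqP; set v := hess p; rewrite {1}/v hessE //.
rewrite (smooth_pdC oO) //.
apply: (pd_line_eq (h := cst 0) (smooth_pd oO v sf) Op _ (is_derive_cst _ _ _)).
near=> t; have -> : p + t *: p = simil (1 + t) 0 p.
  by rewrite /simil scale0r addr0 scalerDl scale1r.
rewrite crit_simil //.
have : -1 < t by near: t; apply: lt_nbhsr; rewrite oppr_lt0.
by nra.
Unshelve. all: by end_near. Qed.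

Lemma hess_rot : hess (rot p) = 0.
Proof.
apply/eqP; rewrite -(mass_dot_eq0 hm); apply/eqP; set v := hess (rot p); rewrite {1}/v hessE //.
rewrite (smooth_pdC oO) //.
apply: (pd_line_eq (h := cst 0) (smooth_pd oO v sf) Op _ (is_derive_cst _ _ _)).
near=> t; have -> : p + t *: rot p = simil 1 t p by rewrite /simil scale1r.
by rewrite crit_simil // expr1n ltr_wpDr // sqr_ge0.
Unshelve. all: by end_near. Qed.

Lemma hess_centered w : w \in centered m -> hess w \in centered m.
Proof.
move=> cw; apply/(centeredP hN) => v tv; rewrite hessE // (smooth_pdC oO) //.
apply: (pd_line_eq (h := cst 0) (smooth_pd oO v sf) Op _ (is_derive_cst _ _ _)).
have NO : \forall x \near p, O x by exact: open_nbhs_nbhs.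
have [e e0 He] := (near_mass_norm hm _ _).1 NO.
have n1 : 0 < nrm w + 1 by rewrite ltr_wpDl ?mass_norm_ge0.
near=> t; rewrite (pd_scaled_potential_translation hm hN) //; last by rewrite memvD ?memvZ.
apply: He; rewrite addrC addKr mass_normZ.
have : `|t| < e / (nrm w + 1).
  near: t; apply/nbhs_ballP; exists (e / (nrm w + 1)) => /=; first exact: divr_gt0.
  by move=> t; rewrite -ball_normE /= sub0r normrN.
rewrite ltr_pdivlMr //; apply: le_lt_trans.
by rewrite ler_wpM2l // lerDl.
Unshelve. all: by end_near. Qed.

Lemma hess_slice w : w \in centered m -> slice (hess w).
Proof.
move=> cw; split; first exact: hess_centered.
- by rewrite hess_sym // hess_self mass_dot0r.
- by rewrite hess_sym // hess_rot mass_dot0r.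
Qed.

End Slice.

(** * Nondegenerate central configurations *)

Section Kernel.
Context {R : realType} {N : nat} {m : 'I_N -> R}.
Hypothesis hm : forall k, 0 < m k.
Hypothesis hN : (2 <= N)%N.
Local Notation dotm := (mass_dot m).
Local Notation nrm := (mass_norm m).
Local Notation O := (@noncoll R N).
Local Notation f := (scaled_potential m).
Let oO : open O := @noncoll_open R N.
Let sf := smooth_scaled_potential hm hN.

Context (p : config R N).
Hypothesis Op : O p.
Hypothesis cp : p \in centered m.
Hypothesis np : nrm p = 1.
Hypothesis crit : forall u, pd u f p = 0.
Local Notation slice := (slice (m := m) p).
Local Notation hess := (hess (m := m) p).

Lemma hess_bounded : exists2 B : R, 0 < B & forall w, nrm (hess w) <= B * nrm w.
Proof.
have [B [d [B0 d0 HB]]] := diter_mass_bound hm hN Op 2.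
exists B => // w; have [h0|h0] := eqVneq (nrm (hess w)) 0.
  by rewrite h0 mulr_ge0 ?mass_norm_ge0 // ltW.
have hp : 0 < nrm (hess w) by rewrite lt_neqAle eq_sym h0 mass_norm_ge0.
rewrite -(ler_pM2r hp) -expr2 mass_norm2 // hessE // (le_trans (ler_norm _)) //.
have pd0 : nrm (p - p) < d by rewrite subrr (mass_norm0 hm).
have := (HB p pd0).2 [:: hess w; w] erefl.
by rewrite !big_cons big_nil mulr1 /= mulrCA mulrC.
Qed.

Lemma hessB u v : hess (u - v) = hess u - hess v.
Proof.
apply/eqP; rewrite -subr_eq0 -(mass_dot_eq0 hm); apply/eqP.
set x := _ - _ in |- *; rewrite {1}/x !mdE !hess_sym // !mdE; ring.
Qed.

Lemma hessZ a u : hess (a *: u) = a *: hess u.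
Proof.
apply/eqP; rewrite -subr_eq0 -(mass_dot_eq0 hm); apply/eqP.
set x := _ - _ in |- *; rewrite {1}/x !mdE !hess_sym // !mdE; ring.
Qed.

(** The bound is the minimum of [nrm (hess w)] on a compact unit sphere. *)
Lemma hess_coercive (ks : seq (config R N)) :
  (forall w, slice w -> (forall k, k \in ks -> dotm w k = 0) -> hess w = 0 -> w = 0) ->
  exists2 lam : R, 0 < lam & forall w, slice w -> (forall k, k \in ks -> dotm w k = 0) ->
    lam * nrm w <= nrm (hess w).
Proof.
move=> inj; pose S : set (config R N) := [set w | [/\ slice w,
  forall k, k \in ks -> dotm w k = 0 & nrm w = 1]].
have [B B0 HB] := hess_bounded.
have cont : continuous (fun w => nrm (hess w)).
  move=> w A /nbhs_ballP[e /= e0 eA].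
  apply/(near_mass_norm hm); exists (e / B); first exact: divr_gt0.
  move=> y wy; apply: eA; rewrite -ball_normE /=.
  have h1 : nrm (hess y - hess w) < e.
    by rewrite -hessB (le_lt_trans (HB _)) // mulrC -ltr_pdivlMr.
  apply: le_lt_trans h1; rewrite ler_norml lerBlDr lerBrDr addrC.
  have h2 := mass_normD hm (hess y - hess w) (hess w).
  have h3 := mass_normD hm (hess w - hess y) (hess y).
  move: h2 h3; rewrite !subrK (mass_normB (hess w) (hess y)) => h2 h3.
  by apply/andP; split; lra.
have [C C0 HC] := mass_norm_equiv hm.
have cS : compact S.
  apply: (@mx_bounded_closed_compact _ _ _ _ C).
    by move=> x [_ _ nx]; have [_] := HC x; rewrite nx mulr1.
  have -> : S = \bigcap_(v in [set v | translation v \/ v \in [:: p, rot p & ks]])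
      ((mass_dot m)^~ v @^-1` [set 0]) `&` (mass_norm m @^-1` [set 1]).
    apply/seteqP; split=> [x [[cx xp xr] xk nx]|x [Hx nx]].
      split=> // v [tv|]; first exact: (elimT (centeredP hN _) cx).
      by rewrite !inE => /or3P[/eqP->|/eqP->|/xk].
    split=> //; last by move=> k kk; apply: Hx; right; rewrite !inE kk !orbT.
    split; first by apply/(centeredP hN) => v tv; apply: Hx; left.
      by apply: Hx; right; rewrite !inE eqxx.
    by apply: Hx; right; rewrite !inE eqxx orbT.
  apply: closedI.
    apply: closed_bigI => v _; apply: closed_comp; last exact: closed_eq.
    by move=> x _; exact: (mass_dot_continuousl hm).
  apply: closed_comp; last exact: closed_eq.
  by move=> x _; exact: (mass_norm_continuous hm).
have scale w : slice w -> (forall k, k \in ks -> dotm w k = 0) -> w != 0 -> S ((nrm w)^-1 *: w).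
  move=> [cw wp wr] wk w0; have n0 : 0 < nrm w by rewrite mass_norm_gt0.
  split.
  - by split; [rewrite memvZ|rewrite mass_dotZl wp mulr0|rewrite mass_dotZl wr mulr0].
  - by move=> k kk; rewrite mass_dotZl wk // mulr0.
  by rewrite mass_normZ gtr0_norm ?invr_gt0 // mulVf // gt_eqF.
have [S0|/nonemptyPn S0] := pselect (S !=set0); last first.
  exists 1 => // w sw wk; have [->|w0] := eqVneq w 0.
    by rewrite (mass_norm0 hm) // mulr0 mass_norm_ge0.
  by have := scale w sw wk w0; rewrite S0.
have [x + Hx] := compact_EVT_min S0 cS (continuous_subspaceT cont).
rewrite inE => -[sx xk nx].
have x0 : x != 0 by apply/eqP => x0; move: nx; rewrite x0 (mass_norm0 hm) => /eqP; rewrite eq_sym oner_eq0.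
have hx : 0 < nrm (hess x).
  rewrite mass_norm_gt0 //; apply/eqP => /(inj x sx xk) /eqP.
  by rewrite (negbTE x0).
exists (nrm (hess x)) => // w sw wk.
have [->|w0] := eqVneq w 0; first by rewrite (mass_norm0 hm) // mulr0 mass_norm_ge0.
have n0 : 0 < nrm w by rewrite mass_norm_gt0.
have := Hx _ (mem_set (scale w sw wk w0)).
by rewrite hessZ mass_normZ gtr0_norm ?invr_gt0 // mulrC ler_pdivlMr.
Qed.

Lemma slice0 : slice 0.
Proof. by split; rewrite ?mem0v // mass_dot0l. Qed.

Lemma hess0 : hess 0 = 0.
Proof. by rewrite -(scale0r 0) hessZ !scale0r. Qed.

(** The Hessian is coercive on the whole slice, and the reduction applies with [y = 0]
  and [kappa = 0]. *)
Lemma slice_lojasiewicz0 : (forall w, slice w -> hess w = 0 -> w = 0) ->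
  slice_lojasiewicz (m := m) p.
Proof.
move=> inj; have [|lam lam0 Hlam] := @hess_coercive [::].
  by move=> w sw _; exact: inj.
apply: (@lyapunov_schmidt _ _ _ hm hN p Op 1 lam 1 1 1) => // z sz _.
exists 0, z, 0; split; rewrite ?add0r //; first exact: slice0.
split=> //; first by apply: hess_slice => //; case: sz.
- exact: Hlam.
- by rewrite (mass_norm0 hm) mulr_ge0 ?mass_norm_ge0.
rewrite addr0 subrr normr0; split=> //.
- by move=> u _; rewrite crit normr0 expr1 mulr0 mul0r.
- exists 0; rewrite (mass_norm0 hm) hess0 expr1 mulr0; split=> //; exact: slice0.
Qed.

End Kernel.

(** * Kernels of dimension two *)

Section CubicCase.
Context {R : realType} {N : nat} {m : 'I_N -> R}.
Hypothesis hm : forall k, 0 < m k.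
Hypothesis hN : (2 <= N)%N.
Local Notation dotm := (mass_dot m).
Local Notation nrm := (mass_norm m).
Local Notation O := (@noncoll R N).
Local Notation f := (scaled_potential m).
Let oO : open O := @noncoll_open R N.
Let sf := smooth_scaled_potential hm hN.

Section Cubic.
Implicit Types x y A B C D : R.

(** Up to the factor [-27], the discriminant of the binary cubic [A x^3 + 3 B x^2 y + 3
  C x y^2 + D y^3]. *)
Definition cubic_disc A B C D : R :=
  A ^+ 2 * D ^+ 2 - 6 * A * B * C * D + 4 * A * C ^+ 3 + 4 * B ^+ 3 * D - 3 * B ^+ 2 * C ^+ 2.

(** Up to a factor, the two quadratic forms are the partial derivatives of the binary
  cubic, and [cubic_disc] is their resultant: explicit linear multipliers combine them
  into [Dl * x ^+ 3], and by exchanging the variables into [Dl * y ^+ 3]. *)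
Lemma quadratics_lower A B C D : cubic_disc A B C D != 0 ->
  exists2 k : R, 0 < k & forall x y, k * (x ^+ 2 + y ^+ 2) <=
    Num.max `|A * x ^+ 2 + 2 * B * x * y + C * y ^+ 2|
            `|B * x ^+ 2 + 2 * C * x * y + D * y ^+ 2|.
Proof.
move=> D0; set Dl := cubic_disc A B C D in D0.
have aux A' B' C' D' : cubic_disc A' B' C' D' = Dl -> exists2 K : R, 0 < K &
    forall x y, `|y| <= `|x| -> `|Dl| * x ^+ 2 <= K *
    Num.max `|A' * x ^+ 2 + 2 * B' * x * y + C' * y ^+ 2|
            `|B' * x ^+ 2 + 2 * C' * x * y + D' * y ^+ 2|.
  move=> DE; pose E := B' * D' - C' ^+ 2.
  pose al := (A' * D' - B' * C') * D' - 4 * C' * E.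
  pose be := - 2 * D' * E.
  pose ga := 4 * B' * E - C' * (A' * D' - B' * C').
  pose de := 2 * C' * E.
  exists (`|al| + `|be| + `|ga| + `|de| + 1).
    by rewrite ltr_wpDl ?addr_ge0.
  move=> x y yx.
  set q1 := A' * x ^+ 2 + _ + _; set q2 := B' * x ^+ 2 + _ + _.
  have id3 : Dl * x ^+ 3 = (al * x + be * y) * q1 + (ga * x + de * y) * q2.
    by rewrite -DE /q1 /q2 /al /be /ga /de /E /cubic_disc; ring.
  set M := Num.max _ _.
  have m1 : `|q1| <= M by rewrite le_max lexx.
  have m2 : `|q2| <= M by rewrite le_max lexx orbT.
  have M0 : 0 <= M by exact: le_trans m1.
  have [->|x0] := eqVneq x 0.
    by rewrite expr0n mulr0 mulr_ge0 // addr_ge0 // !addr_ge0.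
  have xp : 0 < `|x| by rewrite normr_gt0.
  rewrite -(ler_pM2r xp).
  have -> : `|Dl| * x ^+ 2 * `|x| = `|Dl * x ^+ 3|.
    by rewrite normrM normrX -(real_normK (num_real x)); ring.
  have b1 u v : `|u * x + v * y| <= (`|u| + `|v|) * `|x|.
    rewrite (le_trans (ler_normD _ _)) // !normrM mulrDl lerD2l.
    by rewrite ler_wpM2l.
  have h1 : `|(al * x + be * y) * q1| <= (`|al| + `|be|) * `|x| * M.
    by rewrite normrM ler_pM.
  have h2 : `|(ga * x + de * y) * q2| <= (`|ga| + `|de|) * `|x| * M.
    by rewrite normrM ler_pM.
  have h3 := ler_normD ((al * x + be * y) * q1) ((ga * x + de * y) * q2).
  have h4 : 0 <= `|x| * M by rewrite mulr_ge0.
  rewrite id3; apply: (le_trans h3).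
  have -> : (`|al| + `|be| + `|ga| + `|de| + 1) * M * `|x| =
    (`|al| + `|be|) * `|x| * M + (`|ga| + `|de|) * `|x| * M + `|x| * M by ring.
  by rewrite -[leLHS]addr0; apply: lerD => //; apply: lerD.
have [K1 K10 H1] := aux A B C D erefl.
have E2 : cubic_disc D C B A = Dl by rewrite /Dl /cubic_disc; ring.
have [K2 K20 H2] := aux D C B A E2.
have Dp : 0 < `|Dl| by rewrite normr_gt0.
have K0 : 0 < K1 + K2 by rewrite addr_gt0.
exists (`|Dl| / (2 * (K1 + K2))) => [|x y]; first by rewrite divr_gt0 // mulr_gt0.
set M := Num.max _ _.
have M0 : 0 <= M by rewrite le_max normr_ge0.
rewrite mulrAC ler_pdivrMr ?mulr_gt0 //.
have [yx|/ltW xy] := leP `|y| `|x|.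
  have h1 := H1 x y yx; rewrite -/M in h1.
  have h2 : y ^+ 2 <= x ^+ 2.
    by rewrite -(real_normK (num_real y)) -(real_normK (num_real x)); apply: lerXn2r; rewrite ?nnegrE.
  have h3 : `|Dl| * y ^+ 2 <= `|Dl| * x ^+ 2 by rewrite ler_pM2l.
  have h4 : 0 <= K2 * M by rewrite mulr_ge0 // ltW.
  by lra.
have h1 := H2 y x xy.
have ME : Num.max `|D * y ^+ 2 + 2 * C * y * x + B * x ^+ 2|
   `|C * y ^+ 2 + 2 * B * y * x + A * x ^+ 2| = M.
  have -> : D * y ^+ 2 + 2 * C * y * x + B * x ^+ 2 = B * x ^+ 2 + 2 * C * x * y + D * y ^+ 2 by ring.
  have -> : C * y ^+ 2 + 2 * B * y * x + A * x ^+ 2 = A * x ^+ 2 + 2 * B * x * y + C * y ^+ 2 by ring.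
  exact: maxC.
rewrite ME in h1.
have h2 : x ^+ 2 <= y ^+ 2.
  by rewrite -(real_normK (num_real y)) -(real_normK (num_real x)); apply: lerXn2r; rewrite ?nnegrE.
have h3 : `|Dl| * x ^+ 2 <= `|Dl| * y ^+ 2 by rewrite ler_pM2l.
have h4 : 0 <= K1 * M by rewrite mulr_ge0 // ltW.
by lra.
Qed.

End Cubic.

Context (p : config R N).
Hypothesis Op : O p.
Hypothesis cp : p \in centered m.
Hypothesis np : nrm p = 1.
Hypothesis crit : forall u, pd u f p = 0.
Local Notation slice := (slice (m := m) p).
Local Notation hess := (hess (m := m) p).

(** In a kernel direction the first-order term of the differential vanishes and the
  cubic form leads. *)
Lemma taylor_ker : exists B d : R, [/\ 0 < B, 0 < d & forall y u, hess y = 0 ->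
  nrm y < d -> `|pd u f (p + y) - pd y (pd y (pd u f)) p / 2| <= B * nrm y ^+ 3 * nrm u].
Proof.
have [B [d [B0 d0 HB]]] := diter_mass_bound hm hN Op 4.
exists B, d; split => // y u hy yd.
have inO (t : R) : 0 <= t <= 1 -> nrm (p + t *: y - p) < d.
  move=> /andP[t0 t1]; rewrite addrC addKr mass_normZ (ger0_norm t0).
  apply: le_lt_trans yd; rewrite -[leRHS]mul1r ler_wpM2r ?mass_norm_ge0 //.
have D (g : config R N -> R) (t : R) : smooth O g -> 0 <= t <= 1 ->
    is_derive t (1 : R) (fun t => g (p + t *: y)) (pd y g (p + t *: y)).
  move=> sg t01; apply: (smooth_is_derive_line oO) => //.
  by apply: (HB _ (inO t t01)).1.
have s1 := smooth_pd oO u sf; have s2 := smooth_pd oO y s1; have s3 := smooth_pd oO y s2.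
pose q := pd y (pd y (pd u f)) p.
pose phi (t : R) : R := pd u f (p + t *: y) + - (q / 2) * t ^+ 2.
pose dphi (t : R) : R := pd y (pd u f) (p + t *: y) + - (q / 2) * (2 * t).
have Dphi (t : R) : 0 <= t <= 1 -> is_derive t (1 : R) phi (dphi t).
  move=> t01; have D2 : is_derive t (1 : R) (fun t : R => t ^+ 2) (2 * t).
    have -> : (fun t : R => t ^+ 2) = (id : R -> R) * (id : R -> R).
      by apply/funext => x; rewrite expr2.
    apply: is_derive_eq (is_deriveM (is_derive_id t (1 : R)) (is_derive_id t (1 : R))) _.
    by rewrite /GRing.scale /=; ring.
  exact: (is_deriveD (D _ t s1 t01) (is_derive_mulc (- (q / 2)) D2)).
have [c /andP[c0 c1] Ec] := MVT_is_derive ltr01 Dphi.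
pose ph2 (t : R) : R := pd y (pd u f) (p + t *: y) + - q * t.
pose dph2 (t : R) : R := pd y (pd y (pd u f)) (p + t *: y) + - q * 1.
have Dph2 (t : R) : 0 <= t <= c -> is_derive t (1 : R) ph2 (dph2 t).
  move=> /andP[t0 t1]; have t01 : 0 <= t <= 1 by rewrite t0 (le_trans t1 (ltW c1)).
  exact: (is_deriveD (D _ t s2 t01) (is_derive_mulc (- q) (is_derive_id t (1 : R)))).
have [e /andP[e0 e1] Ee] := MVT_is_derive c0 Dph2.
pose dph3 (t : R) : R := pd y (pd y (pd y (pd u f))) (p + t *: y).
have e01 : e <= 1 by rewrite ltW // (lt_trans e1).
have Dph3 (t : R) : 0 <= t <= e -> is_derive t (1 : R) (fun t => pd y (pd y (pd u f)) (p + t *: y)) (dph3 t).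
  by move=> /andP[t0 t1]; apply: D => //; rewrite t0 (le_trans t1).
have [g /andP[g0 g1] Eg] := MVT_is_derive e0 Dph3.
have z1 : pd u f p = 0 by exact: crit.
have z2 : pd y (pd u f) p = 0.
  by rewrite -hessE // hess_sym // hy mass_dot0r.
have phi1 : phi 1 = pd u f (p + y) - q / 2 by rewrite /phi scale1r expr1n mulr1.
have phi0 : phi 0 = 0 by rewrite /phi scale0r addr0 z1 expr0n mulr0 addr0.
have ph20 : ph2 0 = 0 by rewrite /ph2 scale0r addr0 z2 mulr0 addr0.
rewrite phi1 phi0 !subr0 mulr1 in Ec; rewrite ph20 !subr0 in Ee.
rewrite scale0r addr0 subr0 -/q in Eg.
have -> : pd u f (p + y) - q / 2 = dph3 g * e * c.
  have dE : dphi c = ph2 c by rewrite /dphi /ph2; field.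
  by rewrite Ec dE Ee /dph2 mulr1 Eg.
have g01 : 0 <= g <= 1 by rewrite ltW //= (le_trans (ltW g1)).
have := (HB _ (inO g g01)).2 [:: y; y; y; u] erefl.
rewrite /= !big_cons big_nil mulr1 -/(dph3 g) => hB.
rewrite !normrM (gtr0_norm e0) (gtr0_norm c0).
have -> : B * nrm y ^+ 3 * nrm u = B * (nrm y * (nrm y * (nrm y * nrm u))) * 1 * 1 by ring.
by do 2 (apply: ler_pM => //; rewrite ?mulr_ge0 // ?(ltW e0) // ?(ltW c0) // ?(ltW c1) //).
Qed.

Lemma pd2_combination (g : config R N -> R) (x z : R) u v : smooth O g ->
  pd (x *: u + z *: v) (pd (x *: u + z *: v) g) p =
  x ^+ 2 * pd u (pd u g) p + 2 * x * z * pd u (pd v g) p + z ^+ 2 * pd v (pd v g) p.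
Proof.
move=> sg.
have E a : pd a (pd (x *: u + z *: v) g) p = x * pd u (pd a g) p + z * pd v (pd a g) p.
  by rewrite (smooth_pdC oO) // pdD !pdZ.
rewrite pdD !pdZ !E (smooth_pdC oO v u) //; ring.
Qed.

Let half_lower (q P k X Y : R) : k * X <= `|q| -> `|P - q / 2| <= Y -> Y <= k / 4 * X ->
  k / 4 * X <= `|P|.
Proof.
move=> h1 h2 h3; have := ler_normD P (q / 2 - P).
have -> : P + (q / 2 - P) = q / 2 by ring.
by rewrite (distrC (q / 2)) normrM (ger0_norm (_ : 0 <= 2^-1)) ?invr_ge0 //; lra.
Qed.

Lemma sliceD u v : slice u -> slice v -> slice (u + v).
Proof.
move=> [cu up ur] [cv vp vr]; split; first by rewrite memvD.
- by rewrite mass_dotDl up vp addr0.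
- by rewrite mass_dotDl ur vr addr0.
Qed.

Lemma sliceZ a u : slice u -> slice (a *: u).
Proof.
move=> [cu up ur]; split; first by rewrite memvZ.
- by rewrite mass_dotZl up mulr0.
- by rewrite mass_dotZl ur mulr0.
Qed.

Lemma hess_combination (x z : R) u v : hess u = 0 -> hess v = 0 -> hess (x *: u + z *: v) = 0.
Proof.
move=> hu hv; have -> : x *: u + z *: v = x *: u - (- z) *: v by rewrite scaleNr opprK.
by rewrite (hessB hm hN Op) !(hessZ hm hN Op) hu hv !scaler0 subr0.
Qed.

(** Along the kernel the differential at [p + y] is, up to [O (|y|^3)], the gradient of
  the cubic form at [y]. As the discriminant is not zero, it is of the order of [|y|^2],
  and the reduction applies with [n = 2] and [kappa = |y|]. *)
Lemma slice_lojasiewicz2 e5 e6 :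
  let a u v w := pd u (pd v (pd w f)) p in
  slice e5 -> slice e6 -> hess e5 = 0 -> hess e6 = 0 ->
  dotm e5 e5 = 1 -> dotm e6 e6 = 1 -> dotm e5 e6 = 0 ->
  (forall w, slice w -> hess w = 0 -> exists x z : R, w = x *: e5 + z *: e6) ->
  cubic_disc (a e5 e5 e5) (a e5 e5 e6) (a e5 e6 e6) (a e6 e6 e6) != 0 ->
  slice_lojasiewicz (m := m) p.
Proof.
move=> a s5 s6 h5 h6 n5 n6 n56 Hker disc.
have [k k0 Hk] := quadratics_lower disc.
have [B [d [B0 d0 HB]]] := taylor_ker.
have [B3 [d3 [B30 d30 HB3]]] := diter_mass_bound hm hN Op 3.
have [|lam lam0 Hlam] := @hess_coercive _ _ _ hm hN p Op [:: e5; e6].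
  move=> w sw wk hw; have [x [z E]] := Hker w sw hw.
  have := wk e5; have := wk e6; rewrite !inE !eqxx !orbT => /(_ isT) w6 /(_ isT) w5.
  move: w5 w6; rewrite E !mdE n5 n6 n56 (mass_dotC e6) n56 => w5 w6.
  have -> : x = 0 by lra.
  have -> : z = 0 by lra.
  by rewrite !scale0r addr0.
pose C := B3 + B + 1.
have C0 : 0 < C by rewrite !addr_gt0.
pose D := Num.min d3 (Num.min d (Num.min 1 (k / (4 * B)))).
have D0 : 0 < D by rewrite !lt_min d30 d0 ltr01 divr_gt0 // mulr_gt0.
have pd0 : nrm (p - p) < d3 by rewrite subrr (mass_norm0 hm).
have grad_upper y u : hess y = 0 -> nrm y < d -> nrm y <= 1 ->
    `|pd u f (p + y)| <= C * nrm y ^+ 2 * nrm u.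
  move=> hy yd y1; have T := HB y u hy yd.
  have T3 := (HB3 p pd0).2 [:: y; y; u] erefl.
  rewrite /= !big_cons big_nil mulr1 in T3.
  have h1 := ler_normD (pd u f (p + y) - pd y (pd y (pd u f)) p / 2) (pd y (pd y (pd u f)) p / 2).
  rewrite subrK in h1; apply: (le_trans h1).
  have yu : 0 <= nrm y ^+ 2 * nrm u by rewrite mulr_ge0 ?sqr_ge0 ?mass_norm_ge0.
  have h2 : B * nrm y ^+ 3 * nrm u <= B * (nrm y ^+ 2 * nrm u).
    have -> : B * nrm y ^+ 3 * nrm u = B * (nrm y ^+ 2 * nrm u) * nrm y by ring.
    by rewrite -[leRHS]mulr1 ler_wpM2l // mulr_ge0 // ltW.
  have h3 : `|pd y (pd y (pd u f)) p / 2| <= B3 * (nrm y ^+ 2 * nrm u).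
    rewrite normrM (ger0_norm (_ : 0 <= 2^-1)) ?invr_ge0 //.
    have -> : B3 * (nrm y ^+ 2 * nrm u) = B3 * (nrm y * (nrm y * nrm u)) by ring.
    by have := normr_ge0 (pd y (pd y (pd u f)) p); lra.
  have -> : C * nrm y ^+ 2 * nrm u = B3 * (nrm y ^+ 2 * nrm u) + B * (nrm y ^+ 2 * nrm u) +
     nrm y ^+ 2 * nrm u by rewrite /C; ring.
  by lra.
apply: (@lyapunov_schmidt _ _ _ hm hN p Op 2 lam C (k / 4) D) => //; first exact: divr_gt0.
move=> z sz; rewrite !lt_min => /and4P[zd3 zd z1 zk].
pose x5 := dotm z e5; pose x6 := dotm z e6.
pose y := x5 *: e5 + x6 *: e6; pose w := z - y.
have sy : slice y by apply: sliceD; exact: sliceZ.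
have hy : hess y = 0 by exact: hess_combination.
have sw : slice w by rewrite /w -scaleN1r; apply: sliceD => //; exact: sliceZ.
have w5 : dotm w e5 = 0.
  by rewrite /w /y !mdE n5 (mass_dotC e6) n56 -/x5; ring.
have w6 : dotm w e6 = 0 by rewrite /w /y !mdE n6 n56 -/x6; ring.
have ny2 : nrm y ^+ 2 = x5 ^+ 2 + x6 ^+ 2.
  by rewrite mass_norm2 // /y !mdE n5 n6 n56 (mass_dotC e6) n56; ring.
have yz : nrm y <= nrm z.
  have [->|y0] := eqVneq (nrm y) 0; first exact: mass_norm_ge0.
  have yp : 0 < nrm y by rewrite lt_neqAle eq_sym y0 mass_norm_ge0.
  rewrite -(ler_pM2l yp) -expr2 (le_trans _ (mass_dot_le hm y z)) //.
  by rewrite ny2 /y !mdE !(mass_dotC _ z) -/x5 -/x6 -!expr2.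
have yd : nrm y < d by exact: le_lt_trans zd.
have yd3 : nrm y < d3 by exact: le_lt_trans zd3.
have y1 : nrm y <= 1 by rewrite (le_trans yz) // ltW.
exists y, w, (nrm y); split => //; first by rewrite /w addrC subrK.
split; first by apply: hess_slice => //; case: sw.
- apply: Hlam => // e; rewrite !inE => /orP[/eqP->|/eqP->] //.
- by apply: (le_trans yz); rewrite -[leLHS]mul1r ler_wpM2r ?mass_norm_ge0 // /C lerDr addr_ge0 // ltW.
split; first exact: mass_norm_ge0.
- by move=> u _; exact: grad_upper.
- exact: sw.
- have T5 := HB y e5 hy yd; have T6 := HB y e6 hy yd.
  have ne e : dotm e e = 1 -> nrm e = 1 by move=> E; rewrite /mass_norm E sqrtr1.
  rewrite (ne _ n5) mulr1 in T5; rewrite (ne _ n6) mulr1 in T6.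
  rewrite pd2_combination in T5; last exact: smooth_pd.
  rewrite pd2_combination in T6; last exact: smooth_pd.
  have s5f := smooth_pd oO e5 sf; have s6f := smooth_pd oO e6 sf.
  have sw56 x : O x -> pd e6 (pd e5 f) x = pd e5 (pd e6 f) x.
    by move=> Ox; apply: (smooth_pdC oO).
  have X1 : pd e5 (pd e6 (pd e5 f)) p = a e5 e5 e6.
    exact: (pd_ext oO e5 Op (smooth_pd oO e6 s5f) sw56).
  have X2 : pd e6 (pd e6 (pd e5 f)) p = a e5 e6 e6.
    rewrite (pd_ext oO e6 Op (smooth_pd oO e6 s5f) sw56).
    by rewrite (smooth_pdC oO).
  rewrite X1 X2 in T5.
  have k1 := Hk x5 x6.
  have yk : B * nrm y ^+ 3 <= k / 4 * nrm y ^+ 2.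
    have -> : B * nrm y ^+ 3 = B * nrm y * nrm y ^+ 2 by ring.
    rewrite ler_wpM2r ?sqr_ge0 //.
    have : nrm y < k / (4 * B) by exact: le_lt_trans zk.
    by rewrite ltr_pdivlMr ?mulr_gt0 //; lra.
  move: k1 T5 T6; rewrite -ny2 -/(a e5 e5 e5) -/(a e5 e5 e6) -/(a e5 e6 e6) -/(a e6 e6 e6).
  set q5 := (X in Num.max `|X| _); set q6 := (X in Num.max _ `|X|) => k1 T5 T6.
  have [q56|/ltW q65] := leP `|q5| `|q6|.
    exists e6; split => //; first by rewrite (ne _ n6).
    apply: half_lower T6 yk; move: k1; rewrite max_r // => k1.
    by apply: le_trans k1 _; rewrite le_eqVlt; apply/orP; left; apply/eqP; congr (`|_|); rewrite /q6; ring.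
  exists e5; split => //; first by rewrite (ne _ n5).
  apply: half_lower T5 yk; move: k1; rewrite max_l // => k1.
  by apply: le_trans k1 _; rewrite le_eqVlt; apply/orP; left; apply/eqP; congr (`|_|); rewrite /q5; ring.
have inO (s : R) : 0 <= s <= 1 -> nrm (s *: y) <= nrm y.
  move=> /andP[t0 t1]; rewrite mass_normZ (ger0_norm t0).
  by rewrite -[leRHS]mul1r ler_wpM2r ?mass_norm_ge0.
have [s s01 ->] : exists2 s : R, 0 <= s <= 1 & f (p + y) - f p = pd y f (p + s *: y).
  apply: (smooth_MVT oO sf) => s s01.
  by apply: (HB3 _ _).1; rewrite addrC addKr; apply: le_lt_trans (inO _ s01) yd3.
apply: (@le_trans _ _ (C * nrm (s *: y) ^+ 2 * nrm y)).
  apply: grad_upper; first by rewrite (hessZ hm hN Op) hy scaler0.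
  - exact: le_lt_trans (inO _ s01) yd.
  - exact: le_trans (inO _ s01) y1.
have -> : C * nrm y ^+ 3 = C * nrm y ^+ 2 * nrm y by ring.
rewrite ler_wpM2r ?mass_norm_ge0 // ler_wpM2l ?(ltW C0) //.
by apply: lerXn2r; rewrite ?nnegrE ?mass_norm_ge0 ?inO.
Qed.

End CubicCase.

(** * Power series solutions of quadratic equations *)

Section Triangle.
Context {V : zmodType}.

Lemma sum_triangle (G : nat -> nat -> V) M :
  \sum_(k < M.+1) \sum_(l < k.+1) G l (k - l)%N =
  \sum_(i < M.+1) \sum_(j < M.+1 | (i + j <= M)%N) G i j.
Proof.
transitivity (\sum_(k < M.+1) \sum_(l < M.+1 | (l <= k)%N) G l (k - l)%N).
  apply: eq_bigr => k _.
  by rewrite (big_ord_widen _ (fun l => G l (k - l)%N) (ltn_ord k)).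
rewrite (exchange_big_dep predT) //=; apply: eq_bigr => l _.
have lM : (l <= M)%N by rewrite -ltnS.
transitivity (\sum_(l <= k < M.+1) G l (k - l)%N).
  rewrite -(big_mkord (fun k => (l <= k)%N) (fun k => G l (k - l)%N)).
  rewrite (@big_nat_widenl _ _ _ l 0) //.
rewrite -{1}[l : nat]add0n big_addn subSn // big_mkord.
rewrite (big_ord_widen M.+1 (fun j => G l (j + l - l)%N)) ?ltnS ?leq_subr //.
apply: eq_big => j; first by rewrite ltnS leq_subRL.
by rewrite addnK.
Qed.

End Triangle.

Section Limits.
Context {R : realType}.

(** The limit is the supremum of the lower bounds [u k - e k]. *)
Lemma tail_bound_limit (u e : R^nat) :
  (forall k M, (k <= M)%N -> `|u M - u k| <= e k) ->
  exists l : R, forall k, `|l - u k| <= e k.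
Proof.
move=> H; pose L := [set x | exists k, x = u k - e k].
have e0 k : 0 <= e k by apply: le_trans (H k k _); rewrite ?leqnn ?normr_ge0.
have ubL M : ubound L (u M + e M).
  move=> _ [k ->]; have [kM|/ltnW Mk] := leqP k M.
    by have := H _ _ kM; have := e0 M; rewrite ler_distl => h /andP[]; lra.
  by have := H _ _ Mk; have := e0 k; rewrite ler_distl => h /andP[]; lra.
have L0 : L !=set0 by exists (u 0%N - e 0%N); exists 0%N.
exists (sup L) => k; rewrite ler_distl; apply/andP; split.
  by apply: ub_le_sup; [exists (u 0%N + e 0%N); exact: ubL|exists k].
by apply: ge_sup => //; exact: ubL.
Qed.

Lemma geometric_le0 (x C th : R) : 0 <= th -> th < 1 ->
  (forall k, x <= th ^+ k * C) -> x <= 0.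
Proof.
move=> th0 th1 H; rewrite leNgt; apply/negP => x0.
have /(@cvg_geometric _ C)/cvgrPdist_lt/(_ _ x0) [k _ /(_ k (leqnn k))] : `|th| < 1 by rewrite ger0_norm.
rewrite sub0r normrN /geometric /= => h; have := H k; rewrite mulrC => h2.
by have := ler_norm (C * th ^+ k); lra.
Qed.

Lemma mx_norm_lub (a b : nat) (x : 'M[R]_(a, b)) e : 0 <= e ->
  (forall i j, `|x i j| <= e) -> `|x| <= e.
Proof.
move=> e0 H; rewrite /Num.Def.normr /= mx_normrE; by apply/bigmax_leP; split.
Qed.

End Limits.

Section PowerSeries.
Context {R : realType} {n : nat}.
Local Notation V := 'rV[R]_n.
Context (B : V -> V -> V) (b : V) (K : R).
Hypothesis Bl : forall v, linear (B^~ v).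
Hypothesis Br : forall v, linear (B v).
Hypothesis K0 : 0 < K.
Hypothesis BK : forall u v, `|B u v| <= K * `|u| * `|v|.

Let Bl_lin v : {linear V -> V} := HB.pack (B^~ v) (GRing.isLinear.Build _ _ _ _ _ (Bl v)).
Let Br_lin v : {linear V -> V} := HB.pack (B v) (GRing.isLinear.Build _ _ _ _ _ (Br v)).

Let B0l v : B 0 v = 0. Proof. exact: (linear0 (Bl_lin v)). Qed.
Let B0r v : B v 0 = 0. Proof. exact: (linear0 (Br_lin v)). Qed.
Let BBl u w v : B (u - w) v = B u v - B w v. Proof. exact: (linearB (Bl_lin v)). Qed.
Let BBr u w v : B v (u - w) = B v u - B v w. Proof. exact: (linearB (Br_lin v)). Qed.
Let Bsum (I J : Type) (r : seq I) (s : seq J) (F : I -> V) (H : J -> V) :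
  B (\sum_(i <- r) F i) (\sum_(j <- s) H j) = \sum_(i <- r) \sum_(j <- s) B (F i) (H j).
Proof.
rewrite -[LHS]/(Bl_lin _ _) linear_sum; apply: eq_bigr => i _.
exact: (linear_sum (Br_lin _)).
Qed.
Let BZ x z u v : B (x *: u) (z *: v) = (x * z) *: B u v.
Proof. by rewrite -[LHS]/(Bl_lin _ _) linearZ /= -[B u _]/(Br_lin _ _) linearZ scalerA. Qed.

(** Course-of-values recursion for the coefficients of the formal solution of [X = y b +
  B (X, X)]. The list holds the previous coefficients; the default value [0] of [nth]
  stands for the coefficient under construction, which only meets the zero constant
  term. *)
Fixpoint coef_list k : seq V := if k is k'.+1 then
  rcons (coef_list k') ((k' == 1)%:R *: b + \sum_(l < k'.+1)
     B (nth 0 (coef_list k') l) (nth 0 (coef_list k') (k' - l)%N)) else [::].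

Definition coef k := nth 0 (coef_list k.+1) k.

Let size_coef k : size (coef_list k) = k.
Proof. by elim: k => //= k IH; rewrite size_rcons IH. Qed.

Let nth_coef k l : (l < k)%N -> nth 0 (coef_list k) l = coef l.
Proof.
elim: k => // k IH; rewrite ltnS leq_eqVlt => /orP[/eqP->//|lk].
by rewrite [coef_list _]/= nth_rcons size_coef lk IH.
Qed.

Lemma coef0 : coef 0 = 0.
Proof. by rewrite /coef /= scale0r add0r big_ord1 /= B0l. Qed.

Lemma coefE k : coef k = (k == 1)%:R *: b + \sum_(l < k.+1) B (coef l) (coef (k - l)%N).
Proof.
rewrite {1}/coef [coef_list _]/= nth_rcons size_coef ltnn eqxx; congr (_ + _).
apply: eq_bigr => l _.
have [->|l0] := eqVneq (l : nat) 0%N.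
  rewrite subn0 coef0 B0l.
  case: k l => [|k] l; first by rewrite nth_nil B0l.
  by rewrite nth_coef // coef0 B0l.
have [lk|lk] := eqVneq (l : nat) k.
  by rewrite lk [nth _ _ k]nth_default ?size_coef // B0l subnn coef0 B0r.
rewrite !nth_coef //; last by rewrite ltn_neqAle lk -ltnS ltn_ord.
have lp : (0 < l)%N by rewrite lt0n.
by rewrite ltn_subrL lp (leq_trans lp) // -ltnS.
Qed.

Context (eps : R).
Hypothesis eps0 : 0 < eps.
Hypothesis small : 8 * (K * `|b|) * eps <= 1.
Let S := 2 * `|b| * eps.
Let A k := `|coef k| * eps ^+ k.

Let S0 : 0 <= S. Proof. by rewrite !mulr_ge0 // ltW. Qed.
Let KS : 4 * (K * S) <= 1. Proof. by rewrite /S; move: small; lra. Qed.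
Let A_ge0 k : 0 <= A k. Proof. by rewrite mulr_ge0 // exprn_ge0 // ltW. Qed.
Let A0 : A 0%N = 0. Proof. by rewrite /A coef0 normr0 mul0r. Qed.

Let A_le k : A k <= (k == 1)%:R * (`|b| * eps) + K * \sum_(l < k.+1) A l * A (k - l)%N.
Proof.
rewrite {1}/A coefE; apply: (@le_trans _ _ (((k == 1)%:R * `|b| +
  \sum_(l < k.+1) K * `|coef l| * `|coef (k - l)%N|) * eps ^+ k)).
  rewrite ler_wpM2r ?exprn_ge0 ?(ltW eps0) // (le_trans (ler_normD _ _)) // lerD //.
    by rewrite normrZ ger0_norm.
  by rewrite (le_trans (ler_norm_sum _ _ _)) // ler_sum.
rewrite mulrDl lerD //.
  by case: eqP => [->|_]; rewrite ?expr1 ?mul1r // !mul0r.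
rewrite mulr_suml mulr_sumr ler_sum // => l _.
have lk : (l <= k)%N by rewrite -ltnS.
have -> : eps ^+ k = eps ^+ l * eps ^+ (k - l) by rewrite -exprD subnKC.
by rewrite /A le_eqVlt; apply/orP; left; apply/eqP; ring.
Qed.

(** The partial sums satisfy [S_M.+1 <= |b| eps + K * S_M ^ 2], and the bound [2 |b|
  eps] is stable under this recursion when [eps] is small. *)
Lemma coef_sum_le M : \sum_(k < M.+1) A k <= S.
Proof.
elim: M => [|M IH]; first by rewrite big_ord1 A0.
apply: (@le_trans _ _ (`|b| * eps + K * (\sum_(k < M.+1) A k) ^+ 2)); last first.
  have h : (\sum_(k < M.+1) A k) ^+ 2 <= S ^+ 2.
    by apply: lerXn2r; rewrite ?nnegrE // sumr_ge0.
  have h2 : K * (\sum_(k < M.+1) A k) ^+ 2 <= K * S ^+ 2 by rewrite ler_wpM2l // ltW.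
  have h3 : 4 * (K * S) * S <= 1 * S by rewrite ler_wpM2r.
  have h4 : 4 * (K * S ^+ 2) <= S by move: h3; rewrite mul1r expr2 !mulrA.
  have SE : S = 2 * (`|b| * eps) by rewrite /S mulrA.
  have aux (s t x : R) : s = 2 * t -> 4 * x <= s -> 0 <= s -> t + x <= s by lra.
  by apply: le_trans (lerD (lexx _) h2) _; exact: aux SE h4 S0.
apply: (@le_trans _ _ (\sum_(k < M.+2) ((k == 1 :> nat)%:R * (`|b| * eps) +
   K * \sum_(l < k.+1) A l * A (k - l)%N))); first by apply: ler_sum => k _; exact: A_le.
rewrite big_split /=; apply: lerD.
  rewrite -mulr_suml -[leRHS]mul1r ler_wpM2r ?mulr_ge0 ?(ltW eps0) //.
  by rewrite 2!big_ord_recl /= mulr0n add0r big1 ?addr0.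
rewrite -mulr_sumr ler_wpM2l ?(ltW K0) // (sum_triangle (fun i j => A i * A j)).
rewrite big_ord_recr /= [X in _ + X]big1 => [|j]; last first.
  rewrite -[leqRHS]addn0 leq_add2l leqn0 => /eqP->; by rewrite A0 mulr0.
rewrite addr0 expr2 mulr_suml ler_sum // => i _; rewrite mulr_sumr.
rewrite big_mkcond big_ord_recr /= -[leRHS]addr0 lerD //.
  by apply: ler_sum => j _; case: ifP => // _; rewrite mulr_ge0.
case: ifP => // h; have -> : i = 0%N :> nat by apply/eqP; rewrite -leqn0 -(leq_add2r M.+1).
by rewrite A0 mul0r.
Qed.

Definition psum M (y : R) : V := \sum_(k < M.+1) y ^+ k *: coef k.

Lemma psum_tail k M y : `|y| <= eps -> (k <= M)%N ->
  `|psum M y - psum k y| <= (`|y| / eps) ^+ k.+1 * S.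
Proof.
move=> ye kM; rewrite /psum -(big_mkord predT (fun k => y ^+ k *: coef k)).
rewrite -(big_mkord predT (fun k => y ^+ k *: coef k)).
rewrite (@big_cat_nat _ _ _ k.+1) //= addrAC subrr add0r.
apply: le_trans (ler_norm_sum _ _ _) _.
apply: (@le_trans _ _ ((`|y| / eps) ^+ k.+1 * \sum_(k.+1 <= i < M.+1) A i)).
  rewrite mulr_sumr !big_nat ler_sum // => i /andP[ki _].
  rewrite normrZ normrX /A.
  have -> : `|y| ^+ i = (`|y| / eps) ^+ i * eps ^+ i.
    by rewrite -exprMn divfK // gt_eqF.
  rewrite -mulrA (mulrC (eps ^+ i)) ler_wpM2r // ?A_ge0 //.
  apply: ler_wiXn2l => //; first by rewrite divr_ge0 // ltW.
  by rewrite ler_pdivrMr // mul1r.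
rewrite ler_wpM2l ?exprn_ge0 ?divr_ge0 ?(ltW eps0) //.
apply: le_trans (coef_sum_le M); rewrite -(big_mkord predT A).
by rewrite [leRHS](@big_cat_nat _ _ _ k.+1) //= lerDr sumr_ge0.
Qed.

Let normA k y : `|y ^+ k *: coef k| = (`|y| / eps) ^+ k * A k.
Proof.
rewrite normrZ normrX /A.
have -> : `|y| ^+ k = (`|y| / eps) ^+ k * eps ^+ k by rewrite -exprMn divfK // gt_eqF.
by rewrite -mulrA (mulrC (eps ^+ k)).
Qed.

(** A partial sum solves the equation up to those products of its terms whose degree
  exceeds [M.+1]. *)
Lemma psum_residual M y : `|y| <= eps ->
  `|psum M.+1 y - y *: b - B (psum M.+1 y) (psum M.+1 y)| <=
    (`|y| / eps) ^+ M * (K * S ^+ 2).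
Proof.
move=> ye; pose z k := y ^+ k *: coef k.
have th0 : 0 <= `|y| / eps by rewrite divr_ge0 // ltW.
have th1 : `|y| / eps <= 1 by rewrite ler_pdivrMr // mul1r.
have E : psum M.+1 y = y *: b + \sum_(i < M.+2) \sum_(j < M.+2 | (i + j <= M.+1)%N) B (z i) (z j).
  rewrite -(sum_triangle (fun i j => B (z i) (z j))) /psum.
  transitivity (\sum_(k < M.+2) (y ^+ k *: ((k == 1 :> nat)%:R *: b) +
     \sum_(l < k.+1) B (z l) (z (k - l)%N))).
    apply: eq_bigr => k _; rewrite coefE scalerDr scaler_sumr; congr (_ + _).
    apply: eq_bigr => l _; have lk : (l <= k)%N by rewrite -ltnS.
    by rewrite /z BZ -exprD subnKC.
  rewrite big_split /=; congr (_ + _).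
  rewrite 2!big_ord_recl /= mulr0n scale0r scaler0 add0r scale1r expr1 big1 ?addr0 // => i _.
  by rewrite scaler0.
rewrite {1}E (addrAC (y *: b)) subrr add0r /psum Bsum -sumrB.
have -> : \sum_(i < M.+2) (\sum_(j < M.+2 | (i + j <= M.+1)%N) B (z i) (z j) -
    \sum_(j < M.+2) B (z i) (z j)) =
   - \sum_(i < M.+2) \sum_(j < M.+2 | ~~ (i + j <= M.+1)%N) B (z i) (z j).
  rewrite -sumrN; apply: eq_bigr => i _.
  by rewrite [X in _ - X](bigID (fun j : 'I_M.+2 => (i + j <= M.+1)%N)) /= opprD addrA subrr add0r.
rewrite normrN; apply: le_trans (ler_norm_sum _ _ _) _.
apply: (@le_trans _ _ (\sum_(i < M.+2) \sum_(j < M.+2) (`|y| / eps) ^+ M * K * (A i * A j))).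
  apply: ler_sum => i _; apply: le_trans (ler_norm_sum _ _ _) _.
  rewrite big_mkcond ler_sum // => j _; case: ifP => [ij|_]; last first.
    by rewrite !mulr_ge0 ?exprn_ge0 // ltW.
  apply: le_trans (BK _ _) _; rewrite /z !normA.
  have -> : K * ((`|y| / eps) ^+ i * A i) * ((`|y| / eps) ^+ j * A j) =
     (`|y| / eps) ^+ (i + j) * (K * (A i * A j)) by rewrite exprD; ring.
  rewrite -mulrA; apply: ler_wpM2r.
    by apply: mulr_ge0; [exact: ltW|apply: mulr_ge0; exact: A_ge0].
  by apply: ler_wiXn2l => //; move: ij; rewrite -ltnNge => /ltnW/ltnW.
under eq_bigr do rewrite -mulr_sumr -mulr_sumr.
rewrite -mulr_sumr -mulr_suml -expr2 -mulrA ler_wpM2l ?exprn_ge0 // ler_wpM2l ?(ltW K0) //.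
by apply: lerXn2r; rewrite ?nnegrE ?coef_sum_le // sumr_ge0.
Qed.

(** The partial sums converge geometrically, and their limit satisfies the equation. The
  Lipschitz bound comes from the equation, whose quadratic term is a contraction on the
  ball of radius [S]. *)
Lemma power_series_solution : exists gam : R -> V,
  [/\ forall y k, `|y| <= eps -> `|gam y - psum k y| <= (`|y| / eps) ^+ k.+1 * S,
      forall y, `|y| < eps -> gam y = y *: b + B (gam y) (gam y),
      gam 0 = 0 &
      forall y z, `|y| < eps -> `|z| < eps -> `|gam y - gam z| <= 2 * `|b| * `|y - z|].
Proof.
have H y : exists x : V, `|y| <= eps -> forall k, `|x - psum k y| <= (`|y| / eps) ^+ k.+1 * S.
  have [ye|ye] := leP `|y| eps; last by exists 0.
  have Hi i : exists x : R, forall k, `|x - psum k y 0 i| <= (`|y| / eps) ^+ k.+1 * S.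
    apply: (@tail_bound_limit _ (fun k => psum k y 0 i)) => k M kM.
    by have := le_trans (mx_norm_le _ 0 i) (psum_tail ye kM); rewrite !mxE.
  have [x Hx] := choice Hi.
  exists (\row_i x i) => _ k; apply: mx_norm_lub => [|j i].
    by rewrite mulr_ge0 // exprn_ge0 // divr_ge0 // ltW.
  by rewrite !mxE ord1; exact: Hx.
have [gam Hgam] := choice H.
have gamS y : `|y| <= eps -> `|gam y| <= S.
  move=> ye; have := Hgam y ye 0%N; rewrite /psum big_ord1 coef0 scaler0 subr0 expr1 => h.
  by rewrite (le_trans h) // -[leRHS]mul1r ler_wpM2r // ler_pdivrMr // mul1r.
have gamE y : `|y| < eps -> gam y = y *: b + B (gam y) (gam y).
  move=> ye; have yle := ltW ye.
  have th0 : 0 <= `|y| / eps by rewrite divr_ge0 // ltW.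
  have th1 : `|y| / eps < 1 by rewrite ltr_pdivrMr // mul1r.
  apply/eqP; rewrite -subr_eq0 -normr_le0 opprD addrA.
  apply: (@geometric_le0 _ _ (S + K * S ^+ 2 + K * S * S + K * S * S) _ th0 th1) => k.
  have Pk : `|psum k.+1 y| <= S.
    have := psum_tail yle (leq0n k.+1); rewrite [psum 0 y]big_ord1 coef0 scaler0 subr0 expr1 => h.
    by rewrite (le_trans h) // -[leRHS]mul1r ler_wpM2r // ltW.
  have := Hgam y yle k.+1; have := psum_residual k yle.
  set P := psum k.+1 y in Pk *; set th := `|y| / eps in th0 th1 * => h1 h2.
  have h2' : `|gam y - P| <= th ^+ k * S.
    apply: (le_trans h2); rewrite ler_wpM2r //; by apply: ler_wiXn2l; rewrite ?(ltW th1) ?(leqW (leqnSn k)).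
  have -> : gam y - y *: b - B (gam y) (gam y) = (gam y - P) + (P - y *: b - B P P) +
     - B (gam y - P) P + - B (gam y) (gam y - P).
    by rewrite BBl BBr; apply/rowP => i; rewrite !mxE; ring.
  have h3 : `|B (gam y - P) P| <= th ^+ k * (K * S * S).
    apply: (le_trans (BK _ _)).
    have -> : th ^+ k * (K * S * S) = K * (th ^+ k * S) * S by ring.
    apply: ler_pM => //; first by rewrite mulr_ge0 // ltW.
    by rewrite ler_wpM2l // ltW.
  have h4 : `|B (gam y) (gam y - P)| <= th ^+ k * (K * S * S).
    apply: (le_trans (BK _ _)).
    have -> : th ^+ k * (K * S * S) = K * S * (th ^+ k * S) by ring.
    apply: ler_pM => //; first by rewrite mulr_ge0 // ltW.
    by rewrite ler_wpM2l ?gamS // ltW.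
  rewrite !mulrDr.
  do 2 (apply: le_trans (ler_normD _ _) _; rewrite normrN; apply: lerD => //).
  by apply: le_trans (ler_normD _ _) _; apply: lerD.
exists gam; split => // [y k ye||y z ye ze].
- exact: Hgam.
- have e0 : `|0 : R| <= eps by rewrite normr0 ltW.
  have := Hgam 0 e0 0%N; rewrite /psum big_ord1 coef0 scaler0 subr0 normr0 mul0r expr1 mul0r.
  by rewrite normr_le0 => /eqP.
- have E : gam y - gam z = (y - z) *: b + (B (gam y - gam z) (gam y) + B (gam z) (gam y - gam z)).
    by rewrite {1}gamE // {1}(gamE z) // BBl BBr scalerBl; apply/rowP => i; rewrite !mxE; ring.
  set D := `|gam y - gam z|.
  have h1 : `|B (gam y - gam z) (gam y)| <= K * S * D.
    apply: le_trans (BK _ _) _; rewrite -/D.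
    have -> : K * S * D = K * D * S by ring.
    by rewrite ler_wpM2l ?gamS ?(ltW ye) // mulr_ge0 ?normr_ge0 // ltW.
  have h2 : `|B (gam z) (gam y - gam z)| <= K * S * D.
    apply: le_trans (BK _ _) _; rewrite -/D ler_wpM2r ?normr_ge0 //.
    by rewrite ler_wpM2l ?gamS ?(ltW K0) ?(ltW ze).
  have h3 : D <= `|y - z| * `|b| + (K * S * D + K * S * D).
    by rewrite {1}/D E -normrZ; do 2 (apply: le_trans (ler_normD _ _) _; apply: lerD => //).
  have h4 : 4 * (K * S) * D <= 1 * D by rewrite ler_wpM2r // normr_ge0.
  have aux (d t s : R) : d <= t + (s + s) -> 4 * s <= d -> d <= 2 * t by lra.
  have -> : 2 * `|b| * `|y - z| = 2 * (`|y - z| * `|b|) by ring.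
  by apply: (@aux D (`|y - z| * `|b|) (K * S * D)); rewrite // -[leRHS]mul1r mulrA.
Qed.

(** Along the curve a linear functional is a real power series: all its coefficients
  vanish, or the first nonzero one dominates. This alternative fails for smooth curves,
  which is why the curve is built as a power series. *)
Lemma power_series_functional (gam : R -> V) (l : V -> R) (L : R) :
  (forall y k, `|y| <= eps -> `|gam y - psum k y| <= (`|y| / eps) ^+ k.+1 * S) ->
  linear_for *%R l -> (forall x, `|l x| <= L * `|x|) ->
  (forall y, `|y| < eps -> l (gam y) = 0) \/
  exists k, exists c C d : R, [/\ (0 < k)%N, 0 < c, 0 < d &
    forall y, `|y| < d -> c * `|y| ^+ k <= `|l (gam y)| <= C * `|y| ^+ k].
Proof.
move=> Hgam ll lL.
pose lf : {linear V -> R^o} := HB.pack (l : V -> R^o) (GRing.isLinear.Build _ _ _ _ _ ll).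
have lB u v : l (u - v) = l u - l v by exact: (linearB lf).
have lsum M y : l (psum M y) = \sum_(k < M.+1) y ^+ k * l (coef k).
  rewrite /psum -[LHS]/(lf _) linear_sum; apply: eq_bigr => k _; exact: (linearZ_LR lf).
have L0 : 0 <= Num.max L 0 by rewrite le_max lexx orbT.
have lM x : `|l x| <= Num.max L 0 * `|x|.
  by rewrite (le_trans (lL x)) // ler_wpM2r // le_max lexx.
move: {L} (Num.max L 0) L0 lM {lL} => L L0 lL.
have lgam y k : `|y| <= eps -> `|l (gam y) - l (psum k y)| <= (`|y| / eps) ^+ k.+1 * (L * S).
  move=> ye; rewrite -lB (le_trans (lL _)) // mulrCA ler_wpM2l //; exact: Hgam.
have [Hz|] := pselect (forall k, l (coef k) = 0).
  left=> y ye.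
  have th0 : 0 <= `|y| / eps by rewrite divr_ge0 // ltW.
  have th1 : `|y| / eps < 1 by rewrite ltr_pdivrMr // mul1r.
  apply/eqP; rewrite -normr_le0.
  apply: (@geometric_le0 _ _ (L * S) _ th0 th1) => k.
  have := lgam y k (ltW ye); rewrite lsum big1 => [|i _]; last by rewrite Hz mulr0.
  rewrite subr0 => /le_trans; apply; apply: ler_wpM2r; first exact: mulr_ge0.
  by apply: ler_wiXn2l; rewrite ?(ltW th1) ?leqnSn.
move/existsNP => [k0 /eqP k0P].
have ex : exists k, l (coef k) != 0 by exists k0.
right; case: (ex_minnP ex) => k; set A1 := l (coef k) => A1P kmin {k0 k0P ex}.
have k_gt0 : (0 < k)%N.
  rewrite lt0n; apply/eqP => k0; move: A1P; rewrite /A1 k0 coef0.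
  by rewrite -[l 0]/(lf 0) linear0 eqxx.
have a0 : 0 < `|A1| by rewrite normr_gt0.
have e1 : 0 < eps ^+ k.+1 by rewrite exprn_gt0.
pose M := L * S / eps ^+ k.+1 + 1.
have M0 : 0 < M by rewrite ltr_wpDl // divr_ge0 ?mulr_ge0 // ltW.
exists k, (`|A1| / 2), (2 * `|A1|), (Num.min eps (`|A1| / (2 * M))).
split => //; [by rewrite divr_gt0|by rewrite lt_min eps0 divr_gt0 // mulr_gt0|].
move=> y; rewrite lt_min => /andP[ye yM].
have := lgam y k (ltW ye); rewrite lsum big_ord_recr /= big1 => [|i _]; last first.
  have [->|li] := eqVneq (l (coef i)) 0; first by rewrite mulr0.
  by have := kmin _ li; rewrite leqNgt ltn_ord.
rewrite add0r -/A1 => h.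
have h2 : (`|y| / eps) ^+ k.+1 * (L * S) <= `|A1| / 2 * `|y| ^+ k.
  apply: (@le_trans _ _ (`|y| * M * `|y| ^+ k)).
    have -> : (`|y| / eps) ^+ k.+1 * (L * S) = `|y| * (L * S / eps ^+ k.+1) * `|y| ^+ k.
      by rewrite expr_div_n exprS; ring.
    by rewrite ler_wpM2r ?exprn_ge0 // ler_wpM2l // lerDl.
  rewrite ler_wpM2r ?exprn_ge0 //; move: yM; rewrite ltr_pdivlMr ?mulr_gt0 // => yM.
  have aux (u v w : R) : u * (2 * v) < w -> u * v <= w / 2 by lra.
  exact: aux yM.
have h3 := le_trans h h2.
have E : `|y ^+ k * A1| = `|A1| * `|y| ^+ k by rewrite normrM normrX mulrC.
have := ler_distD 0 (l (gam y)) (y ^+ k * A1); have := ler_normD (l (gam y) - y ^+ k * A1) (y ^+ k * A1).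
have := ler_normD (y ^+ k * A1 - l (gam y)) (l (gam y)).
rewrite !subrK E (distrC (y ^+ k * A1)) => h4 h5 _.
have Y0 : 0 <= `|A1| * `|y| ^+ k by rewrite mulr_ge0 ?exprn_ge0.
have aux (x Y D : R) : D <= Y / 2 -> Y <= D + x -> x <= D + Y -> 0 <= Y -> Y / 2 <= x <= 2 * Y by lra.
have -> : `|A1| / 2 * `|y| ^+ k = `|A1| * `|y| ^+ k / 2 by ring.
have -> : 2 * `|A1| * `|y| ^+ k = 2 * (`|A1| * `|y| ^+ k) by ring.
apply: aux h4 h5 Y0; apply: (le_trans h3).
by have -> : `|A1| / 2 * `|y| ^+ k = `|A1| * `|y| ^+ k / 2 by ring.
Qed.

End PowerSeries.

Section QuadraticCurve.
Context {R : realType}.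
Import VectorInternalTheory.

Lemma row_linear_bound n (l : 'rV[R]_n -> R) : linear_for *%R l ->
  exists L, forall x, `|l x| <= L * `|x|.
Proof.
move=> ll.
pose lf : {linear 'rV[R]_n -> R^o} := HB.pack (l : _ -> R^o) (GRing.isLinear.Build _ _ _ _ _ ll).
exists (\sum_i `|l (delta_mx 0 i)|) => x.
rewrite {1}(row_sum_delta x) -[l _]/(lf _) linear_sum mulr_suml.
apply: le_trans (ler_norm_sum _ _ _) _; apply: ler_sum => i _.
by rewrite linearZ /= normrM mulrC ler_wpM2l // mx_norm_le.
Qed.

Lemma row_bilinear_bound n (B : 'rV[R]_n -> 'rV[R]_n -> 'rV[R]_n) :
  (forall v, linear (B^~ v)) -> (forall v, linear (B v)) ->
  exists2 K : R, 0 < K & forall u v, `|B u v| <= K * `|u| * `|v|.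
Proof.
move=> Bl Br.
pose l v : {linear 'rV[R]_n -> 'rV[R]_n} := HB.pack (B^~ v) (GRing.isLinear.Build _ _ _ _ _ (Bl v)).
pose r v : {linear 'rV[R]_n -> 'rV[R]_n} := HB.pack (B v) (GRing.isLinear.Build _ _ _ _ _ (Br v)).
pose S := \sum_i \sum_j `|B (delta_mx 0 i) (delta_mx 0 j)|.
have S0 : 0 <= S by do 2 apply: sumr_ge0 => ? _.
exists (S + 1) => [|u v]; first exact: ltr_wpDl.
apply: (@le_trans _ _ (S * `|u| * `|v|)); last first.
  by rewrite ler_wpM2r // ler_wpM2r // lerDl.
rewrite {1}(row_sum_delta u) {1}(row_sum_delta v) -[B _ _]/(l _ _) linear_sum !mulr_suml.
apply: le_trans (ler_norm_sum _ _ _) _; apply: ler_sum => i _.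
rewrite linearZ /= -[B _ _]/(r _ _) linear_sum !mulr_suml scaler_sumr.
apply: le_trans (ler_norm_sum _ _ _) _; apply: ler_sum => j _.
rewrite linearZ /= scalerA normrZ normrM mulrC -mulrA ler_wpM2l //.
by apply: ler_pM => //; exact: mx_norm_le.
Qed.

Context {V : vectType R}.
Local Notation rv := (@r2v R V).
Local Notation vr := (@v2r R V).
Context (F : V -> V) (q : V -> V -> V) (X0 b : V).
Hypothesis Fl : linear F.
Hypothesis ql : forall v, linear (q^~ v).
Hypothesis qr : forall v, linear (q v).
Hypothesis inj : forall v, F v + q X0 v + q v X0 = 0 -> v = 0.

(** The analytic implicit function theorem for a quadratic equation whose linearization
  at [X0] is injective: inverting the linearization gives [x = y b' + B (x, x)] in
  coordinates. *)
Lemma quadratic_curve : exists eps : R, exists X : R -> V, [/\ 0 < eps, X 0 = X0,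
  forall y, `|y| < eps -> F (X y) + q (X y) (X y) = F X0 + q X0 X0 + y *: b,
  forall l : V -> R, linear_for *%R l -> exists2 C, 0 < C &
    forall y z, `|y| < eps -> `|z| < eps -> `|l (X y) - l (X z)| <= C * `|y - z| &
  forall l : V -> R, linear_for *%R l -> l X0 = 0 ->
  (forall y, `|y| < eps -> l (X y) = 0) \/
  exists k, exists c C d : R, [/\ (0 < k)%N, 0 < c, 0 < d &
    forall y, `|y| < d -> c * `|y| ^+ k <= `|l (X y)| <= C * `|y| ^+ k]].
Proof.
pose Ff : {linear V -> V} := HB.pack F (GRing.isLinear.Build _ _ _ _ _ Fl).
pose qlf v : {linear V -> V} := HB.pack (q^~ v) (GRing.isLinear.Build _ _ _ _ _ (ql v)).
pose qrf v : {linear V -> V} := HB.pack (q v) (GRing.isLinear.Build _ _ _ _ _ (qr v)).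
pose T v := F v + q X0 v + q v X0.
have Tl : linear T.
  move=> a u v; rewrite /T Fl qr [q (_ + _) X0]ql !scalerDr.
  by rewrite [RHS]addrACA; congr (_ + _); rewrite addrACA.
pose Tf : 'End(V) := linfun (HB.pack T (GRing.isLinear.Build _ _ _ _ _ Tl) : {linear V -> V}).
have TfE v : Tf v = T v by rewrite lfunE.
have T0 : lker Tf == 0%VS.
  apply/eqP/vspaceP => v; rewrite memv_ker memv0 TfE; apply/eqP/eqP => [|->]; first exact: inj.
  by rewrite -TfE linear0.
have TK v : T (Tf^-1%VF v) = v.
  by rewrite -TfE -[LHS]comp_lfunE (lker0_compfV T0) id_lfunE.
pose n := dim V.
pose B (u v : 'rV[R]_n) : 'rV[R]_n := - vr (Tf^-1%VF (q (rv u) (rv v))).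
have Bl v : linear (B^~ v).
  move=> a x y; rewrite /B linearP /= [q (_ + _) _]ql linearP linearP /=.
  by rewrite opprD scalerN.
have Br v : linear (B v).
  move=> a x y; rewrite /B linearP /= qr linearP linearP /=.
  by rewrite opprD scalerN.
have [K K0 BK] := row_bilinear_bound Bl Br.
pose b' := vr (Tf^-1%VF b).
pose eps := (8 * (K * `|b'|) + 1)^-1.
have den0 : 0 < 8 * (K * `|b'|) + 1 by rewrite ltr_wpDl // !mulr_ge0 // ltW.
have eps0 : 0 < eps by rewrite invr_gt0.
have small : 8 * (K * `|b'|) * eps <= 1 by rewrite ler_pdivrMr // mul1r lerDl.
have [gam [Hgam gamE gam0 gamL]] := power_series_solution Bl Br K0 BK eps0 small.
exists eps, (fun y => X0 + rv (gam y)); split => //.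
- by rewrite gam0 linear0 addr0.
- move=> y ye; set g := rv (gam y).
  have E : g = y *: Tf^-1%VF b - Tf^-1%VF (q g g).
    by rewrite /g {1}gamE // linearD linearZ /= /b' v2rK linearN /= v2rK.
  have E2 : T g + q g g = y *: b.
    rewrite {1}E; have -> : y *: (Tf^-1)%VF b - (Tf^-1)%VF (q g g) =
      (Tf^-1)%VF (y *: b - q g g) by rewrite linearB linearZ.
    by rewrite TK subrK.
  rewrite -E2 /T -[F _]/(Ff _) linearD /= -[q _ _]/(qlf _ _) linearD /=.
  rewrite -[q X0 _]/(qrf _ _) linearD /= -[q g _]/(qrf _ _) linearD /=.
  move: (F X0) (F g) (q X0 X0) (q X0 g) (q g X0) (q g g) => x1 x2 x3 x4 x5 x6.
  rewrite -!addrA; congr (_ + _); rewrite [LHS]addrCA; congr (_ + _).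

- move=> l ll.
  have lD u v : l (u + v) = l u + l v by have := ll 1 u v; rewrite scale1r mul1r.
  pose l' (x : 'rV[R]_n) := l (rv x).
  have ll' : linear_for *%R l' by move=> a u v; rewrite /l' linearP /= ll.
  have [L HL] := row_linear_bound ll'.
  exists ((`|L| + 1) * (2 * `|b'|) + 1) => [|y z ye ze].
    by rewrite ltr_wpDl // !mulr_ge0 // addr_ge0.
  rewrite !lD opprD addrACA subrr add0r.
  have -> : l (rv (gam y)) - l (rv (gam z)) = l' (gam y - gam z).
    by rewrite /l' linearB /=; have := ll (-1) (rv (gam z)) (rv (gam y));
      rewrite scaleN1r mulN1r (addrC (- rv _)) (addrC (- l _)).
  apply: (le_trans (HL _)).
  apply: (@le_trans _ _ ((`|L| + 1) * (2 * `|b'| * `|y - z|))).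
    apply: (@le_trans _ _ ((`|L| + 1) * `|gam y - gam z|)).
      by rewrite ler_wpM2r // (le_trans (ler_norm L)) // lerDl.
    by rewrite ler_wpM2l ?addr_ge0 // gamL.
  by rewrite !mulrA ler_wpM2r // lerDl.
- move=> l ll l0.
  have lD u v : l (u + v) = l u + l v by have := ll 1 u v; rewrite scale1r mul1r.
  pose l' (x : 'rV[R]_n) := l (rv x).
  have ll' : linear_for *%R l' by move=> a u v; rewrite /l' linearP /= ll.
  have [L HL] := row_linear_bound ll'.
  have E y : l (X0 + rv (gam y)) = l' (gam y) by rewrite lD l0 add0r.
  have [H|[k [c [C [d [k0 c0 d0 H]]]]]] := power_series_functional Bl eps0 Hgam ll' HL.
    by left=> y ye; rewrite E H.
  by right; exists k, c, C, d; split => // y yd; rewrite E H.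
Qed.

End QuadraticCurve.

(** * Central configurations with a defect along the kernel *)

Section CentralCurve.
Context {R : realType} {N : nat} {m : 'I_N -> R}.
Hypothesis hm : forall k, 0 < m k.
Hypothesis hN : (2 <= N)%N.
Local Notation dotm := (mass_dot m).
Local Notation nrm := (mass_norm m).
Local Notation O := (@noncoll R N).
Local Notation U := (potential m).
Local Notation f := (scaled_potential m).
Let oO : open O := @noncoll_open R N.
Let sf := smooth_scaled_potential hm hN.

(** The attraction on each body, with the inverse cubes of the distances replaced by
  coefficients [b]. *)
Definition force (b : 'M[R]_N) (x : config R N) : config R N :=
  \matrix_(k, i) \sum_j m j * b j k * (x j i - x k i).

Lemma force_linear_l x : linear (force^~ x).
Proof.
move=> c b b'; apply/matrixP => k i; rewrite !mxE mulr_sumr -big_split /=.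
by apply: eq_bigr => j _; rewrite !mxE; ring.
Qed.

Lemma force_linear_r b : linear (force b).
Proof.
move=> c x x'; apply/matrixP => k i; rewrite !mxE mulr_sumr -big_split /=.
by apply: eq_bigr => j _; rewrite !mxE; ring.
Qed.

Lemma forceE b x v : dotm (force b x) v =
  \sum_k \sum_(j | j != k) m j * m k * b j k * dot (sep j k x) (row k v).
Proof.
apply: eq_bigr => k _.
have -> : row k (force b x) = \sum_j (m j * b j k) *: sep j k x.
  apply/rowP => i; rewrite !mxE summxE; apply: eq_bigr => j _.
  by rewrite !mxE.
rewrite dot_suml mulr_sumr (bigD1 k) //= {1}/sep subrr scaler0 dot0l mulr0 add0r.
by apply: eq_bigr => j _; rewrite dotZl; ring.
Qed.

Local Notation unknowns :=
  (config R N * ('M[R]_N * 'M[R]_N * ('M[R]_N * 'M[R]_N)) * (R^o * R^o * R^o))%type.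
Implicit Types X Y : unknowns.

Definition u_x X : config R N := X.1.1.
Definition u_r X : 'M[R]_N := X.1.2.1.1.
Definition u_u X : 'M[R]_N := X.1.2.1.2.
Definition u_a X : 'M[R]_N := X.1.2.2.1.
Definition u_b X : 'M[R]_N := X.1.2.2.2.
Definition u_l X : R := X.2.1.1.
Definition u_be X : R := X.2.1.2.
Definition u_mu X : R := X.2.2.

Let uxl c X Y : u_x (c *: X + Y) = c *: u_x X + u_x Y. Proof. by []. Qed.
Let url c X Y : u_r (c *: X + Y) = c *: u_r X + u_r Y. Proof. by []. Qed.
Let uul c X Y : u_u (c *: X + Y) = c *: u_u X + u_u Y. Proof. by []. Qed.
Let ual c X Y : u_a (c *: X + Y) = c *: u_a X + u_a Y. Proof. by []. Qed.
Let ubl c X Y : u_b (c *: X + Y) = c *: u_b X + u_b Y. Proof. by []. Qed.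
Let ull c X Y : u_l (c *: X + Y) = c * u_l X + u_l Y. Proof. by []. Qed.
Let ubel c X Y : u_be (c *: X + Y) = c * u_be X + u_be Y. Proof. by []. Qed.
Let umul c X Y : u_mu (c *: X + Y) = c * u_mu X + u_mu Y. Proof. by []. Qed.
Lemma unknownsE (x : config R N) (r u a b : 'M[R]_N) (l be mu : R^o) :
  let X : unknowns := (x, (r, u, (a, b)), (l, be, mu)) in
  ((u_x X = x) * (u_r X = r) * (u_u X = u) * (u_a X = a) * (u_b X = b) * (u_l X = l) *
  (u_be X = be) * (u_mu X = mu))%type.
Proof. by []. Qed.
Let uE := (uxl, url, uul, ual, ubl, ull, ubel, umul).

Lemma unknownsD X Y : ((u_x (X + Y)%R = (u_x X + u_x Y)%R) * (u_r (X + Y)%R = (u_r X + u_r Y)%R) *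
  (u_u (X + Y)%R = (u_u X + u_u Y)%R) * (u_a (X + Y)%R = (u_a X + u_a Y)%R) * (u_b (X + Y)%R = (u_b X + u_b Y)%R) *
  (u_l (X + Y)%R = (u_l X + u_l Y)%R) * (u_be (X + Y)%R = (u_be X + u_be Y)%R) *
  (u_mu (X + Y)%R = (u_mu X + u_mu Y)%R))%type.
Proof. by []. Qed.

Lemma unknownsP X Y : u_x X = u_x Y -> u_r X = u_r Y -> u_u X = u_u Y -> u_a X = u_a Y ->
  u_b X = u_b Y -> u_l X = u_l Y -> u_be X = u_be Y -> u_mu X = u_mu Y -> X = Y.
Proof.
case: X => [[x [[r u] [a b]]] [[l be] mu]]; case: Y => [[x' [[r' u'] [a' b']]] [[l' be'] mu']].
by rewrite /u_x /u_r /u_u /u_a /u_b /u_l /u_be /u_mu /= => -> -> -> -> -> -> -> ->.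
Qed.

Context (p e : config R N).
Hypothesis Op : O p.
Hypothesis cp : p \in centered m.
Hypothesis np : nrm p = 1.
Hypothesis crit : forall u, pd u f p = 0.
Hypothesis se : slice (m := m) p e.
Hypothesis he : hess (m := m) p e = 0.
Hypothesis ne : dotm e e = 1.
Hypothesis ker1 : forall w, slice (m := m) p w -> hess (m := m) p w = 0 ->
  exists c : R, w = c *: e.

(** The equations of central configurations up to a defect in the kernel direction, made
  quadratic by auxiliary unknowns: the configuration [x], the squared distances [r], the
  inverse distances [u] with [a = u^2] and [b = u^3], and multipliers [l], [be], [mu].
  The equations are [r_jk = |x_j - x_k|^2 + delta_jk], [a = u^2], [a r = 1], [b = a u],
  [force b x + l x = be (rot p) + mu e], [<x, p> = 1], [<x, rot p> = 0] and [<x, e> =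
  y]. The Kronecker symbol makes the diagonal equations solvable. Solutions with [mu =
  0] are central configurations. *)
Definition eqn_lin X : unknowns :=
  (- u_be X *: rot p - u_mu X *: e, (u_r X, u_a X, (0, u_b X)),
   (dotm (u_x X) p, dotm (u_x X) (rot p), dotm (u_x X) e)).

Definition eqn_quad X Y : unknowns :=
  (force (u_b X) (u_x Y) + u_l X *: u_x Y,
   (\matrix_(j, k) - dot (sep j k (u_x X)) (sep j k (u_x Y)),
    \matrix_(j, k) - (u_u X j k * u_u Y j k),
    (\matrix_(j, k) (u_a X j k * u_r Y j k),
     \matrix_(j, k) - (u_a X j k * u_u Y j k))),
   (0, 0, 0)).

Lemma eqn_lin_linear : linear eqn_lin.
Proof.
move=> c X Y; apply: unknownsP; rewrite uE /eqn_lin ?uE !unknownsE //.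
- by apply/matrixP => k i; rewrite !mxE; ring.
- by rewrite scaler0 addr0.
- by rewrite mass_dotDl mass_dotZl.
- by rewrite mass_dotDl mass_dotZl.
- by rewrite mass_dotDl mass_dotZl.
Qed.

Lemma eqn_quad_linear_l Y : linear (eqn_quad^~ Y).
Proof.
move=> c X X'; apply: unknownsP; rewrite uE /eqn_quad ?uE !unknownsE.
- by rewrite force_linear_l scalerDl scalerDr -scalerA addrACA.
- by apply/matrixP => k i; rewrite !mxE sepD sepZ dotDl dotZl; ring.
- by apply/matrixP => k i; rewrite !mxE; ring.
- by apply/matrixP => k i; rewrite !mxE; ring.
- by apply/matrixP => k i; rewrite !mxE; ring.
- by rewrite mulr0 addr0.
- by rewrite mulr0 addr0.
- by rewrite mulr0 addr0.
Qed.

Lemma eqn_quad_linear_r X : linear (eqn_quad X).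
Proof.
move=> c Y Y'; apply: unknownsP; rewrite uE /eqn_quad ?uE !unknownsE.
- by rewrite force_linear_r; apply/matrixP => k i; rewrite !mxE; ring.
- by apply/matrixP => k i; rewrite !mxE sepD sepZ dotDr dotZr; ring.
- by apply/matrixP => k i; rewrite !mxE; ring.
- by apply/matrixP => k i; rewrite !mxE; ring.
- by apply/matrixP => k i; rewrite !mxE; ring.
- by rewrite mulr0 addr0.
- by rewrite mulr0 addr0.
- by rewrite mulr0 addr0.
Qed.

Let npp : dotm p p = 1. Proof. by rewrite -(mass_norm2 hm) np expr1n. Qed.

Lemma potential_crit_gt0 : 0 < U p.
Proof.
have [c c0 /(_ p Op)] := scaled_potential_lower hm hN.
by rewrite scaled_potentialE np mul1r; exact: lt_le_trans.
Qed.

Let pd_potential_crit v : pd v U p = - U p * dotm p v.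
Proof.
have := crit v; rewrite (pd_scaled_potential hm hN) // np divr1 mul1r => E.
have -> : pd v U p = (dotm p v * U p + pd v U p) - U p * dotm p v by ring.
by rewrite E; ring.
Qed.

Let is_diff_mass_dotl v r : is_diff r (fun r => dotm r v) (fun w => dotm w v).
Proof.
have H : is_diff r (fun r => \sum_k \sum_i m k * v k i * r k i)
    (fun w => \sum_k \sum_i m k * v k i * w k i).
  apply: is_diff_fsum => k _; apply: is_diff_fsum => i _.
  have D := is_diff_mxcoord r k i.
  by apply: is_diff_eqfun (is_diff_fmul (is_diff_fcst (m k * v k i) r) D) => w //; ring.
by apply: is_diff_eqfun H => w; rewrite mass_dotE //; apply: eq_bigr => k _;
  apply: eq_bigr => i _; ring.
Qed.

Lemma pd2_scaled_potential x v : dotm x p = 0 ->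
  pd x (pd v f) p = U p * dotm x v + pd x (pd v U) p.
Proof.
move=> xp; have sU := @smooth_potential R N m.
have xU : pd x U p = 0 by rewrite pd_potential_crit mass_dotC xp mulr0.
have pp0 : 0 < dotm p p by rewrite npp.
have D1 := @is_diff_rsqrt _ _ (fun r => dotm r r) _ _ pp0 (is_diff_mass_dot p).
have D2 := @is_diff_fsqrt _ _ (fun r => dotm r r) _ _ pp0 (is_diff_mass_dot p).
have D := is_diff_fadd
  (is_diff_fmul (is_diff_fmul (is_diff_mass_dotl v p) D1) (smooth_diff oO sU Op))
  (is_diff_fmul D2 (smooth_diff oO (smooth_pd oO v sU) Op)).
have E r : O r -> dotm r v * (Num.sqrt (dotm r r))^-1 * U r +
    Num.sqrt (dotm r r) * pd v U r = pd v f r.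
  by move=> Or; rewrite (pd_scaled_potential hm hN).
rewrite (is_diff_pd_ext oO x Op E D) -/(nrm p) np xU (mass_dotC p x) xp invr1; by field.
Qed.

(** The inverse distances, with the value that the equations impose on the diagonal. *)
Definition isep1 (j k : 'I_N) : R := if j == k then 1 else isep j k p.

Definition base : unknowns :=
  (p, (\matrix_(j, k) (isep1 j k)^-1 ^+ 2, \matrix_(j, k) isep1 j k,
       (\matrix_(j, k) isep1 j k ^+ 2, \matrix_(j, k) isep1 j k ^+ 3)),
   (U p, 0, 0)).

Lemma isep1_gt0 j k : 0 < isep1 j k.
Proof. by rewrite /isep1; case: eqP => // /eqP jk; exact: isep_gt0. Qed.

Let isep1_dot j k : (isep1 j k)^-1 ^+ 2 - dot (sep j k p) (sep j k p) = (j == k)%:R.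
Proof.
rewrite /isep1; have [->|jk] := eqVneq j k.
  by rewrite /sep subrr dot0l subr0 invr1 expr1n.
by rewrite /isep invrK enorm2 subrr.
Qed.

Let forceE_isep (b : 'M[R]_N) x v : O x -> (forall j k, j != k -> b j k = isep j k x ^+ 3) ->
  dotm (force b x) v = pd v U x.
Proof.
move=> Ox Hb; rewrite forceE pd_potential //; apply: eq_bigr => k _.
by apply: eq_bigr => j jk; rewrite Hb.
Qed.

Lemma eqn_base : eqn_lin base + eqn_quad base base =
  (0, (\matrix_(j, k) (j == k)%:R, 0, (const_mx 1, 0)), (1, 0, 0)).
Proof.
have [ce ep er] := se.
have i1 j k : isep1 j k != 0 by rewrite gt_eqF ?isep1_gt0.
apply: unknownsP; rewrite unknownsD /eqn_lin /eqn_quad /base !unknownsE.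
- rewrite oppr0 !scale0r subrr add0r.
  set w := _ + _; have H v : dotm w v = 0.
    rewrite mass_dotDl mass_dotZl (forceE_isep _ Op) ?pd_potential_crit //; first by ring.
    by move=> j k jk; rewrite !mxE /isep1 (negbTE jk).
  by apply/eqP; rewrite -(mass_dot_eq0 hm) H.
- by apply/matrixP => j k; rewrite !mxE isep1_dot.
- by apply/matrixP => j k; rewrite !mxE; ring.
- by apply/matrixP => j k; have := i1 j k; rewrite !mxE => h; field.
- by apply/matrixP => j k; rewrite !mxE; ring.
- by rewrite npp addr0.
- by rewrite dot_rot_self addr0.
- by rewrite mass_dotC ep addr0.
Qed.

(** Eliminating [r], [u], [a] and [b] turns the linearized force equation into a
  relation between [hess x] and the vectors [p], [rot p] and [e]. As these lie in the
  kernel of the Hessian, testing on them kills the multipliers; then [x] belongs to the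
  kernel line of [e] and is orthogonal to [e]. *)
Lemma eqn_inj Y : eqn_lin Y + eqn_quad base Y + eqn_quad Y base = 0 -> Y = 0.
Proof.
have [ce ep er] := se => H.
have i1 j k : isep1 j k != 0 by rewrite gt_eqF ?isep1_gt0.
have hx := congr1 u_x H; have hr := congr1 u_r H; have hu := congr1 u_u H.
have ha := congr1 u_a H; have hb := congr1 u_b H; have hl := congr1 u_l H.
have hbe := congr1 u_be H; have hmu := congr1 u_mu H.
move: hx hr hu ha hb hl hbe hmu.
rewrite !unknownsD /eqn_lin /eqn_quad /base !unknownsE !addr0.
set x := u_x Y; set r := u_r Y; set u := u_u Y; set a := u_a Y; set b := u_b Y.
set la := u_l Y; set be := u_be Y; set mu := u_mu Y.
move=> hx hr hu ha hb xp xr xe.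
have Er j k : r j k = 2 * dot (sep j k p) (sep j k x).
  by have /matrixP/(_ j k) := hr; rewrite !mxE (dotC (sep j k x)); lra.
have Ea j k : a j k = 2 * isep1 j k * u j k.
  by have /matrixP/(_ j k) := hu; rewrite !mxE => E; lra.
have Eu j k : u j k = - isep1 j k ^+ 3 * dot (sep j k p) (sep j k x).
  have /matrixP/(_ j k) := ha; rewrite !mxE Er Ea add0r => E.
  apply: (mulfI (x := 2 / isep1 j k)); first by rewrite mulf_neq0 ?invr_eq0.
  apply/eqP; rewrite -subr_eq0 -E; apply/eqP.
  by field; exact: i1.
have Eb j k : b j k = - 3 * isep1 j k ^+ 5 * dot (sep j k p) (sep j k x).
  have /matrixP/(_ j k) := hb; rewrite !mxE Ea Eu => E.
  by apply/eqP; rewrite -subr_eq0 -E; apply/eqP; ring.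
have W v : pd x (pd v U) p + U p * dotm x v + la * dotm p v - be * dotm (rot p) v -
    mu * dotm e v = 0.
  have : dotm (0 : config R N) v = 0 by rewrite mass_dot0l.
  rewrite -[X in dotm X v]hx !mdE !forceE => E; rewrite -[RHS]E pd_potential2 //.
  set S1 := \sum_k _; set S2 := \sum_k _; set S3 := \sum_k _.
  have -> : S1 = S2 + S3.
    rewrite -big_split; apply: eq_bigr => k _; rewrite -big_split; apply: eq_bigr => j jk.
    by rewrite /= Eb !mxE /isep1 (negbTE jk); ring.
  by ring.
have cx : x \in centered m.
  apply/(centeredP hN) => v tv; have := W v.
  have tz y : O y -> pd v U y = 0 by move=> Oy; exact: pd_potential_translation.
  have -> : pd x (pd v U) p = 0.
    rewrite (pd_ext oO x Op (smooth_pd oO v (@smooth_potential R N m)) tz).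
    exact: pd_cst.
  have cr : rot p \in centered m by exact: centered_rot.
  rewrite add0r (centeredP hN _ cp v tv) (centeredP hN _ cr v tv) (centeredP hN _ ce v tv) !mulr0.
  by rewrite !subr0 addr0 => /eqP; rewrite mulf_eq0 (gt_eqF potential_crit_gt0) => /eqP.
have sx : slice (m := m) p x by [].
have W2 v : dotm (hess (m := m) p x) v + la * dotm p v - be * dotm (rot p) v - mu * dotm e v = 0.
  by rewrite hessE // (smooth_pdC oO) // pd2_scaled_potential // -(W v); ring.
have hsx y : hess (m := m) p y = 0 -> dotm (hess (m := m) p x) y = 0.
  by move=> hy; rewrite hess_sym // hy mass_dotC mass_dot0l.
have rr : dotm (rot p) (rot p) = 1 by rewrite rot_dot.
have rp : dotm (rot p) p = 0 by rewrite mass_dotC dot_rot_self.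
have pr : dotm p (rot p) = 0 by rewrite dot_rot_self.
have re : dotm (rot p) e = 0 by rewrite mass_dotC.
have pe : dotm p e = 0 by rewrite mass_dotC.
have la0 : la = 0.
  by have := W2 p; rewrite hsx ?hess_self // npp rp ep; lra.
have be0 : be = 0.
  by have := W2 (rot p); rewrite hsx ?hess_rot // rr pr er; lra.
have mu0 : mu = 0.
  by have := W2 e; rewrite hsx // re pe ne; lra.
have hx0 : hess (m := m) p x = 0.
  have Z v : dotm (hess (m := m) p x) v = 0.
    by have := W2 v; rewrite la0 be0 mu0; lra.
  by apply/eqP; rewrite -(mass_dot_eq0 hm) Z.
have x0 : x = 0.
  have [c E] := ker1 sx hx0; move: xe; rewrite E mass_dotZl ne mulr1 => ->.
  by rewrite scale0r.
have dx j k : dot (sep j k p) (sep j k x) = 0 by rewrite x0 /sep !row0 subr0 dotC dot0l.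
apply: unknownsP => //; apply/matrixP => j k.
- by rewrite -/r Er dx !mxE mulr0.
- by rewrite -/u Eu dx !mxE mulr0.
- by rewrite -/a Ea Eu dx !mxE !mulr0.
- by rewrite -/b Eb dx !mxE mulr0.
Qed.

End CentralCurve.

Section CentralCurve.
Context {R : realType} {N : nat} {m : 'I_N -> R}.
Hypothesis hm : forall k, 0 < m k.
Hypothesis hN : (2 <= N)%N.
Local Notation dotm := (mass_dot m).
Local Notation nrm := (mass_norm m).
Local Notation O := (@noncoll R N).
Local Notation U := (potential m).
Local Notation f := (scaled_potential m).
Local Notation unknowns :=
  (config R N * ('M[R]_N * 'M[R]_N * ('M[R]_N * 'M[R]_N)) * (R^o * R^o * R^o))%type.
Implicit Types X Y : unknowns.
Context (p e : config R N).
Hypothesis Op : O p.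
Hypothesis cp : p \in centered m.
Hypothesis np : nrm p = 1.
Hypothesis crit : forall u, pd u f p = 0.
Hypothesis se : slice (m := m) p e.
Hypothesis he : hess (m := m) p e = 0.
Hypothesis ne : dotm e e = 1.
Hypothesis ker1 : forall w, slice (m := m) p w -> hess (m := m) p w = 0 ->
  exists c : R, w = c *: e.

(** Only the prescribed component along [e] varies. *)
Definition direction : unknowns := (0, (0, 0, (0, 0)), (0, 0, 1)).

(** Positivity of [u] makes it the inverse distance. Testing the force equation on
  translations, on [x] and on [rot x] shows that [x] is centered and expresses [l] and
  [be] through [mu]; the differential of [f] at [x] is then [mu] times an explicit form
  close to the product with [e]. *)
Lemma solution_central X y : eqn_lin (m := m) p e X + eqn_quad (m := m) X X =
    (0, (\matrix_(j, k) (j == k)%:R, 0, (const_mx 1, 0)), (1, 0, 0)) + y *: direction ->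
  (forall j k, 0 < u_u X j k) -> 0 < u_l X ->
  let x := u_x X in
  [/\ O x, x \in centered m,
    [/\ dotm x p = 1, dotm x (rot p) = 0 & dotm x e = y],
    forall q, slice (m := m) p q ->
      pd q f x = nrm x * u_mu X * (dotm e q - y / nrm x ^+ 2 * dotm x q) &
    u_mu X = 0 -> central_config m x].
Proof.
move=> H; set u := u_u X; set la := u_l X => u0 la0 x.
have uZ (Z : unknowns) : ((u_x (y *: Z) = y *: u_x Z) * (u_r (y *: Z) = y *: u_r Z) *
  (u_u (y *: Z) = y *: u_u Z) * (u_a (y *: Z) = y *: u_a Z) * (u_b (y *: Z) = y *: u_b Z) *
  (u_l (y *: Z) = (y * u_l Z)%R) * (u_be (y *: Z) = (y * u_be Z)%R) *
  (u_mu (y *: Z) = (y * u_mu Z)%R))%type by [].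
have hx := congr1 u_x H; have hr := congr1 u_r H; have hu := congr1 u_u H.
have ha := congr1 u_a H; have hb := congr1 u_b H; have hl := congr1 u_l H.
have hbe := congr1 u_be H; have hmu := congr1 u_mu H.
move: hx hr hu ha hb hl hbe hmu.
rewrite !unknownsD !uZ /eqn_lin /eqn_quad /direction !unknownsE !scaler0 !mulr0 mulr1 !addr0 !add0r.
rewrite -/x -/u -/la; set r := u_r X; set a := u_a X; set b := u_b X.
set be := u_be X; set mu := u_mu X.
move=> hx hr hu ha hb xp xr xe.
have Er j k : r j k = (j == k)%:R + dot (sep j k x) (sep j k x).
  by have /matrixP/(_ j k) := hr; rewrite !mxE => <-; ring.
have Ea j k : a j k = u j k ^+ 2.
  by have /matrixP/(_ j k) := hu; rewrite !mxE => /eqP; rewrite subr_eq0 => /eqP->; ring.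
have Eb j k : b j k = u j k ^+ 3.
  by have /matrixP/(_ j k) := hb; rewrite !mxE Ea => /eqP; rewrite subr_eq0 => /eqP->; ring.
have Eu j k : j != k -> u j k ^+ 2 * dot (sep j k x) (sep j k x) = 1.
  move=> jk; have /matrixP/(_ j k) := ha; rewrite !mxE Ea Er (negbTE jk) => <-.
  by rewrite add0r.
have Ox : O x.
  apply: noncollP => j k jk; apply/eqP => s0; have := Eu j k jk.
  by rewrite s0 dot0l mulr0 => /eqP; rewrite eq_sym oner_eq0.
have Es j k : j != k -> u j k = isep j k x.
  move=> jk; have uu := Eu j k jk; have u1 := u0 j k.
  rewrite /isep /enorm.
  have -> : dot (sep j k x) (sep j k x) = (u j k)^-1 ^+ 2.
    apply: (mulfI (x := u j k ^+ 2)); first by rewrite sqrf_eq0 gt_eqF.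
    by rewrite uu exprVn divff // sqrf_eq0 gt_eqF.
  by rewrite sqrtr_sqr gtr0_norm ?invr_gt0 // invrK.
have W v : pd v U x + la * dotm x v - be * dotm (rot p) v - mu * dotm e v = 0.
  have : dotm (0 : config R N) v = 0 by rewrite mass_dot0l.
  rewrite -[X in dotm X v]hx !mdE forceE => E; rewrite -[RHS]E pd_potential //.
  set S1 := \sum_k _; set S2 := \sum_k _.
  have -> : S1 = S2.
    by apply: eq_bigr => k _; apply: eq_bigr => j jk; rewrite Eb Es.
  by ring.
have [ce ep er] := se.
have cx : x \in centered m.
  apply/(centeredP hN) => v tv; have := W v.
  have cr : rot p \in centered m by exact: centered_rot.
  rewrite pd_potential_translation // (centeredP hN _ cr v tv) (centeredP hN _ ce v tv).
  by rewrite !mulr0 !subr0 add0r => /eqP; rewrite mulf_eq0 (gt_eqF la0) => /eqP.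
have n0 := noncoll_norm hm hN Ox.
have n2 := mass_norm2 hm x.
have fself := pd_scaled_potential_self hm hN Ox.
have frot := pd_scaled_potential_rot hm hN Ox.
rewrite !(pd_scaled_potential hm hN) // in fself frot.
have Wx := W x; have Wr := W (rot x).
have Uself : pd x U x = - U x.
  apply: (mulfI (x := nrm x)); first by rewrite gt_eqF.
  apply/eqP; rewrite -subr_eq0 -fself -n2; apply/eqP.
  by field; rewrite gt_eqF.
have Urot : pd (rot x) U x = 0.
  move: frot; rewrite dot_rot_self !mul0r add0r => /eqP.
  by rewrite mulf_eq0 (gt_eqF n0) => /eqP.
have bemu : be = - mu * dotm e (rot x).
  by move: Wr; rewrite Urot dot_rot_self rot_dot (mass_dotC p) xp; lra.
have lamu : la = (U x + mu * y) / nrm x ^+ 2.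
  move: Wx; rewrite Uself -n2 (mass_dotC e) xe (mass_dotC (rot p)) xr => E.
  apply: (mulIf (x := nrm x ^+ 2)); first by rewrite sqrf_eq0 gt_eqF.
  by rewrite divfK ?sqrf_eq0 ?gt_eqF //; lra.
split => //.
- move=> q [_ qp qr]; rewrite (pd_scaled_potential hm hN) //.
  have -> : pd q U x = - la * dotm x q + mu * dotm e q.
    by have := W q; rewrite (mass_dotC (rot p)) qr; lra.
  by rewrite lamu; field; rewrite gt_eqF.
- move=> mu0; apply: (central_configP (lambda := la)) => // v.
  by have := W v; rewrite bemu mu0; lra.
Qed.

(** The curve through [p] is parametrized by the component along the kernel direction,
  and the differential of [f] along it is governed by the single analytic function [mu].
  *)
Lemma central_curve : exists d C (gam : R -> config R N) (mu : R -> R),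
  [/\ 0 < d, 0 < C, gam 0 = p,
  forall y, `|y| < d -> [/\ O (gam y), gam y \in centered m,
    [/\ dotm (gam y) p = 1, dotm (gam y) (rot p) = 0 & dotm (gam y) e = y],
    forall q, slice (m := m) p q -> pd q f (gam y) =
      nrm (gam y) * mu y * (dotm e q - y / nrm (gam y) ^+ 2 * dotm (gam y) q) &
    mu y = 0 -> central_config m (gam y)] &
  (forall y z, `|y| < d -> `|z| < d -> nrm (gam y - gam z) <= C * `|y - z|) /\
  ((forall y, `|y| < d -> mu y = 0) \/
   exists k, exists c C d : R, [/\ (0 < k)%N, 0 < c, 0 < d &
     forall y, `|y| < d -> c * `|y| ^+ k <= `|mu y| <= C * `|y| ^+ k])].
Proof.
have [eps [X [eps0 X0 HX HL HD]]] := quadratic_curve direction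
  (eqn_lin_linear (m := m) p e) (eqn_quad_linear_l (m := m))
  (eqn_quad_linear_r (m := m)) (eqn_inj hm hN Op cp np crit se he ne ker1).
rewrite (eqn_base hm hN Op np crit se) in HX.
have l0 : linear_for *%R (fun X : unknowns => u_l X) by [].
have lmu : linear_for *%R (fun X : unknowns => u_mu X) by [].
have lu j k : linear_for *%R (fun X : unknowns => u_u X j k).
  by move=> a Y Z; rewrite -[LHS]/((a *: u_u Y + u_u Z) j k) !mxE.
have lx k i : linear_for *%R (fun X : unknowns => u_x X k i).
  by move=> a Y Z; rewrite -[LHS]/((a *: u_x Y + u_x Z) k i) !mxE.
have pos (l : unknowns -> R) : linear_for *%R l -> 0 < l (base (m := m) p) -> \forall y \near (0 : R), 0 < l (X y).
  move=> ll lp; have [C C0 H] := HL l ll.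
  apply/nbhs_ballP; exists (Num.min eps (l (base (m := m) p) / C)) => /=.
    by rewrite lt_min eps0 divr_gt0.
  move=> y; rewrite /ball /= sub0r normrN lt_min => /andP[ye].
  rewrite ltr_pdivlMr // => yC.
  have z0 : `|0 : R| < eps by rewrite normr0.
  have := H y 0 ye z0; rewrite X0 subr0 ler_distl => /andP[h _].
  by apply: lt_le_trans h; rewrite subr_gt0 mulrC.
have near_u1 (jk : 'I_N * 'I_N) : \forall y \near (0 : R), 0 < u_u (X y) jk.1 jk.2.
  apply: (pos (fun X : unknowns => u_u X jk.1 jk.2) (lu _ _)).
  by rewrite unknownsE mxE isep1_gt0.
have near_u : \forall y \near (0 : R), forall jk : 'I_N * 'I_N, 0 < u_u (X y) jk.1 jk.2.
  exact: filter_forall near_u1.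
have near_l : \forall y \near (0 : R), 0 < u_l (X y).
  by apply: (pos (fun X : unknowns => u_l X) l0); rewrite unknownsE; exact: potential_crit_gt0.
have near_ul : \forall y \near (0 : R), (forall jk : 'I_N * 'I_N, 0 < u_u (X y) jk.1 jk.2) /\
    0 < u_l (X y) by near=> y; split; near: y.
move/nbhs_ballP : near_ul => [d1 /= d10 Hd1].
pose d := Num.min eps d1.
have [K K0 HK] := mass_norm_equiv hm.
have HCk1 (ki : 'I_N * 'I_2) : exists C, 0 < C /\ forall y z, `|y| < eps -> `|z| < eps ->
    `|u_x (X y) ki.1 ki.2 - u_x (X z) ki.1 ki.2| <= C * `|y - z|.
  by case: ki => k i /=; have [C C0 H] := HL _ (lx k i); exists C.
have [Ck HCk] := choice HCk1.
pose S := \sum_ki Ck ki.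
have S0 : 0 <= S by apply: sumr_ge0 => ki _; case: (HCk ki) => /ltW.
exists d, (K * S + 1), (fun y => u_x (X y)), (fun y => u_mu (X y)).
split.
- by rewrite lt_min eps0.
- by rewrite ltr_wpDl // mulr_ge0 // ltW.
- by rewrite X0 unknownsE.
- move=> y; rewrite lt_min => /andP[ye yd].
  have [hu hl] : (forall jk : 'I_N * 'I_N, 0 < u_u (X y) jk.1 jk.2) /\ 0 < u_l (X y).
    by apply: Hd1; rewrite /ball /= sub0r normrN.
  by apply: (solution_central (HX y ye)) => // j k; exact: (hu (j, k)).
split.
- move=> y z; rewrite !lt_min => /andP[ye _] /andP[ze _].
  have [h _] := HK (u_x (X y) - u_x (X z)); apply: (le_trans h).
  apply: (@le_trans _ _ (K * (S * `|y - z|))); last first.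
    by rewrite mulrA ler_wpM2r // lerDl.
  rewrite ler_wpM2l ?(ltW K0) //; apply: mx_norm_lub => [|k i]; first by rewrite mulr_ge0.
  rewrite !mxE; have [_ /(_ y z ye ze) /= h2] := HCk (k, i); apply: (le_trans h2).
  rewrite ler_wpM2r // /S (bigD1 (k, i)) //= lerDl sumr_ge0 // => ki _.
  by case: (HCk ki) => /ltW.
- have mu0 : u_mu (base (m := m) p) = 0 by rewrite unknownsE.
  have [H|//] := HD _ lmu mu0; last by right.
  by left=> y; rewrite lt_min => /andP[ye _]; exact: H.
Unshelve. all: by end_near. Qed.

End CentralCurve.

(** * Kernels of dimension one *)

Section DegenerateOne.
Context {R : realType} {N : nat} {m : 'I_N -> R}.
Hypothesis hm : forall k, 0 < m k.
Hypothesis hN : (2 <= N)%N.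
Local Notation dotm := (mass_dot m).
Local Notation nrm := (mass_norm m).
Local Notation O := (@noncoll R N).
Local Notation f := (scaled_potential m).

Lemma SO2_act (A : 'M[R]_2) (x : config R N) : SO2 A ->
  act A x = simil (A 0 0) (A 1 0) x /\ A 0 0 ^+ 2 + A 1 0 ^+ 2 = 1.
Proof.
move=> [/matrixP AA dA].
have sum2 (F : 'I_2 -> R) : \sum_i F i = F 0 + F 1.
  by rewrite !big_ord_recl big_ord0 addr0; congr (_ + F _); exact/val_inj.
have := AA 0 0; have := AA 1 1; have := AA 0 1; rewrite !mxE !sum2 !mxE /= mulr0n !mulr1n.
move: dA; rewrite (expand_det_row _ 0) sum2 /cofactor !det_mx11 !mxE /=.
have -> : lift 0 0 = 1 :> 'I_2 by exact/val_inj.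
have -> : lift 1 0 = 0 :> 'I_2 by exact/val_inj.
rewrite expr0 expr1 mul1r mulN1r.
set a := A 0 0; set b := A 0 1; set c := A 1 0; set d := A 1 1 => dA ac cd ab.
have da : d = a.
  apply/eqP; rewrite -subr_eq0; apply/eqP.
  have -> : d - a = d * (1 - (a * a + b * b)) + a * (a * d + b * - c - 1) + b * (a * c + b * d) by ring.
  by rewrite ab dA ac !subrr !mulr0 !addr0.
have cb : c = - b.
  apply/eqP; rewrite -addr_eq0; apply/eqP.
  have -> : c + b = c * (1 - (a * a + b * b)) + a * (a * c + b * d) - b * (a * d + b * - c - 1) by ring.
  by rewrite ab dA ac !subrr !mulr0 oppr0 !addr0.
split; last by rewrite cb sqrrN !expr2.
apply/matrixP => k i; rewrite !mxE sum2 !mxE.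
have [->|i1] := eqVneq i 0; first by rewrite -/a -/b cb; ring.
have -> : i = 1 by apply/val_inj; case: i i1 => -[|[]].
by rewrite -/c -/d da; ring.
Qed.

Lemma equiv_simil (x z : config R N) : equiv_config x z ->
  exists a b : R, z = simil a b x.
Proof.
move=> [rho [A [rho0 /(SO2_act x)[E _] ->]]]; exists (rho * A 0 0), (rho * A 1 0).
by rewrite E /simil scalerDr !scalerA.
Qed.

Context (p e : config R N).
Hypothesis Op : O p.
Hypothesis cp : p \in centered m.
Hypothesis np : nrm p = 1.
Hypothesis crit : forall u, pd u f p = 0.

Let npp : dotm p p = 1. Proof. by rewrite -(mass_norm2 hm) np expr1n. Qed.

Hypothesis se : slice (m := m) p e.
Hypothesis he : hess (m := m) p e = 0.
Hypothesis ne : dotm e e = 1.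
Hypothesis ker1 : forall w, slice (m := m) p w -> hess (m := m) p w = 0 ->
  exists c : R, w = c *: e.

Lemma slice_equiv x z : dotm x p = 1 -> dotm x (rot p) = 0 -> dotm z p = 1 ->
  dotm z (rot p) = 0 -> equiv_config x z -> z = x.
Proof.
move=> xp xr zp zr /equiv_simil[a [b E]].
have a1 : a = 1.
  by move: zp; rewrite E /simil !mdE xp rot_dotl xr; lra.
have b0 : b = 0.
  by move: zr; rewrite E /simil !mdE xr rot_dot xp; lra.
by rewrite E a1 b0 simil1.
Qed.

(** Points of [p + slice] with different components along [e] are not equivalent. *)
Lemma central_family_infinite d (gam : R -> config R N) : 0 < d ->
  (forall y, `|y| < d -> [/\ dotm (gam y) p = 1, dotm (gam y) (rot p) = 0, dotm (gam y) e = y &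
    central_config m (gam y)]) ->
  ~ finite_set (central_classes m).
Proof.
move=> d0 Hg fin; pose y (n : nat) : R := d / n.+2%:R.
have yd n : `|y n| < d.
  rewrite ger0_norm ?divr_ge0 ?(ltW d0) // ltr_pdivrMr ?ltr0n //.
  by rewrite ltr_pMr // ltr1n.
pose F n := equiv_class (gam (y n)).
have injF : set_inj (F @^-1` central_classes m) F.
  move=> n k _ _ E.
  have [np1 nr1 ne1 _] := Hg _ (yd n); have [kp1 kr1 ke1 _] := Hg _ (yd k).
  have : F k (gam (y k)).
    exists 1, 1%:M; rewrite ltr01 /act trmx1 mulmx1 scale1r; split => //.
    by split; rewrite ?trmx1 ?mulmx1 ?det1.
  rewrite -E => /(slice_equiv np1 nr1 kp1 kr1) E2.
  have : y k = y n by rewrite -ke1 -ne1 E2.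
  move=> /(mulfI (lt0r_neq0 d0))/invr_inj/eqP; rewrite eqr_nat !eqSS => /eqP.
  by [].
have := finite_preimage injF fin.
have -> : F @^-1` central_classes m = setT.
  apply/seteqP; split => // n _ /=; exists (gam (y n)) => //=.
  by have [] := Hg _ (yd n).
exact: infinite_nat.
Qed.

(** When the segment is cut into [2 ^ k] pieces the quadratic errors add up to [O (2 ^
  -k)]. *)
Lemma chopped_increment (g : R -> R) (A B y : R) :
  (forall s t, `|s| <= `|y| -> `|t| <= `|y| -> `|g t - g s| <= A * `|t - s| + B * `|t - s| ^+ 2) ->
  `|g y - g 0| <= A * `|y|.
Proof.
move=> H; rewrite -subr_le0.
apply: (@geometric_le0 _ _ (B * `|y| ^+ 2) 2^-1) => // [|k]; first by rewrite invf_lt1 // ltr1n.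
pose K : R := (2 ^ k)%:R; have K0 : 0 < K by rewrite ltr0n expn_gt0.
have Hs i : (i <= 2 ^ k)%N -> `|y * i%:R / K| <= `|y|.
  move=> iK; rewrite -mulrA normrM -[leRHS]mulr1 ler_wpM2l //.
  by rewrite ger0_norm ?divr_ge0 ?ler0n ?(ltW K0) // ler_pdivrMr // mul1r ler_nat.
have S i : (i <= 2 ^ k)%N ->
    `|g (y * i%:R / K) - g 0| <= i%:R * (A * (`|y| / K) + B * (`|y| / K) ^+ 2).
  elim: i => [_|i IH iK]; first by rewrite mulr0 !mul0r subrr normr0.
  have := ler_normD (g (y * i.+1%:R / K) - g (y * i%:R / K)) (g (y * i%:R / K) - g 0).
  rewrite subrKA => /le_trans; apply.
  rewrite -natr1 mulrDl mul1r addrC lerD ?IH ?(ltnW iK) //.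
  have := H _ _ (Hs _ (ltnW iK)) (Hs _ iK).
  have -> : y * i.+1%:R / K - y * i%:R / K = y / K by rewrite -natr1; ring.
  have K1 : 0 <= K^-1 by rewrite invr_ge0 ltW.
  by rewrite normrM (ger0_norm K1) natr1.
have := S _ (leqnn _); rewrite -/K mulfK ?gt_eqF // => h.
rewrite lerBlDr; apply: (le_trans h); rewrite le_eqVlt; apply/orP; left; apply/eqP.
have -> : 2^-1 ^+ k = K^-1 by rewrite exprVn /K natrX.
by field; rewrite gt_eqF.
Qed.

(** Along the curve [gam] the differential of [f] is [mu] in the direction of [e]. If
  [mu] vanished identically, the curve would consist of pairwise inequivalent central
  configurations, infinitely many. Hence [|mu y|] is comparable to [|y| ^ k], and the
  reduction applies with [n = k] and [kappa = |y|], each point being compared with the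
  point of the curve that has the same component along [e]. *)
Lemma slice_lojasiewicz1 : finite_set (central_classes m) -> slice_lojasiewicz (m := m) p.
Proof.
move=> fin.
have [d [C [gam [mu [d0 C0 gam0 Hgam [gamL dich]]]]]] :=
  central_curve hm hN Op cp np crit se he ne ker1.
case: dich => [mu0|[k [c [C' [d' [k0 c0 d'0 Hmu]]]]]].
  exfalso; apply: (@central_family_infinite d gam d0) fin => y yd.
  by have [_ _ [h1 h2 h3] _ h4] := Hgam y yd; split => //; apply: h4; exact: mu0.
have [B [d2 [B0 d20 HB]]] := taylor_pot hm hN Op.
have [|lam lam0 Hlam] := @hess_coercive _ _ _ hm hN p Op [:: e].
  move=> w sw wk hw; have [a E] := ker1 sw hw.
  by have := wk e; rewrite inE eqxx E mass_dotZl ne mulr1 => /(_ isT)->; rewrite scale0r.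
have ne1 : nrm e = 1 by rewrite /mass_norm ne sqrtr1.
have C'0 : 0 < C'.
  pose y := d' / 2; have yd : `|y| < d' by rewrite ger0_norm /y ?divr_ge0 ?ltW //; lra.
  have y0 : 0 < `|y| ^+ k by rewrite exprn_gt0 // normr_gt0 /y mulf_neq0 ?gt_eqF.
  have /andP[h1 h2] := Hmu y yd; have := le_trans h1 h2.
  by rewrite ler_pM2r // => h; exact: lt_le_trans h.
pose D : R := Num.min d (Num.min d' (Num.min (4^-1 : R) (Num.min (1 / (2 * C)) (d2 / C)))).
have D0 : 0 < D.
  by rewrite !lt_min d0 d'0 invr_gt0 ltr0n !divr_gt0 // mulr_gt0.
have near_p (y : R) : `|y| < d -> nrm (gam y - p) <= C * `|y|.
  by move=> yd; have := gamL y 0 yd; rewrite normr0 gam0 subr0; exact.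
have sl (y : R) : `|y| < d -> slice (m := m) p (gam y - p).
  move=> yd; have [_ cg [h1 h2 _] _ _] := Hgam y yd.
  by split; rewrite ?memvB // !mass_dotBl ?h1 ?h2 ?npp ?dot_rot_self subrr.
have smallD (y : R) : `|y| < D -> [/\ `|y| < d, `|y| < d', `|y| < 4^-1, C * `|y| < 2^-1 & C * `|y| < d2].
  rewrite !lt_min => /and5P[h1 h2 h3 h4 h5]; split => //.
    by move: h4; rewrite ltr_pdivlMr ?mulr_gt0 //; lra.
  by move: h5; rewrite ltr_pdivlMr // mulrC.
have nbounds (y : R) : `|y| < D -> 2^-1 <= nrm (gam y) <= 2.
  move=> /smallD[yd _ _ yC _]; have := near_p y yd.
  have := mass_normD hm (gam y - p) p; have := mass_normD hm (p - gam y) (gam y).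
  rewrite !subrK np mass_normB; move: yC; set t := C * `|y|; set s := nrm _.
  by set s' := nrm _; lra.
have gupper (y : R) u : `|y| < D -> slice (m := m) p u ->
    `|pd u f (gam y)| <= 4 * C' * `|y| ^+ k * nrm u.
  move=> yD su; have [yd yd' y4 _ _] := smallD y yD.
  have /andP[nl nu] := nbounds y yD; have /andP[_ hmu] := Hmu y yd'.
  have [_ _ _ /(_ u su)-> _] := Hgam y yd.
  have n0 : 0 < nrm (gam y) by apply: lt_le_trans nl; rewrite invr_gt0.
  have ni : (nrm (gam y))^-1 <= 2 by rewrite invf_ple ?posrE.
  have u0 : 0 <= nrm u by exact: mass_norm_ge0.
  have h1 : `|dotm e u| <= nrm u by have := mass_CS hm e u; rewrite ne1 mul1r.
  have h2 : `|y / nrm (gam y) ^+ 2 * dotm (gam y) u| <= nrm u.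
    rewrite normrM normrM (ger0_norm (_ : 0 <= (nrm (gam y) ^+ 2)^-1)) ?invr_ge0 ?sqr_ge0 //.
    apply: (@le_trans _ _ (`|y| / nrm (gam y) ^+ 2 * (nrm (gam y) * nrm u))).
      apply: ler_wpM2l; last exact: mass_CS.
      by apply: divr_ge0; [exact: normr_ge0|exact: sqr_ge0].
    have -> : `|y| / nrm (gam y) ^+ 2 * (nrm (gam y) * nrm u) =
        `|y| * (nrm (gam y))^-1 * nrm u by field; rewrite gt_eqF.
    rewrite -[leRHS]mul1r ler_wpM2r //.
    have -> : 1 = 4^-1 * 4 :> R by rewrite mulVf.
    apply: ler_pM => //; [by rewrite invr_ge0 ltW|exact: ltW|].
    by apply: (le_trans ni); rewrite ler_nat.
  have h3 := ler_normB (dotm e u) (y / nrm (gam y) ^+ 2 * dotm (gam y) u).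
  have h4 : `|dotm e u - y / nrm (gam y) ^+ 2 * dotm (gam y) u| <= 2 * nrm u.
    have aux (a b t s : R) : t <= a + b -> a <= s -> b <= s -> t <= 2 * s by lra.
    exact: aux h3 h1 h2.
  rewrite !normrM (ger0_norm (ltW n0)).
  have -> : 4 * C' * `|y| ^+ k * nrm u = 2 * (C' * `|y| ^+ k) * (2 * nrm u) by ring.
  apply: ler_pM => //; first by rewrite mulr_ge0 // ltW.
  by apply: ler_pM => //; exact: ltW.
have glower (y : R) : `|y| < D -> c / 4 * `|y| ^+ k <= `|pd e f (gam y)|.
  move=> yD; have [yd yd' y4 _ _] := smallD y yD.
  have /andP[nl nu] := nbounds y yD; have /andP[hmu _] := Hmu y yd'.
  have [_ _ [_ _ ge] /(_ e se)-> _] := Hgam y yd; rewrite ne ge.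
  have n0 : 0 < nrm (gam y) by apply: lt_le_trans nl; rewrite invr_gt0.
  have ni : (nrm (gam y))^-1 <= 2 by rewrite invf_ple ?posrE.
  have y0 := normr_ge0 y.
  have h1 : `|y / nrm (gam y) ^+ 2 * y| <= 4^-1.
    have -> : y / nrm (gam y) ^+ 2 * y = y * (nrm (gam y))^-1 * (y * (nrm (gam y))^-1).
      by field; rewrite gt_eqF.
    have h : `|y * (nrm (gam y))^-1| <= 2^-1.
      rewrite normrM (ger0_norm (_ : 0 <= (nrm (gam y))^-1)) ?invr_ge0 ?(ltW n0) //.
      have -> : 2^-1 = 4^-1 * 2 :> R by field.
      by apply: ler_pM => //; [rewrite invr_ge0 ltW|exact: ltW].
    rewrite normrM; have -> : 4^-1 = 2^-1 * 2^-1 :> R by field.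
    exact: ler_pM.
  have h2 : 2^-1 <= `|1 - y / nrm (gam y) ^+ 2 * y|.
    have aux (t a b : R) : t <= a -> a <= 4^-1 -> 1 - t <= b -> 2^-1 <= b by lra.
    exact: aux (ler_norm _) h1 (ler_norm _).
  rewrite !normrM (ger0_norm (ltW n0)).
  have -> : c / 4 * `|y| ^+ k = 2^-1 * (c * `|y| ^+ k) * 2^-1 by field.
  apply: ler_pM => //; first by rewrite !mulr_ge0 ?invr_ge0 ?exprn_ge0 // ltW.
  by apply: ler_pM => //; rewrite mulr_ge0 ?exprn_ge0 // ltW.
have fvar (y : R) : `|y| < D -> `|f (gam y) - f p| <= 4 * C' * C * `|y| ^+ k.+1.
  move=> yD; rewrite -gam0 exprSr mulrA.
  have -> : 4 * C' * C * `|y| ^+ k = 4 * C' * `|y| ^+ k * C by ring.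
  apply: (@chopped_increment (f \o gam) _ (B * C ^+ 2)) => s t sy ty /=.
  have sD := le_lt_trans sy yD; have tD := le_lt_trans ty yD.
  have [sd _ _ _ sd2] := smallD s sD; have [td _ _ _ td2] := smallD t tD.
  have st : nrm (gam t - gam s) <= C * `|t - s| by exact: gamL.
  have := HB (gam s) (gam t - gam s); rewrite [gam s + (_ - gam s)]addrC subrK.
  move=> /(_ (le_lt_trans (near_p _ sd) sd2) (le_lt_trans (near_p _ td) td2)) h1.
  have sz : slice (m := m) p (gam t - gam s).
    have -> : gam t - gam s = (gam t - p) + (-1) *: (gam s - p).
      by rewrite scaleN1r opprB subrKA.
    by apply: sliceD; [exact: sl|apply: sliceZ; exact: sl].
  have h2 := gupper s _ sD sz.
  have h3 : 4 * C' * `|s| ^+ k * nrm (gam t - gam s) <= 4 * C' * `|y| ^+ k * (C * `|t - s|).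
    apply: ler_pM => //; rewrite ?mass_norm_ge0 //.
      by rewrite !mulr_ge0 ?exprn_ge0 // ltW.
    rewrite ler_wpM2l ?mulr_ge0 ?(ltW C'0) //.
    by apply: lerXn2r; rewrite ?nnegrE.
  have h4 : B * nrm (gam t - gam s) ^+ 2 <= B * (C * `|t - s|) ^+ 2.
    rewrite ler_wpM2l ?(ltW B0) //; apply: lerXn2r => //; rewrite nnegrE ?mass_norm_ge0 //.
    by rewrite mulr_ge0 // ltW.
  have := ler_normD (f (gam t) - f (gam s) - pd (gam t - gam s) f (gam s)) (pd (gam t - gam s) f (gam s)).
  rewrite subrK => /le_trans; apply; rewrite addrC lerD //.
    by rewrite (le_trans h2) // (le_trans h3) // -!mulrA.
  by rewrite (le_trans h1) // (le_trans h4) // exprMn mulrA.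
pose C1 := C + 4 * C' + 4 * C' * C.
apply: (@lyapunov_schmidt _ _ _ hm hN p Op k lam C1 (c / 4) D) => //.
- by rewrite !addr_gt0 // !mulr_gt0.
- by rewrite divr_gt0.
move=> z sz zD; pose y := dotm z e.
have yz : `|y| <= nrm z by have := mass_CS hm z e; rewrite ne1 mulr1.
have yD : `|y| < D by exact: le_lt_trans zD.
have [yd _ _ _ _] := smallD y yD.
have sY := sl y yd; pose w := z - (gam y - p).
have sw : slice (m := m) p w.
  by rewrite /w -scaleN1r; apply: sliceD => //; exact: sliceZ.
have we : dotm w e = 0.
  have [_ _ [_ _ h] _ _] := Hgam y yd; have [_ ep _] := se.
  by rewrite /w !mass_dotBl h (mass_dotC p) ep -/y; ring.
have k_ge0 : 0 <= `|y| ^+ k by rewrite exprn_ge0.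
pose ky : R := `|y|; exists (gam y - p), w, ky; split => //; first by rewrite /w addrC subrK.
split.
- by apply: hess_slice => //; case: sw.
- by apply: Hlam => // e'; rewrite inE => /eqP->.
- apply: (le_trans (near_p y yd)); apply: ler_pM => //; first exact: ltW.
  by rewrite /C1 -addrA lerDl addr_ge0 // !mulr_ge0 // ltW.
rewrite (addrC p) subrK; split => //.
- exact: normr_ge0.
- move=> u su; apply: (le_trans (gupper y u yD su)).
  rewrite ler_wpM2r ?mass_norm_ge0 // ler_wpM2r // /C1.
  by rewrite addrAC lerDr addr_ge0 ?(ltW C0) // !mulr_ge0 // ltW.
- by exists e; split => //; rewrite ?ne1 // glower.
- apply: (le_trans (fvar y yD)); rewrite ler_wpM2r ?exprn_ge0 // /C1 lerDr.
  by rewrite addr_ge0 ?(ltW C0) // !mulr_ge0 // ltW.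
Qed.

End DegenerateOne.

(** * Central configurations with small degeneracy *)

Section Kernel.
Context {R : realType} {N : nat} {m : 'I_N -> R}.
Hypothesis hm : forall k, 0 < m k.
Hypothesis hN : (2 <= N)%N.
Local Notation dotm := (mass_dot m).
Local Notation nrm := (mass_norm m).
Local Notation O := (@noncoll R N).
Local Notation f := (scaled_potential m).
Let oO : open O := @noncoll_open R N.
Let sf := smooth_scaled_potential hm hN.

Context (p : config R N).
Hypothesis Op : O p.
Hypothesis cp : p \in centered m.
Hypothesis np : nrm p = 1.
Hypothesis crit : forall u, pd u f p = 0.
Local Notation hess := (hess (m := m) p).
Local Notation slice := (slice (m := m) p).
Local Notation V := (subvs_of (centered m)).

Let npp : dotm p p = 1. Proof. by rewrite -(mass_norm2 hm) np expr1n. Qed.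

(** The second differential determines the operator, so the choice made in [hessian] is
  [hess]. *)
Lemma hessian_hess (x : V) : vsval (hessian m p x) = hess (vsval x).
Proof.
pose H0 (x : V) : V := vsproj (centered m) (hess (vsval x)).
have H0l : linear H0.
  move=> a u v; rewrite /H0 -linearP; congr vsproj.
  rewrite linearP /= -[X in _ + X]opprK -scaleN1r -scaleN1r scaleN1r scaleN1r.
  have -> : a *: vsval u + - - vsval v = a *: vsval u - (- 1) *: vsval v by rewrite scaleN1r.
  by rewrite (hessB hm hN Op) !(hessZ hm hN Op) scaleN1r opprK.
pose H1 : 'End(V) := linfun (HB.pack H0 (GRing.isLinear.Build _ _ _ _ _ H0l) : {linear V -> V}).
have d2 (u v : V) : diff2 f p (vsval u) (vsval v) = dotm (hess (vsval u)) (vsval v).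
  by rewrite diff2E hessE // (smooth_pdC oO).
have ex : exists H : 'End(V), forall x y : V,
    diff2 f p (vsval x) (vsval y) = dotm (vsval (H x)) (vsval y).
  exists H1 => u v; rewrite d2 lfunE /= /H0 vsprojK //.
  by apply: hess_centered => //; exact: subvsP.
have /= Hs := xgetPex 0 ex; rewrite -/(hessian m p) in Hs.
have ch : hess (vsval x) \in centered m by apply: hess_centered => //; exact: subvsP.
pose w := vsproj (centered m) (vsval (hessian m p x) - hess (vsval x)).
have wE : vsval w = vsval (hessian m p x) - hess (vsval x).
  by rewrite vsprojK // memvB // subvsP.
apply/eqP; rewrite -subr_eq0 -(mass_dot_eq0 hm) -{2}wE mass_dotBl -(Hs x w) d2.
by rewrite wE subrr.
Qed.

Lemma lker_hessian (x : V) : (x \in lker (hessian m p)) = (hess (vsval x) == 0).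
Proof.
rewrite memv_ker -hessian_hess; apply/eqP/eqP => [->|h]; first by rewrite linear0.
by apply: subvs_inj; rewrite h linear0.
Qed.

Lemma equiv_self : equiv_config p p.
Proof.
exists 1, 1%:M; rewrite ltr01 /act trmx1 mulmx1 scale1r; split => //.
by split; rewrite ?trmx1 ?mulmx1 ?det1.
Qed.

Lemma equiv_rot : equiv_config p (rot p).
Proof.
pose A : 'M[R]_2 := \matrix_(i, j) (if i == 0 then - (j != 0)%:R else (j == 0)%:R).
have sum2 (F : 'I_2 -> R) : \sum_i F i = F 0 + F 1.
  by rewrite !big_ord_recl big_ord0 addr0; congr (_ + F _); exact/val_inj.
exists 1, A; split; rewrite ?ltr01 //; last first.
  apply/matrixP => k i; rewrite scale1r !mxE sum2 !mxE /=.
  by case: ifP => _; ring.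
split.
  apply/matrixP => i j; rewrite !mxE sum2 !mxE /=.
  have one (l : 'I_2) : l != 0 -> l = 1 by case: l => -[|[]] // l0 _; exact/val_inj.
  by have [i0|/one i0] := eqVneq i 0; have [j0|/one j0] := eqVneq j 0; rewrite ?i0 ?j0 /=; ring.
rewrite (expand_det_row _ 0) sum2 /cofactor !det_mx11 !mxE /=.
by rewrite expr1; ring.
Qed.

Lemma reduced_kernelE w : reduced_kernel m p w <-> slice w /\ hess w = 0.
Proof.
split.
  move=> [x [xk xp] <-]; split; last by move: xk; rewrite lker_hessian => /eqP.
  split; first exact: subvsP.
  - by apply: xp; left; exact: equiv_self.
  - by apply: xp; left; exact: equiv_rot.
move=> [[cw wp wr] hw]; have wE : vsval (vsproj (centered m) w) = w by exact: vsprojK.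
exists (vsproj (centered m) w) => //; split; first by rewrite lker_hessian wE hw.
move=> q [/equiv_simil[a [b ->]]|->]; rewrite wE; last by rewrite mass_dot0r.
by rewrite /simil !mdE wp wr; ring.
Qed.

(** The kernel contains the four orthonormal vectors [p], [rot p], [e] and [e']. *)
Lemma lker_hessian_dim e e' : slice e -> slice e' -> hess e = 0 -> hess e' = 0 ->
  dotm e e = 1 -> dotm e' e' = 1 -> dotm e e' = 0 -> (2 <= degeneracy_degree m p)%N.
Proof.
move=> [ce ep er] [ce' ep' er'] he he' ne ne' ee'.
have cr : rot p \in centered m by exact: centered_rot.
pose P := vsproj (centered m).
pose X : 4.-tuple V := [tuple P p; P (rot p); P e; P e'].
have fX : free X.
  apply/freeP => k /(congr1 vsval); rewrite linear0 !big_ord_recl big_ord0 addr0 /=.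
  rewrite !vsprojK // => E.
  have D v : dotm (k ord0 *: p + (k (lift ord0 ord0) *: rot p + (k (lift ord0 (lift ord0 ord0)) *: e +
    k (lift ord0 (lift ord0 (lift ord0 ord0))) *: e'))) v = 0 by rewrite E mass_dot0l.
  have rp : dotm (rot p) p = 0 by rewrite mass_dotC dot_rot_self.
  have rr : dotm (rot p) (rot p) = 1 by rewrite rot_dot.
  have k0 := D p; have k1 := D (rot p); have k2 := D e; have k3 := D e'.
  rewrite !mdE npp rp ep ep' !mulr0 !addr0 mulr1 in k0.
  rewrite !mdE dot_rot_self rr er er' !mulr0 !addr0 add0r mulr1 in k1.
  rewrite !mdE !(mass_dotC _ e) ep er ne ee' !mulr0 !add0r addr0 mulr1 in k2.
  rewrite !mdE !(mass_dotC _ e') ep' er' (mass_dotC e') ne' ee' !mulr0 !add0r mulr1 in k3.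
  by case=> -[|[|[|[|i]]]] // hi; [rewrite -[RHS]k0|rewrite -[RHS]k1|rewrite -[RHS]k2|rewrite -[RHS]k3];
    congr (k _); exact/val_inj.
have sub : (<<X>> <= lker (hessian m p))%VS.
  apply/span_subvP => x; rewrite !inE lker_hessian => /or4P[] /eqP->; rewrite vsprojK //.
  - by rewrite hess_self.
  - by rewrite hess_rot.
  - by rewrite he.
  - by rewrite he'.
have := dimvS sub; rewrite (eqP (fX : free X)) /= => h.
by rewrite /degeneracy_degree (leq_sub2r 2 h).
Qed.

Lemma unit_multiple w : w != 0 -> dotm ((nrm w)^-1 *: w) ((nrm w)^-1 *: w) = 1.
Proof.
move=> w0; rewrite !mdE -(mass_norm2 hm); field.
by rewrite gt_eqF // (mass_norm_gt0 hm).
Qed.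

(** By the bound on the degeneracy, the kernel of the Hessian in the slice has dimension
  zero, one or two. The finiteness of the classes serves in dimension one, the condition
  on the cubic terms in dimension two. *)
Lemma slice_lojasiewicz_crit : finite_set (central_classes m) ->
  (degeneracy_degree m p <= 2)%N ->
  (degeneracy_degree m p = 2%N -> exists e5 e6 : config R N,
     orthonormal_basis2 m (reduced_kernel m p) e5 e6 /\ cubic_nondegenerate m p e5 e6) ->
  slice_lojasiewicz (m := m) p.
Proof.
move=> fin deg2 cubic.
have [inj|] := pselect (forall w, slice w -> hess w = 0 -> w = 0).
  exact: slice_lojasiewicz0 inj.
move=> /existsNP[w /not_implyP[sw /not_implyP[hw /eqP w0]]].
have [e [se he ne]] : exists e, [/\ slice e, hess e = 0 & dotm e e = 1].
  exists ((nrm w)^-1 *: w); split; [exact: sliceZ| |exact: unit_multiple].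
  by rewrite (hessZ hm hN Op) hw scaler0.
have [ker1|] := pselect (forall z, slice z -> hess z = 0 -> exists c : R, z = c *: e).
  exact: (slice_lojasiewicz1 hm hN Op cp np crit se he ne ker1 fin).
move=> /existsNP[z /not_implyP[sz /not_implyP[hz zne]]].
pose z' := z - dotm z e *: e.
have z'0 : z' != 0.
  by apply/eqP => E; apply: zne; exists (dotm z e); move/eqP: E; rewrite subr_eq0 => /eqP.
have sz' : slice z' by rewrite /z' -scaleNr; apply: sliceD => //; exact: sliceZ.
have hz' : hess z' = 0 by rewrite (hessB hm hN Op) (hessZ hm hN Op) he hz scaler0 subr0.
pose e' := (nrm z')^-1 *: z'.
have ee' : dotm e e' = 0.
  by rewrite /e' /z' !mdE ne mulr1 (mass_dotC e) subrr mulr0.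
have d2 : (2 <= degeneracy_degree m p)%N.
  apply: (@lker_hessian_dim e e') => //; [exact: sliceZ| |exact: unit_multiple].
  by rewrite (hessZ hm hN Op) hz' scaler0.
have [e5 [e6 [[[r5 r6] [n5 n6 n56] span] disc]]] : exists e5 e6 : config R N,
    orthonormal_basis2 m (reduced_kernel m p) e5 e6 /\ cubic_nondegenerate m p e5 e6.
  by apply: cubic; apply/eqP; rewrite eqn_leq deg2 d2.
have [s5 h5] := (reduced_kernelE e5).1 r5; have [s6 h6] := (reduced_kernelE e6).1 r6.
apply: (slice_lojasiewicz2 hm hN Op cp crit s5 s6 h5 h6 n5 n6 n56).
- by move=> x sx hx; apply: span; exact/reduced_kernelE.
- by move: disc; rewrite /cubic_nondegenerate !diff3E.
Qed.

End Kernel.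

Section Reversal.
Context {R : realType} {N : nat} {m : 'I_N -> R}.

Lemma is_derive_reverse (r : R -> config R N) (t : R) dr :
  is_derive (- t) (1 : R) r dr -> is_derive t (1 : R) (fun s => r (- s)) (- dr).
Proof.
move=> D; apply: is_derive_mx => k i.
have D1 := is_derive_coord k i D.
have D2 : is_derive t (1 : R) (-%R : R -> R) (-1) by exact: is_deriveNid.
have := @is_derive1_comp _ (fun s => r s k i) -%R t _ _ D1 D2.
by rewrite mulrN1 !mxE.
Qed.

Lemma total_collision_reverse (r : R -> config R N) (T b : R) :
  total_collision_backward m r T b ->
  total_collision_forward m (fun s => r (- s)) (- b) (- T).
Proof.
move=> [Tb sol r0]; split; [by rewrite ltrN2| |exact: (cvg_at_rightNP (fun t => mass_norm m (r t)) _ _).1 r0].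
have dr t : - b < t < - T -> is_derive t (1 : R) (fun s => r (- s)) (- (r^`()%classic (- t))).
  move=> /andP[h1 h2]; apply: is_derive_reverse.
  have [|_ _ [D _ _]] := sol (- t); first by rewrite /= ltrNr h2 ltrNl.
  by rewrite derive1E; exact: derivableP.
have near_in t : - b < t < - T -> \forall s \near t, - b < s < - T.
  by move=> /andP[h1 h2]; near=> s; apply/andP; split; near: s; [exact: lt_nbhsr|exact: lt_nbhsl].
have d1 t : - b < t < - T -> (fun s => r (- s))^`()%classic t = - (r^`()%classic (- t)).
  by move=> tI; rewrite derive1E; have [_ ->] := dr t tI.
have dr2 t : - b < t < - T ->
    is_derive t (1 : R) ((fun s => r (- s))^`()%classic) (r^`(2)%classic (- t)).
  move=> tI; apply: (@near_eq_is_derive _ _ _ (fun s => - (r^`()%classic (- s)))).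
    by near=> s; rewrite d1 //; near: s; exact: near_in.
  have [|_ _ [_ D _]] := sol (- t).
    by move: tI => /andP[h1 h2]; rewrite /= ltrNr h2 ltrNl.
  rewrite -[X in is_derive _ _ _ X]opprK; apply: is_deriveN.
  apply: is_derive_reverse; rewrite derive1nS derive1n1 (derive1E (r^`()%classic)).
  exact: derivableP.
move=> t tI; have [|c nc [_ _ newton]] := sol (- t).
  by move: tI => /= /andP[h1 h2]; rewrite ltrNr h2 ltrNl.
split; [exact: c|exact: nc|split].
- by have [D _] := dr t tI.
- by have [D _] := dr2 t tI.
- move=> k; rewrite -newton derive1nS derive1n1 derive1E.
  by have [_ ->] := dr2 t tI.
Unshelve. all: by end_near. Qed.

End Reversal.

Theorem theorem4p3 (R : realType) (N : nat) (m : 'I_N -> R)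
    (hN : (2 <= N)%N)
    (hm : forall k, 0 < m k)
    (hfinite : finite_set (central_classes m))
    (hdeg : forall r : config R N, central_config m r ->
       (degeneracy_degree m r <= 2)%N)
    (hcubic : forall r0 : config R N, central_config m r0 ->
       mass_norm m r0 = 1 -> degeneracy_degree m r0 = 2%N ->
       exists e5 e6 : config R N,
         orthonormal_basis2 m (reduced_kernel m r0) e5 e6 /\
         cubic_nondegenerate m r0 e5 e6) :
  (forall (r : R -> config R N) (a T : R), total_collision_forward m r a T ->
     exists2 r0 : config R N, central_config m r0 &
       normalized m (r t) @[t --> T^'-] --> r0) /\
  (forall (r : R -> config R N) (T b : R), total_collision_backward m r T b ->
     exists2 r0 : config R N, central_config m r0 &
       normalized m (r t) @[t --> T^'+] --> r0).
Proof.
have forward (r : R -> config R N) (a T : R) : total_collision_forward m r a T ->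
    exists2 r0 : config R N, central_config m r0 & normalized m (r t) @[t --> T^'-] --> r0.
  move=> C; have [w [sg [v [h [H sg0]]]]] := total_collision_mcgehee hm hN C.
  have aT : a < T by case: C.
  have [a' [p [Z [dZ [d [A [P [/andP[aa' a'T] d0 A0 P0 GL]]]]]]]] :=
    collision_gradient_like hm hN aT H sg0.
  have Op := gl_noncoll GL; have cp := gl_centered GL; have np := gl_unit GL.
  have crit := gl_crit GL.
  have ccp : central_config m p.
    apply: (crit_central_config hm hN Op cp); apply/matrixP => k i.
    by rewrite !mxE crit mulr0.
  exists p => //.
  apply: (gradient_like_cvg hm hN a'T (mcgehee_sub aa' H) d0 A0 P0 GL).
  apply: slice_to_lojasiewicz => //.
  apply: (slice_lojasiewicz_crit hm hN Op cp np crit hfinite (hdeg p ccp)).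
  exact: hcubic.
split => // r T b /total_collision_reverse/forward[r0 cc cv]; exists r0 => //.
exact: (cvg_at_rightNP (fun t => normalized m (r t)) _ _).2 cv.
Qed.
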